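(* There is a universal constant $C>0$ such that for every $n\ge 1$ and every square-integrable martingale difference sequence $Y=\{Y_m\}_{m=1}^n$ with $s_n>0$, the following hold. (i) For any N-function $\psi$ with $\psi\succcurlyeq x^2$, $$\mathcal W_1(X_n,\mathcal N)\le C\Big( L_\psi\log\left(e+L_\psi^{-2}\right)+\|V_n^2-1\|_{1/2}^{1/2}\Big).$$ (ii) For any $p>2$ and any N-function $\psi$ with $x^2\preccurlyeq\psi\preccurlyeq x^p$, $$\mathcal W_1(X_n,\mathcal N)\le C\Big( pL_\psi+\|V_n^2-1\|_{1/2}^{1/2}\Big).$$ As consequences, for any $p>2$, $$\mathcal W_1(X_n,\mathcal N)\le C\Big(\min\{p,\ \log(e+L_p^{-2})\}\,L_p+\|V_n^2-1\|_{1/2}^{1/2}\Big),$$ and, in particular, in the $L^\infty$ case, $$\mathcal W_1(X_n,\mathcal N)\le C\Big( L_\infty\log\left(e+L_\infty^{-2}\right)+\|V_n^2-1\|_{1/2}^{1/2}\Big).$$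
   Context: Martingale setting: $Y=\{Y_m\}_{m=1}^n$ is a square-integrable martingale difference sequence with respect to $\sigma$-fields $\{\mathcal F_m\}_{m=0}^n$, where $\mathcal F_0$ is trivial. Put $s_n^2=\sum_{i=1}^nE[Y_i^2]$, $\sigma_i^2(Y)=E[Y_i^2\mid\mathcal F_{i-1}]$, $V_n^2=\frac1{s_n^2}\sum_{i=1}^n\sigma_i^2(Y)$, $X_n=\frac1{s_n}\sum_{i=1}^nY_i$. $\mathcal N$ denotes a standard normal $N(0,1)$ random variable. For a random variable $U$ and $r>0$, $\|U\|_r=E[|U|^r]^{1/r}$ (so $\|V_n^2-1\|_{1/2}^{1/2}=E|V_n^2-1|^{1/2}$), and $\|U\|_\infty$ is the essential supremum of $|U|$. The Wasserstein distance of order $r\ge1$ is $\mathcal W_r(\mu,\nu)=\inf\{\|U-V\|_r:U\sim\mu,V\sim\nu\}$; random variables are used as synonyms of their distributions. An N-function is a convex $\psi:[0,\infty)\to[0,\infty)$ with $\lim_{x\to0}\psi(x)/x=0$, $\lim_{x\to\infty}\psi(x)/x=\infty$ and $\psi(x)>0$ for $x>0$ (as usual $\psi(0)=0$, so $\psi$ is an increasing bijection of $[0,\infty)$ with inverse $\psi^{-1}$). For functions $\psi_1,\psi_2:[0,\infty)\to[0,\infty)$, $\psi_1\preccurlyeq\psi_2$ (equivalently $\psi_2\succcurlyeq\psi_1$) means $\psi_2(x)/\psi_1(x)$ is non-decreasing on $(0,\infty)$. Here $x^p$ denotes the function $x\mapsto x^p$. Orlicz norm of the sequence: $\|Y\|_\psi=\inf\{c>0:\frac1n\sum_{i=1}^nE[\psi(|Y_i|/c)]\le1\}$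 (possibly $+\infty$, in which case the bound is trivial); $\|Y\|_\infty=\max_{1\le i\le n}\|Y_i\|_\infty$. Lyapunov-type coefficients: $$L_\psi=\frac1{s_n}\|Y\|_\psi\,\psi^{-1}(n),\qquad L_p=\frac1{s_n}\Big(\sum_{i=1}^nE|Y_i|^p\Big)^{1/p},\qquad L_\infty=\frac1{s_n}\|Y\|_\infty.$$ *)

(* Defs.v *)
From HB Require Import structures.
From mathcomp Require Import all_boot all_order all_algebra.
From mathcomp Require Import all_classical all_reals all_analysis.
From mathcomp Require Import measurable_realfun.

Set Implicit Arguments.
Unset Strict Implicit.
Unset Printing Implicit Defensive.

Import Order.TTheory GRing.Theory Num.Theory.
Import numFieldNormedType.Exports.

Local Open Scope classical_set_scope.
Local Open Scope ring_scope.

(* [F 0, ..., F n] is an increasing family of sub-sigma-algebras; the values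
   [F m] with [n < m] are irrelevant. *)
Definition filtration d (T : measurableType d) (n : nat)
    (F : nat -> set (set T)) : Prop :=
  (forall m, (m <= n)%N -> sigma_algebra setT (F m) /\ F m `<=` measurable) /\
  (forall m, (m < n)%N -> F m `<=` F m.+1).

Definition sigma_measurable d (T : measurableType d) (R : realType)
    (G : set (set T)) (Z : T -> R) : Prop :=
  preimage_set_system setT Z measurable `<=` G.

(* [Z] is a version of the conditional expectation E[X | G]. *)
Definition is_condexp d (T : measurableType d) (R : realType)
    (P : probability T R) (G : set (set T)) (X Z : T -> R) : Prop :=
  [/\ P.-integrable setT (EFin \o X),
      P.-integrable setT (EFin \o Z),
      sigma_measurable G Z &
      forall A, G A ->
        (\int[P]_(w in A) (Z w)%:E = \int[P]_(w in A) (X w)%:E)%E].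

(* The sequence is [Y 1, ..., Y n]; the other values of [Y] are irrelevant. *)
Definition martingale_difference d (T : measurableType d) (R : realType)
    (P : probability T R) (n : nat) (F : nat -> set (set T))
    (Y : nat -> {RV P >-> R}) : Prop :=
  forall m, (1 <= m <= n)%N ->
    sigma_measurable (F m) (Y m) /\ is_condexp P (F m.-1) (Y m) (cst 0).

Definition square_integrable d (T : measurableType d) (R : realType)
    (P : probability T R) (n : nat) (Y : nat -> {RV P >-> R}) : Prop :=
  forall m, (1 <= m <= n)%N -> (Y m : T -> R) \in Lfun P 2%:E.

(* [sigma2 m] is a version of E[Y_m ^ 2 | F_(m - 1)]. *)
Definition conditional_variances d (T : measurableType d) (R : realType)
    (P : probability T R) (n : nat) (F : nat -> set (set T))
    (Y : nat -> {RV P >-> R}) (sigma2 : nat -> T -> R) : Prop :=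
  forall m, (1 <= m <= n)%N ->
    is_condexp P (F m.-1) (fun w => Y m w ^+ 2) (sigma2 m).

(* [fine] is harmless for square-integrable sequences. *)
Definition s_ d (T : measurableType d) (R : realType)
    (P : probability T R) (n : nat) (Y : nat -> {RV P >-> R}) : R :=
  Num.sqrt (\sum_(1 <= i < n.+1) fine 'E_P[(fun w => Y i w ^+ 2)]).

Definition X_ d (T : measurableType d) (R : realType)
    (P : probability T R) (n : nat) (Y : nat -> {RV P >-> R}) : {RV P >-> R} :=
  (s_ n Y)^-1 *: \sum_(1 <= i < n.+1) (Y i : {mfun T >-> R}).

Definition V2_ d (T : measurableType d) (R : realType)
    (P : probability T R) (n : nat) (Y : nat -> {RV P >-> R})
    (sigma2 : nat -> T -> R) (w : T) : R :=
  (s_ n Y ^+ 2)^-1 * \sum_(1 <= i < n.+1) sigma2 i w.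

(* The infimum is over all pairs of random variables with the prescribed laws,
   defined on a common, arbitrary, probability space.  A law is given as a set
   function, as for [distribution] and [normal_prob]; only its values on Borel
   sets matter. *)
Definition wasserstein (R : realType) (r : R)
    (mu nu : set R -> \bar R) : \bar R :=
  ereal_inf [set x : \bar R |
    exists (d : measure_display) (S : measurableType d) (Q : probability S R)
      (U V : {RV Q >-> R}),
      [/\ forall A : set R, measurable A -> distribution Q U A = mu A,
          forall A : set R, measurable A -> distribution Q V A = nu A &
          x = ('N[Q]_(r%:E)[EFin \o (U \- V)%R])%E]].

(* Functions on [0, oo) are represented by functions on R, whose values at
   negative reals are never used. *)
Definition N_function (R : realType) (psi : R -> R) : Prop :=
  [/\ convex_function (`[0, +oo[%classic : set R^o) psi,
      psi 0 = 0,
      forall x, 0 < x -> 0 < psi x,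
      psi x / x @[x --> 0^'+] --> 0 &
      psi x / x @[x --> +oo] --> +oo].

Definition preccurly (R : realType) (psi1 psi2 : R -> R) : Prop :=
  {in `]0, +oo[ &, {homo (fun x => psi2 x / psi1 x) : x y / x <= y}}.

Definition psi_inv (R : realType) (psi : R -> R) : R -> R :=
  'pinv_(fun=> 0) `[0, +oo[ psi.

Definition orlicz_norm d (T : measurableType d) (R : realType)
    (P : probability T R) (n : nat) (Y : nat -> {RV P >-> R})
    (psi : R -> R) : \bar R :=
  ereal_inf [set c%:E | c in [set c : R | 0 < c /\
    ((n%:R^-1)%:E *
      \sum_(1 <= i < n.+1) 'E_P[(fun w => psi (`|Y i w| / c))%R] <= 1)%E]].

Definition L_psi d (T : measurableType d) (R : realType)
    (P : probability T R) (n : nat) (Y : nat -> {RV P >-> R})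
    (psi : R -> R) : \bar R :=
  ((s_ n Y)^-1%:E * orlicz_norm n Y psi * (psi_inv psi n%:R)%:E)%E.

Definition L_p d (T : measurableType d) (R : realType)
    (P : probability T R) (n : nat) (Y : nat -> {RV P >-> R})
    (p : R) : \bar R :=
  ((s_ n Y)^-1%:E *
    (\sum_(1 <= i < n.+1) 'E_P[(fun w => `|Y i w| `^ p)%R]) `^ p^-1)%E.

Definition L_infty d (T : measurableType d) (R : realType)
    (P : probability T R) (n : nat) (Y : nat -> {RV P >-> R}) : \bar R :=
  ((s_ n Y)^-1%:E *
    \big[maxe/0]_(1 <= i < n.+1) 'N[P]_(+oo)[EFin \o Y i])%E.

(* log (e + L^-2), for L in [0, +oo]; at L = +oo it is 1, and at L = 0 it is
   +oo, so that L * log_term L is 0 there. *)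
Definition log_term (R : realType) (L : \bar R) : \bar R :=
  lne ((expR 1)%:E + (L ^+ 2)^-1)%E.

(* || V_n^2 - 1 ||_(1/2)^(1/2) *)
Definition V2_term d (T : measurableType d) (R : realType)
    (P : probability T R) (n : nat) (Y : nat -> {RV P >-> R})
    (sigma2 : nat -> T -> R) : \bar R :=
  ('N[P]_((2^-1)%R%:E)[EFin \o (fun w => V2_ n Y sigma2 w - 1)%R] `^ 2^-1)%E.

Definition W1_normal d (T : measurableType d) (R : realType)
    (P : probability T R) (n : nat) (Y : nat -> {RV P >-> R}) : \bar R :=
  wasserstein 1 (distribution P (X_ n Y)) (normal_prob 0 1).

(* Main.v *)
(** Let [S] be the normalized sum and [Z] a standard normal variable.

    Coupling through quantile functions attains the Kantorovich dual bound
    for an explicit potential: if [h] has slope -1 where the distribution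
    function of [S] exceeds that of [Z] and slope 1 elsewhere, then the
    quantiles [U], [V] satisfy [|U - V| = h U - h V] pointwise.  So it suffices to bound
    [E h(S) - E h(Z)] for a 1-Lipschitz [h].

    Write [A_k] for the sum of the first [k] conditional variances and suppose
    [A_n <= 1], which is arranged by stopping.  Smooth [h] at time [k] with a
    Gaussian of the predictable bandwidth [r_k = sqrt (1 + delta^2 - A_k)] and
    telescope.  In each step the heat equation cancels the second-order terms,
    and the remainder is at most a constant times
    [E min (y_k^2 / r_(k+1), |y_k|^3 / r_(k+1)^2)].
    Jumps larger than [delta] contribute little by the choice of [delta];
    the others are compared, through the conditional variances, with the
    telescoping sum of [(r_k / delta)^(- 2 eta)], at a cost [delta / eta].
    Taking [eta = 1 / p] uses the p-th moments, while
    [eta = 1 / (2 ln (e + delta^-2))] uses only that [(r_k / delta)^eta] is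
    bounded; [delta] is the Lyapunov coefficient up to a factor 2.

    The stopping and the final smoothing cost [E |A_n - 1|^(1/2)], because
    [E |sum y_k| <= 2 E (sum v_k)^(1/2)]. *)

Require Import Defs.
From HB Require Import structures.
From mathcomp Require Import all_boot all_order all_algebra.
From mathcomp Require Import all_classical all_reals all_analysis.
From mathcomp Require Import measurable_realfun ess_sup_inf.
From mathcomp Require Import zify ring lra.
Set Implicit Arguments.
Unset Strict Implicit.
Unset Printing Implicit Defensive.
Import Order.TTheory GRing.Theory Num.Theory.
Import numFieldNormedType.Exports.
Local Open Scope classical_set_scope.
Local Open Scope ring_scope.

(** The bandwidth used after the [k]-th increment contains [v_k], which is known before that
    increment, so [y_k] and [y_k^2 - v_k] stay centred against every weight built from it. Of the
    size of the increments only two facts are kept: [sum E y_k^2 1(|y_k| > delta) <= delta^2] and,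
    for the power bound, [sum E |y_k|^p 1(|y_k| <= delta) <= delta^p]. The Lyapunov coefficients
    provide thresholds [delta] for which they hold. For a small jump put [u = |y_k| / delta <= 1]
    and [X = (r_(k+1) / delta)^2]; the cubic remainder is [delta u^2 (u / X)]. The terms [u^2 / X]
    alone, compared with the increments of [X], would sum to a logarithm; an extra factor
    [X^(- eta)] makes the sum at most a multiple of [1 / eta]. If [u <= X^(- eta)], the spare factor
    [u] supplies it. Otherwise [1 / X < u^(1 / eta)], and [eta = 1 / p] turns the remainder into a
    p-th moment. *)

(** * Quantile coupling and the dual bound for the Wasserstein distance *)

(** By complementation the measures agree on the rays []a, +oo[], a pi-system that generates the
    Borel sets and exhausts the line. *)
Lemma eq_probability_rays (R : realType) (m1 m2 : probability R R) :
  (forall x : R, m1 `]-oo, x]%classic = m2 `]-oo, x]%classic) ->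
  forall A, measurable A -> m1 A = m2 A.
Proof.
move=> m12 A mA.
apply: (@measure_unique _ R R (@RGenOInfty.G R) (fun k => `](-k%:R), +oo[%classic) _ _ _ _ m1 m2) => //.
- exact: RGenOInfty.measurableE.
- move=> _ _ [a ->] [b ->]; exists (Num.max a b).
  apply/seteqP; split=> x /=; rewrite !in_itv/= !andbT gt_max.
    by case=> -> ->.
  by move=> /andP[].
- by move=> k; exists (- k%:R).
- rewrite -subTset => x _; exists (Num.truncn (- x)).+1 => //=.
  by rewrite in_itv/= andbT ltrNl truncnS_gt.
- move=> _ [a ->].
  rewrite (_ : `]a, +oo[%classic = ~` `]-oo, a]%classic); last by rewrite setCitvl.
  have mr : measurable (`]-oo, a]%classic : set R).
    exact: measurable_itv.
  apply: (etrans (probability_setC m1 mr)).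
  by rewrite m12; apply/esym; exact: (probability_setC m2 mr).
- move=> k; rewrite (le_lt_trans (probability_le1 _ _)) ?ltry//.
Qed.

Section quantile_coupling.
Variable R : realType.
Local Notation Q := (@uniform_prob R 0 1 ltr01).

Lemma uniform_prob01 (A : set R) : measurable A ->
  Q A = lebesgue_measure (A `&` `[0, 1]%classic).
Proof.
move=> mA; rewrite /uniform_prob integral_uniform_pdf.
rewrite (eq_integral (fun=> 1%:E)); last first.
  by move=> x; rewrite inE/= in_itv/= /uniform_pdf => -[_ ->]; rewrite subr0 invr1.
rewrite integral_cst ?mul1e//; exact: measurableI.
Qed.

(** The equivalence with [cdf] is part of the conclusion because it serves twice: for the law of
    [U], and later to locate two quantiles at the same [w] relative to both distribution
    functions. *)
Lemma quantile_exists d (T : measurableType d) (P : probability T R)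
  (X : {RV P >-> R}) :
  exists U : {RV Q >-> R},
   (forall A, measurable A -> distribution Q U A = distribution P X A) /\
   forall w, 0 < w < 1 -> forall x, (U w <= x) = (w%:E <= cdf X x)%E.
Proof.
pose q w := inf [set x | (w%:E <= cdf X x)%E].
have qP w : 0 < w < 1 -> forall x, (q w <= x) = (w%:E <= cdf X x)%E.
  move=> /andP[w0 w1] x; set S := [set x | (w%:E <= cdf X x)%E].
  have S0 : S !=set0.
    apply/set0P/negP => /eqP S0.
    have : (1 <= w%:E)%E.
      apply: cvge_le (cvg_cdfy1 X); apply: nearW => y.
      rewrite leNgt; apply/negP => wy.
      by have : S y by [exact: ltW]; rewrite S0.
    by rewrite lee_fin leNgt w1.
  have [y0 yS] : exists y, (cdf X y < w%:E)%E.
    apply: contrapT => /forallNP ny.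
    have : (w%:E <= 0)%E.
      apply: cvge_ge (cvg_cdfNy0 X); apply: nearW => y.
      by rewrite leNgt; apply/negP.
    by rewrite lee_fin leNgt w0.
  have Slb : has_lbound S.
    exists y0 => z Sz; rewrite leNgt; apply/negP => zy.
    have := le_trans Sz (cdf_nondecreasing X (ltW zy)).
    by rewrite leNgt yS.
  have Sup y z : S y -> y <= z -> S z.
    by move=> Sy yz; rewrite /S/= (le_trans Sy)// cdf_nondecreasing.
  apply/idP/idP => [qx|Sx]; last exact: ge_inf.
  have gtS y : q w < y -> S y.
    move=> /inf_lt[//|z Sz zy]; apply: Sup Sz (ltW zy).
  have := @cdf_right_continuous _ _ _ _ X x.
  move=> cx; apply: cvge_ge cx.
  near=> y; apply: gtS; apply: le_lt_trans qx _; by near: y; exact: nbhs_right_gt.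
pose U0 w : R := if 0 < w < 1 then q w else 0.
have mU0 : measurable_fun setT U0.
  apply: measurable_fun_if => //=.
  - by apply: measurable_and => //; exact: measurable_fun_ltr.
  - apply: (measurability (@RGenOInfty.G R)) => [|/= _ [_] [r] -> <-].
      exact: RGenOInfty.measurableE.
    rewrite setTI.
    (* By [qP], [q] is monotone, so the preimage of a ray is an interval. *)
    apply: is_interval_measurable => s t/=.
    rewrite !in_itv/= !andbT => -[s01 rs] [t01 rt] u /andP[su ut].
    have u01 : 0 < u < 1 by move: s01 t01 su ut; lra.
    split=> //; rewrite in_itv/= andbT (lt_le_trans rs)// qP//.
    by rewrite (@le_trans _ _ u%:E) ?lee_fin// -qP.
have mU1 : @measurable_fun _ _ (measurableTypeR R) R setT U0 by exact: mU0.
have [U1 U1U0] : exists U1 : {RV Q >-> R}, forall w, U1 w = U0 w.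
  have U1 : {U1 : {RV Q >-> R} | forall w, U1 w = U0 w}.
    pose U1 : {RV Q >-> R} :=
      HB.pack U0 (@isMeasurableFun.Build _ _ (measurableTypeR R) R U0 mU1).
    by exists U1.
  by exists (sval U1) => w; exact: (svalP U1).
exists U1; have U1E w : 0 < w < 1 -> U1 w = q w by rewrite U1U0 /U0 => ->.
split; last by move=> w w01 x; rewrite U1E// qP.
apply: eq_probability_rays => x.
change (Q (U1 @^-1` `]-oo, x]%classic) = cdf X x).
have mA : measurable (U1 @^-1` `]-oo, x]%classic).
  by rewrite -[X in measurable X]setTI; apply: measurable_funP.
rewrite uniform_prob01//.
set F := cdf X x.
have F0 : (0 <= F)%E by exact: cdf_ge0.
have F1 : (F <= 1)%E by exact: cdf_le1.
have [f Ff] : exists f : R, F = f%:E.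
  by exists (fine F); rewrite fineK// fin_numElt (lt_le_trans (ltNyr 0) F0) (le_lt_trans F1 (ltry 1)).
have f0 : 0 <= f by rewrite -lee_fin -Ff.
have f1 : f <= 1 by rewrite -lee_fin -Ff.
apply/eqP; rewrite eq_le; apply/andP; split.
(* The endpoint 1 is added as a null set because [U1] takes its default value 0 there. *)
- apply: (@le_trans _ _ (lebesgue_measure (`[0, f] `|` `[1, 1]%classic : set R))).
    apply: le_measure; rewrite ?inE//; try exact: measurableI; try exact: measurableU.
    move=> w [] /=; rewrite !in_itv/= => Uw /andP[w0 w1].
    have [w01|] := boolP (0 < w < 1).
      left; move: Uw; rewrite U1E// qP// -/F Ff lee_fin; lra.
    rewrite negb_and -!leNgt => /orP[w0'|]; [left|right]; lra.
  apply: (@le_trans _ _ (lebesgue_measure (`[0%R, f]%classic : set R) +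
      lebesgue_measure (`[1%R, 1%R]%classic : set R))%E); first exact: measureU2.
  rewrite !lebesgue_measure_itv/= !lte_fin ltxx adde0 Ff sube0.
  by case: ifP => // _; rewrite lee_fin.
- apply: (@le_trans _ _ (lebesgue_measure (`]0, f[%classic : set R))).
    rewrite lebesgue_measure_itv/= lte_fin Ff sube0.
    by case: ltgtP f0 => // <-.
  apply: le_measure; rewrite ?inE//; try exact: measurableI.
  move=> w /=; rewrite !in_itv/= => wf.
  have w01 : 0 < w < 1 by lra.
  split; last by lra.
  rewrite U1E// qP// -/F Ff lee_fin; lra.
Unshelve. all: by end_near. Qed.

Lemma wasserstein1_lip d (T : measurableType d) (P : probability T R)
  (X : {RV P >-> R}) d' (T' : measurableType d') (P' : probability T' R)
  (Z : {RV P' >-> R}) :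
  P.-integrable setT (EFin \o X) -> P'.-integrable setT (EFin \o Z) ->
  exists h : R -> R, (forall x y, `|h x - h y| <= `|x - y|) /\
   (wasserstein 1 (distribution P X) (distribution P' Z) <=
    (\int[P]_w h (X w) - \int[P']_w h (Z w))%:E)%E.
Proof.
move=> iX iZ.
have [U [dU qU]] := quantile_exists X.
have [V [dV qV]] := quantile_exists Z.
pose D := [set x | (cdf Z x < cdf X x)%E].
have mD : measurable D.
  by rewrite -[D]setTI; apply: measurable_lte => //; exact: cdf_measurable.
pose lam a b := fine (lebesgue_measure (D `&` `[a, b[%classic)).
have lamfin a b : lebesgue_measure (D `&` `[a, b[%classic) \is a fin_num.
  rewrite ge0_fin_numE//.
  apply: (@le_lt_trans _ _ (lebesgue_measure (`[a, b[%classic : set R))).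
    by apply: le_measure; rewrite ?inE//; exact: measurableI.
  by rewrite lebesgue_measure_itv/=; case: ifP; rewrite ?ltry.
have lam0 a b : 0 <= lam a b by rewrite fine_ge0.
have lam_le a b : a <= b -> lam a b <= b - a.
  move=> ab; rewrite -lee_fin fineK//.
  apply: (@le_trans _ _ (lebesgue_measure (`[a, b[%classic : set R))).
    by apply: le_measure; rewrite ?inE//; exact: measurableI.
  rewrite lebesgue_measure_itv/= lte_fin; case: ltP => //.
  by rewrite lee_fin subr_ge0.
have lamD a b c : a <= b -> b <= c -> lam a c = lam a b + lam b c.
  move=> ab bc; apply/EFin_inj; rewrite EFinD !fineK//.
  rewrite (_ : D `&` `[a, c[ = (D `&` `[a, b[) `|` (D `&` `[b, c[))%classic.
    rewrite measureU//; try exact: measurableI.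
    rewrite -subset0 => x [[_ /=]]; rewrite !in_itv/= => H1 [_] H2; lra.
  apply/seteqP; split => x /=; rewrite !in_itv/=.
    move=> [Dx H]; case: (ltP x b) => xb; [left|right]; split=> //; lra.
  by move=> [[Dx H]|[Dx H]]; split=> //; lra.
(* The primitive of the indicator of [D] that vanishes at 0. *)
pose k y := if 0 <= y then lam 0 y else - lam y 0.
have kB y z : y <= z -> k z - k y = lam y z.
  move=> yz; rewrite /k; case: (leP 0 y) => y0; case: (leP 0 z) => z0.
  - by rewrite (lamD 0 y z)//; lra.
  - lra.
  - by rewrite (lamD y 0 z)//; lra.
  - by rewrite (lamD y z 0)//; lra.
(* slope -1 on [D] and 1 outside *)
pose h y := y - 2 * k y.
have hlip x y : `|h x - h y| <= `|x - y|.
  wlog xy : x y / x <= y.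
    move=> W; case: (leP x y) => xy; first exact: W.
    by rewrite distrC [leRHS]distrC; apply: W; exact: ltW.
  have -> : h x - h y = - (y - x) + 2 * lam x y by rewrite -kB// /h; lra.
  rewrite (distrC x) (ger0_norm (_ : 0 <= y - x)) ?subr_ge0// ler_norml.
  by have := lam0 x y; have := lam_le x y xy; lra.
exists h; split=> //.
have hc : continuous h.
  move=> x; apply/cvgrPdist_le => e e0; near=> y.
  apply: le_trans (hlip _ _) _; near: y.
  apply/nbhs_ballP; exists e => //= z; exact: ltW.
have mh : measurable_fun setT h by exact: continuous_measurable_fun.
have ih : forall d0 (T0 : measurableType d0) (P0 : probability T0 R)
    (X0 : T0 -> R), measurable_fun setT X0 -> P0.-integrable setT (EFin \o X0) ->
    P0.-integrable setT (EFin \o (h \o X0)).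
  move=> d0 T0 P0 X0 mX0 iX0.
  apply: (@le_integrable _ _ _ _ _ measurableT _
     (fun w => abse ((`|h 0|)%:E + abse ((X0 w)%:E)))%E).
  - by apply/measurable_EFinP; exact: measurableT_comp.
  - move=> w _ /=; rewrite lee_fin.
    have := hlip (X0 w) 0; have := ler_normD (h (X0 w) - h 0) (h 0).
    rewrite subrK subr0 => H1 H2.
    by do 2 apply: le_trans _ (ler_norm _); lra.
  - apply: integrable_abse; apply: integrableD => //; last exact: integrable_abse.
    exact: finite_measure_integrable_cst.
(* A point [x] with [U w <= x < V w] satisfies [cdf Z x < w <= cdf X x], so this interval lies in
   [D]; if [V w < U w], the interval between them misses [D]. *)
have key w : 0 < w < 1 -> `|U w - V w| = h (U w) - h (V w).
  move=> w01; case: (leP (U w) (V w)) => UV.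
  - have : lam (U w) (V w) = V w - U w.
      rewrite /lam (_ : D `&` _ = `[U w, V w[%classic).
        rewrite lebesgue_measure_itv/= lte_fin; case: ltP => //= ?; lra.
      apply/seteqP; split=> x /=; first by case.
      move=> xUV; split=> //; move: xUV; rewrite in_itv/= => /andP[Ux xV].
      rewrite /D/=; apply: (@lt_le_trans _ _ w%:E).
        by rewrite ltNge -qV// -ltNge.
      by rewrite -qU.
    rewrite -kB// /h distrC ger0_norm ?subr_ge0//; lra.
  - have : lam (V w) (U w) = 0.
      rewrite /lam (_ : D `&` _ = set0) ?measure0//.
      rewrite -subset0 => x [/=]; rewrite in_itv/= => Dx /andP[Vx xU].
      move: Dx; rewrite /D/= ltNge => /negP; apply; apply: ltW.
      apply: (@lt_le_trans _ _ w%:E).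
        by rewrite ltNge -qU// -ltNge.
      by rewrite -qV.
    rewrite -kB ?ltW// /h ger0_norm ?subr_ge0 ?ltW//; lra.
have tr : forall d0 (T0 : measurableType d0) (P0 : probability T0 R)
    (X0 : {RV P0 >-> R}) (U0 : {RV Q >-> R}),
    (forall A, measurable A -> distribution Q U0 A = distribution P0 X0 A) ->
    P0.-integrable setT (EFin \o X0) ->
    Q.-integrable setT (EFin \o (h \o U0)) /\
    (\int[Q]_w (h (U0 w))%:E = \int[P0]_w (h (X0 w))%:E)%E.
  move=> d0 T0 P0 X0 U0 dU0 iX0.
  have ihX : P0.-integrable setT (EFin \o (h \o X0)) by apply: ih.
  have mEh : measurable_fun setT (EFin \o h) by exact/measurable_EFinP.
  have e1 g : measurable_fun setT g -> (forall y, 0 <= g y)%E ->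
      (\int[Q]_w g (U0 w) = \int[P0]_w g (X0 w))%E.
    move=> mg g0.
    have := @ge0_integral_distribution _ _ _ _ _ Q U0 g mg g0.
    have := @ge0_integral_distribution _ _ _ _ _ P0 X0 g mg g0.
    move=> <- <-; apply: eq_measure_integral => A mA _; exact: dU0.
  have ihU : Q.-integrable setT (EFin \o (h \o U0)).
    apply/integrableP; split.
      apply/measurable_EFinP; apply: measurableT_comp => //.
    have := e1 (fun y => `|(h y)%:E|)%E.
    move=> ->//; last exact: measurableT_comp.
    by move/integrableP : ihX => [].
  split=> //.
  rewrite [LHS]integralE [RHS]integralE.
  congr (_ - _)%E.
  - have e := e1 ((EFin \o h)^\+)%E (measurable_funepos mEh) (funepos_ge0 _).
    by apply: etrans (etrans e _); apply: eq_integral => w _; rewrite !funeposE.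
  - have e := e1 ((EFin \o h)^\-)%E (measurable_funeneg mEh) (funeneg_ge0 _).
    by apply: etrans (etrans e _); apply: eq_integral => w _; rewrite !funenegE.
have [ihU eU] := tr _ _ _ _ _ dU iX.
have [ihV eV] := tr _ _ _ _ _ dV iZ.
have mUV : measurable_fun setT (fun w => `|U w - V w|).
  by apply: measurableT_comp => //; exact: measurable_funB.
have QN : Q (~` `]0, 1[%classic) = 0%E.
  rewrite uniform_prob01; last exact: measurableC.
  apply/eqP; rewrite eq_le measure_ge0 andbT.
  apply: (@le_trans _ _ (lebesgue_measure ([set 0] `|` [set 1 : R]))).
    apply: le_measure; rewrite ?inE//.
    - by apply: measurableI => //; exact: measurableC.
    - exact: measurableU.
    move=> w [/=]; rewrite !in_itv/= => H w01.
    have [->|w0] := eqVneq w 0; first by left.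
    right; apply/eqP; rewrite eq_le; apply/andP; split; first lra.
    rewrite leNgt; apply/negP => w1; apply: H; rewrite w1 lt_neqAle eq_sym w0; lra.
  apply: (@le_trans _ _ (lebesgue_measure [set 0%R] + lebesgue_measure [set 1%R])%E).
    exact: measureU2.
  by rewrite !lebesgue_measure_set1 adde0.
have ie : (\int[Q]_w `|(U w - V w)%:E| =
           \int[Q]_w ((h (U w))%:E - (h (V w))%:E))%E.
  apply: ae_eq_integral => //.
  - exact/measurable_EFinP.
  - by apply: emeasurable_funB; apply/measurable_EFinP; apply: measurableT_comp.
  - exists (~` `]0, 1[%classic); split.
    + exact: measurableC.
    + exact: QN.
    + move=> w /=; apply: contra_not => w01 _; rewrite key//.
apply: ge_ereal_inf; exists (\int[Q]_w `|(U w - V w)%:E|)%E.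
  exists _, _, Q, U, V; split=> //.
  by rewrite Lnorm1.
rewrite ie integralB// eU eV /Rintegral EFinB !fineK//.
- apply: integrable_fin_num => //; apply: ih => //; exact: measurable_funP.
- apply: integrable_fin_num => //; apply: ih => //; exact: measurable_funP.
Unshelve. all: by end_near. Qed.

End quantile_coupling.

(** * Real integrals and centring against bounded measurable functions *)

Section integral_tools.
Context d (T : measurableType d) (R : realType) (P : probability T R).
Local Notation intg f := (P.-integrable setT (EFin \o f)).

Lemma integrable_le (f g : T -> R) : measurable_fun setT f -> intg g ->
  (forall w, `|f w| <= g w) -> intg f.
Proof.
move=> mf ig fg; apply: le_integrable ig => //; first exact/measurable_EFinP.
by move=> w _ /=; rewrite lee_fin (le_trans (fg w))// ler_norm.
Qed.

Lemma integrable_measurable (f : T -> R) : intg f -> measurable_fun setT f.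
Proof. by move=> /measurable_int /measurable_EFinP. Qed.

Lemma integrableD_real (f g : T -> R) : intg f -> intg g -> intg (fun w => f w + g w).
Proof. by move=> iF ig; have := integrableD measurableT iF ig. Qed.

Lemma integrableB_real (f g : T -> R) : intg f -> intg g -> intg (fun w => f w - g w).
Proof. by move=> iF ig; have := integrableB measurableT iF ig. Qed.

Lemma integrableZ_real (c : R) (f : T -> R) : intg f -> intg (fun w => c * f w).
Proof. by move=> iF; have := integrableZl measurableT c iF. Qed.

Lemma integrable_cst_real (c : R) : intg (fun=> c).
Proof. exact: finite_measure_integrable_cst. Qed.

Lemma integrable_sum_real n (f : nat -> T -> R) : (forall k, intg (f k)) ->
  intg (fun w => \sum_(k < n) f k w).
Proof.
move=> iF; rewrite (_ : _ \o _ = fun w => (\sum_(k < n) (f k w)%:E)%E).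
  by apply: integrable_sum => // k _; exact: iF.
by apply/funext => w /=; rewrite sumEFin.
Qed.

Lemma integrable_mul_bounded (f g : T -> R) (M : R) : intg f ->
  measurable_fun setT g -> (forall w, `|g w| <= M) -> intg (fun w => f w * g w).
Proof.
move=> iF mg gM; apply: (@integrable_le _ (fun w => M * `|f w|)).
- by apply: measurable_funM => //; exact: integrable_measurable.
- by apply: integrableZ_real; exact: integrable_norm.
- by move=> w; rewrite normrM mulrC ler_wpM2r.
Qed.

Lemma Rintegral_sum n (f : nat -> T -> R) : (forall k, intg (f k)) ->
  \int[P]_w (\sum_(k < n) f k w) = \sum_(k < n) \int[P]_w f k w.
Proof.
move=> iF; elim: n => [|n IH].
  by rewrite big_ord0; under eq_Rintegral do rewrite big_ord0; rewrite Rintegral_cst// mul0r.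
rewrite big_ord_recr/= -IH -RintegralD//; last exact: integrable_sum_real.
by apply: eq_Rintegral => w _; rewrite big_ord_recr.
Qed.

Lemma le_RintegralT (f g : T -> R) : intg f -> intg g ->
  (forall w, f w <= g w) -> \int[P]_w f w <= \int[P]_w g w.
Proof. by move=> iF ig fg; apply: le_Rintegral. Qed.

Lemma Rintegral_cst_prob (c : R) : \int[P]_w c = c.
Proof. by rewrite Rintegral_cst// [X in fine X]probability_setT mulr1. Qed.

Lemma sum_ord_ltn n N : (\sum_(k < n) (k < N : nat))%N = minn n N.
Proof.
elim: n => [|n IH]; first by rewrite big_ord0 min0n.
rewrite big_ord_recr/= IH /minn; case: (ltngtP n N) => /= nN; case: ltnP => //=; lia.
Qed.

(** As [x <= n], the sum counts all of [1, ..., floor x], so the difference is the fractional part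
    of [x]. *)
Lemma count_approx (x : R) (n : nat) : 0 <= x <= n%:R ->
  0 <= x - \sum_(k < n) (k.+1%:R <= x)%R%:R <= 1.
Proof.
move=> /andP[x0 xn]; set N := Num.truncn x.
have /andP[Nx xN] : N%:R <= x < N.+1%:R by exact: truncn_itv.
rewrite (eq_bigr (fun k : 'I_n => (k < N : nat)%:R)); last first.
  move=> k _; congr (nat_of_bool _)%:R.
  apply/idP/idP => [kx|kN].
    have : (k.+1%:R < N.+1%:R :> R) by exact: le_lt_trans kx xN.
    by rewrite ltr_nat ltnS.
  by rewrite (le_trans _ Nx)// ler_nat.
rewrite -natr_sum sum_ord_ltn.
have -> : minn n N = N.
  apply/minn_idPr; rewrite -ltnS -(ltr_nat R); apply: le_lt_trans Nx _.
  by rewrite (le_lt_trans xn)// ltr_nat.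
by move: xN; rewrite -natr1; lra.
Qed.

Variable G : set (set T).
Hypothesis Gm : G `<=` measurable.
Local Notation TG := (g_sigma_algebraType G).

Lemma sub_g_sigma_measurable : <<s G >> `<=` @measurable d T.
Proof. by apply: smallest_sub => //; exact: sigma_algebra_measurable. Qed.

Lemma measurable_fun_sub d' (S : measurableType d') (f : T -> S) :
  @measurable_fun _ _ TG S setT f -> measurable_fun setT f.
Proof. by move=> mf mT A mA; apply: sub_g_sigma_measurable; exact: mf. Qed.

(** Passes from centring on events, as in [is_condexp], to centring against bounded functions, as in
    [mdiff]. *)
Lemma Rintegral_mul_eq0 (W g : T -> R) (M : R) : intg W ->
  (forall A, <<s G >> A -> \int[P]_(w in A) W w = 0) ->
  @measurable_fun _ _ TG R setT g -> (forall w, `|g w| <= M) ->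
  \int[P]_w (W w * g w) = 0.
Proof.
move=> iW W0 mg gM.
have mgT := measurable_fun_sub mg.
have M0 : 0 <= M by rewrite (le_trans _ (gM point)).
have iWg := integrable_mul_bounded iW mgT gM.
set C := \int[P]_w `|W w|.
have C0 : 0 <= C by apply: Rintegral_ge0.
have iabsW := integrable_norm iW.
(* [g] is approximated uniformly within [1 / n.+1] by combinations of indicators of level sets *)
suff bnd n : `|\int[P]_w (W w * g w)| <= n.+1%:R^-1 * C.
  apply/eqP; rewrite -normr_eq0 eq_le normr_ge0 andbT leNgt; apply/negP => p0.
  set x := `|_| in bnd p0.
  have := bnd (Num.truncn (C / x)); rewrite leNgt => /negP; apply.
  by rewrite mulrC ltr_pdivrMr// mulrC -ltr_pdivrMr// truncnS_gt.
set N : R := n.+1%:R.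
have N0 : 0 < N by rewrite ltr0n.
(* [g] is shifted by [M] and dilated by [N], so that counting the levels [1, ..., K] reached by [x]
   gives [x] within 1 and hence [g] within [1 / N]. *)
pose K := (Num.truncn (N * (M + M))).+1.
pose x w := N * (g w + M).
have mx : @measurable_fun _ _ TG R setT x.
  by apply: measurable_funM => //; apply: measurable_funD.
have x0K w : 0 <= x w <= K%:R.
  have := gM w; rewrite ler_norml => /andP[g1 g2].
  rewrite mulr_ge0 ?ler0n//=; last lra.
  by rewrite ltW// (le_lt_trans _ (truncnS_gt _))// ler_wpM2l ?ler0n//; lra.
pose A k := x @^-1` `[k.+1%:R, +oo[%classic.
have mA k : <<s G >> (A k).
  by have := mx measurableT `[k.+1%:R, +oo[%classic (measurable_itv _); rewrite setTI.
pose S w : R := \sum_(k < K) \1_(A k) w.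
have SE w : S w = \sum_(k < K) (k.+1%:R <= x w)%R%:R.
  apply: eq_bigr => k _; rewrite indicE; congr (nat_of_bool _)%:R.
  by apply/idP/idP; rewrite inE /A/= in_itv/= andbT.
have xS w : `|x w - S w| <= 1.
  have /andP[h0 h1] := count_approx (x0K w).
  by rewrite SE ger0_norm.
have mAT k : measurable (A k) by exact: sub_g_sigma_measurable.
have mxT := measurable_fun_sub mx.
have mS : measurable_fun setT S.
  by rewrite /S; apply: measurable_sum => k; exact: measurable_indic.
have iWA k : intg (fun w => W w * \1_(A k) w).
  apply: (@integrable_mul_bounded _ _ 1) => //.
  by move=> w; rewrite indicE; case: (_ \in _); rewrite ?normr1 ?normr0.
have WS0 : \int[P]_w (W w * S w) = 0.
  under eq_Rintegral do rewrite /S mulr_sumr.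
  rewrite (@Rintegral_sum _ (fun k w => W w * \1_(A k) w))// big1// => k _.
  rewrite -(W0 _ (mA k)) [RHS]Rintegral_mkcond; apply: eq_Rintegral => w _.
  by rewrite patchE indicE; case: (_ \in _); rewrite ?mulr1 ?mulr0.
have W00 : \int[P]_w W w = 0 by apply: W0; exact: (@measurableT _ TG).
have iWxS : intg (fun w => W w * (x w - S w)).
  apply: (@integrable_mul_bounded _ _ 1) => //; exact: measurable_funB.
have iWS : intg (fun w => W w * S w).
  apply: (@integrable_mul_bounded _ _ (K%:R + 1)) => // w.
  have := xS w; have /andP[x1 x2] := x0K w; rewrite !ler_norml => /andP[]; lra.
have -> : \int[P]_w (W w * g w) = N^-1 * \int[P]_w (W w * (x w - S w)).
  transitivity (\int[P]_w (N^-1 * (W w * (x w - S w) + W w * S w) - M * W w)).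
    apply: eq_Rintegral => w _; rewrite /x; field; exact: lt0r_neq0.
  rewrite RintegralB//; last exact: integrableZ_real.
    rewrite !RintegralZl// ?W00 ?mulr0 ?subr0; last exact: integrableD_real.
    by rewrite RintegralD// WS0 addr0.
  by apply: integrableZ_real; exact: integrableD_real.
rewrite normrM (gtr0_norm (_ : 0 < N^-1)) ?invr_gt0// ler_pM2l ?invr_gt0//.
apply: le_trans (le_normr_Rintegral _ _) _ => //.
apply: le_RintegralT => //; first exact: integrable_norm.
by move=> w; rewrite normrM ler_piMr.
Qed.

End integral_tools.

Lemma measurable_sqrtr (R : realType) : measurable_fun setT (@Num.sqrt R).
Proof. by apply: nondecreasing_measurable => // x y xy; rewrite ler_wsqrtr. Qed.

(** The square makes the base nonnegative, where the power of exponent -1 is the inverse; at 0 the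
    outer factor gives the default value 0. *)
Lemma measurable_invr (R : realType) : measurable_fun setT (@GRing.inv R).
Proof.
rewrite (_ : @GRing.inv R = fun x : R => x * ((x ^+ 2) `^ (-1))).
  apply: measurable_funM => //.
  apply: (@measurableT_comp _ _ _ _ _ _ (fun x : R => x `^ (-1))).
    exact: measurable_powR.
  exact: measurable_funX.
apply/funext => x; rewrite powR_inv1 ?sqr_ge0//.
have [->|x0] := eqVneq x 0; first by rewrite mul0r invr0.
by rewrite expr2 invfM mulrA divff// mul1r.
Qed.

Lemma measurable_fun_sqrtr d (T : measurableType d) (R : realType) (f : T -> R) :
  measurable_fun setT f -> measurable_fun setT (fun x => Num.sqrt (f x)).
Proof. by move=> mf; apply: (measurableT_comp (@measurable_sqrtr R)). Qed.

Lemma measurable_fun_invr d (T : measurableType d) (R : realType) (f : T -> R) :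
  measurable_fun setT f -> measurable_fun setT (fun x => (f x)^-1).
Proof. by move=> mf; apply: (measurableT_comp (@measurable_invr R)). Qed.

(* [y k] is revealed at time [k.+1] and has conditional variance [v k] given
   [F k]; conditional expectations are encoded by integration against bounded
   [F k]-measurable functions. *)
Record mdiff d (T : measurableType d) (R : realType) (P : probability T R)
    (F : nat -> set (set T)) (y v : nat -> T -> R) : Prop := MDiff {
  md_sub : forall k, F k `<=` measurable;
  md_incr : forall k, F k `<=` F k.+1;
  md_y : forall k, @measurable_fun _ _ (g_sigma_algebraType (F k.+1)) R setT (y k);
  md_v : forall k, @measurable_fun _ _ (g_sigma_algebraType (F k)) R setT (v k);
  md_v0 : forall k w, 0 <= v k w;
  md_iy2 : forall k, P.-integrable setT (EFin \o (fun w => y k w ^+ 2));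
  md_iv : forall k, P.-integrable setT (EFin \o v k);
  md_Ey : forall k g M, @measurable_fun _ _ (g_sigma_algebraType (F k)) R setT g ->
    (forall w, `|g w| <= M) -> \int[P]_w (y k w * g w) = 0;
  md_Ey2 : forall k g M, @measurable_fun _ _ (g_sigma_algebraType (F k)) R setT g ->
    (forall w, `|g w| <= M) ->
    \int[P]_w (y k w ^+ 2 * g w) = \int[P]_w (v k w * g w) }.

Arguments md_sub {d T R P F y v} _ k.
Arguments md_incr {d T R P F y v} _ k.
Arguments md_y {d T R P F y v} _ k.
Arguments md_v {d T R P F y v} _ k.
Arguments md_v0 {d T R P F y v} _ k w.
Arguments md_iy2 {d T R P F y v} _ k.
Arguments md_iv {d T R P F y v} _ k.
Arguments md_Ey {d T R P F y v} _ k g M.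
Arguments md_Ey2 {d T R P F y v} _ k g M.

(** * Martingale differences: stopping and the first moment of the sum *)

Section mdiff_theory.
Context d (T : measurableType d) (R : realType) (P : probability T R).
Variables (F : nat -> set (set T)).
Local Notation intg f := (P.-integrable setT (EFin \o f)).
Local Notation mF k f := (@measurable_fun _ _ (g_sigma_algebraType (F k)) R setT f).

Section props.
Variables (y v : nat -> T -> R) (H : mdiff P F y v).

Lemma md_meas k (f : T -> R) : mF k f -> measurable_fun setT f.
Proof. exact: measurable_fun_sub (md_sub H k) _ _ _. Qed.

Lemma md_mono k l (f : T -> R) : (k <= l)%N -> mF k f -> mF l f.
Proof.
move=> kl mf mT A mA; have : <<s F k >> (setT `&` f @^-1` A) by exact: mf.
apply: sub_sigma_algebra2; elim: l kl {mf mT mA} => [|l IH].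
  by rewrite leqn0 => /eqP ->.
rewrite leq_eqVlt ltnS => /predU1P[->//|/IH]; move/subset_trans; apply.
exact: (md_incr H).
Qed.

Lemma md_iy k : intg (y k).
Proof.
apply: (@integrable_le _ _ _ _ _ (fun w => 1 + y k w ^+ 2)).
- exact: md_meas (md_y H k).
- by apply: integrableD_real; [exact: integrable_cst_real|exact: md_iy2 H k].
- by move=> w; rewrite ler_norml; have := sqr_ge0 (y k w - 1);
    have := sqr_ge0 (y k w + 1); nra.
Qed.

Lemma md_sum_y m : mF m (fun w => \sum_(k < m) y k w).
Proof.
apply: measurable_sum => k; apply: (@md_mono k.+1) (md_y H k); exact: ltn_ord.
Qed.

Lemma md_sum_v m : mF m (fun w => \sum_(k < m.+1) v k w).
Proof.
apply: measurable_sum => k; apply: (@md_mono k) (md_v H k).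
by rewrite -ltnS ltn_ord.
Qed.

(** A predictable 0-1 factor is absorbed by the test function, and [J ^ 2 = J] makes the conditional
    variance scale by [J] itself. It is applied to the increments before the stopping time and, with
    [1 - J], to those after it. *)
Lemma md_stop (J : nat -> T -> R) : (forall k, mF k (J k)) ->
  (forall k w, J k w = 0 \/ J k w = 1) ->
  mdiff P F (fun k w => J k w * y k w) (fun k w => J k w * v k w).
Proof.
move=> mJ J01.
have Jb k w : `|J k w| <= 1 by case: (J01 k w) => ->; rewrite ?normr0 ?normr1.
have J2 k w : J k w ^+ 2 = J k w by case: (J01 k w) => ->; rewrite ?expr0n ?expr1n.
have mJT k := md_meas (mJ k).
have JgM k g M w : (forall w, `|g w| <= M) -> `|J k w * g w| <= M.
  by move=> gM; rewrite normrM (le_trans (ler_piMl _ (Jb k w))).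
split.
- exact: md_sub H.
- exact: md_incr H.
- move=> k; apply: measurable_funM (md_y H k); exact: (@md_mono k).
- by move=> k; apply: measurable_funM (md_v H k).
- by move=> k w; case: (J01 k w) => ->; rewrite ?mul0r ?mul1r// (md_v0 H).
- move=> k; under [X in EFin \o X]funext do rewrite exprMn J2 mulrC.
  exact: integrable_mul_bounded (md_iy2 H k) (mJT k) (Jb k).
- move=> k; under [X in EFin \o X]funext do rewrite mulrC.
  exact: integrable_mul_bounded (md_iv H k) (mJT k) (Jb k).
- move=> k g M mg gM; under eq_Rintegral do rewrite mulrAC mulrC.
  apply: (md_Ey H k _ M); first exact: measurable_funM.
  by move=> w; exact: JgM.
- move=> k g M mg gM; under eq_Rintegral do rewrite exprMn J2 mulrAC mulrC.
  under [RHS]eq_Rintegral do rewrite mulrAC mulrC.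
  apply: (md_Ey2 H k _ M); first exact: measurable_funM.
  by move=> w; exact: JgM.
Qed.

(** Three facts: replacing [b] by [c] costs the most at [x = 0]; [sqrt] lies below its tangent at
    [x ^ 2 + c]; and the slope of this tangent is largest at [x = 0]. The coefficient of [z]
    involves only [x] and [c], so in the application it is predictable and the linear term has mean
    zero. *)
Lemma sqrt_step (x z b c : R) : 0 < b -> b <= c ->
  Num.sqrt ((x + z) ^+ 2 + c) <= Num.sqrt (x ^+ 2 + b) + (Num.sqrt c - Num.sqrt b)
    + z * (x / Num.sqrt (x ^+ 2 + c)) + z ^+ 2 * (2 * Num.sqrt c)^-1.
Proof.
move=> b0 bc; have c0 : 0 < c by exact: lt_le_trans bc.
set r := Num.sqrt (x ^+ 2 + c); set sb := Num.sqrt b; set sc := Num.sqrt c.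
have x2 := sqr_ge0 x.
have sb0 : 0 < sb by rewrite sqrtr_gt0.
have sc0 : 0 < sc by rewrite sqrtr_gt0.
have r0 : 0 < r by rewrite sqrtr_gt0; lra.
have sbE : sb ^+ 2 = b by rewrite sqr_sqrtr// ltW.
have scE : sc ^+ 2 = c by rewrite sqr_sqrtr// ltW.
have rE : r ^+ 2 = x ^+ 2 + c by rewrite sqr_sqrtr//; lra.
have scr : sc <= r by rewrite ler_sqrt; lra.
have sbc : sb <= sc by rewrite ler_sqrt // ltW.
have h1 : r <= Num.sqrt (x ^+ 2 + b) + (sc - sb).
  rewrite -lerBlDr; set q := Num.sqrt _.
  have q0 : 0 <= q by exact: sqrtr_ge0.
  have qE : q ^+ 2 = x ^+ 2 + b by rewrite sqr_sqrtr//; lra.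
  have sbq : sb <= q by rewrite ler_sqrt; lra.
  have [|qr] := leP r q; first lra.
  have : (r - q) * (r + q) = (sc - sb) * (sc + sb) by nra.
  have : 0 < r + q by lra.
  nra.
have h2 : Num.sqrt ((x + z) ^+ 2 + c) <= r + z * (x / r) + z ^+ 2 * (2 * r)^-1.
  have e : r + z * (x / r) + z ^+ 2 * (2 * r)^-1 = (2 * r ^+ 2 + 2 * z * x + z ^+ 2) / (2 * r).
    by field; exact: lt0r_neq0.
  have n0 : 0 <= (2 * r ^+ 2 + 2 * z * x + z ^+ 2) / (2 * r).
    apply: divr_ge0; last lra.
    rewrite rE; have := sqr_ge0 (x + z); nra.
  rewrite e -[leRHS]ger0_norm// -sqrtr_sqr ler_sqrt ?sqr_ge0//.
  rewrite expr_div_n ler_pdivlMr; last by rewrite exprn_gt0//; lra.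
  rewrite exprMn rE; have := sqr_ge0 (2 * z * x + z ^+ 2); nra.
have h3 : z ^+ 2 * (2 * r)^-1 <= z ^+ 2 * (2 * sc)^-1.
  by rewrite ler_wpM2l ?sqr_ge0// lef_pV2 ?posrE; lra.
lra.
Qed.

(* Compensated increments of [sqrt (S ^ 2 + A)]: each step costs at most the
   increment of [2 sqrt A]. *)
Lemma abs_le_bracket n :
  \int[P]_w `|\sum_(k < n) y k w| <= 2 * \int[P]_w Num.sqrt (\sum_(k < n) v k w).
Proof.
pose S m w := \sum_(k < m) y k w.
pose A m w := \sum_(k < m) v k w.
have A0 m w : 0 <= A m w by apply: sumr_ge0 => k _; exact: md_v0 H k w.
have iS m : intg (S m) by apply: integrable_sum_real => k; exact: md_iy.
have iA m : intg (A m) by apply: integrable_sum_real => k; exact: md_iv H k.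
have mFA m : mF m (A m.+1) by exact: md_sum_v.
have mFS m : mF m (S m) by exact: md_sum_y.
have mA m : measurable_fun setT (A m) by exact: integrable_measurable.
have mS m : measurable_fun setT (S m) by exact: integrable_measurable.
have isA m : intg (fun w => Num.sqrt (A m w)).
  apply: (@integrable_le _ _ _ _ _ (fun w => 1 + A m w)).
  - exact: measurable_fun_sqrtr.
  - by apply: integrableD_real => //; exact: integrable_cst_real.
  - move=> w; rewrite ger0_norm ?sqrtr_ge0//.
    have := sqr_sqrtr (A0 m w); have := sqr_ge0 (Num.sqrt (A m w) - 1); nra.
rewrite -/(A n) leNgt; apply/negP => lt1.
set E2 := \int[P]_w _ in lt1; set E1 := \int[P]_w _ in lt1.
(* Adding [t ^ 2] to the bracket keeps the roots away from 0. This costs [2 * t] in the final bound,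
   less than the assumed excess [3 * t]. *)
pose t := (E1 - 2 * E2) / 3.
have t0 : 0 < t by rewrite divr_gt0//; lra.
pose e := t ^+ 2.
have e0 : 0 < e by rewrite exprn_gt0.
pose B m w := e + A m w.
have B0 m w : 0 < B m w by rewrite /B; have := A0 m w; lra.
have mFB m : mF m (B m.+1) by exact: measurable_funD.
have mB m : measurable_fun setT (B m) by exact: measurable_funD.
have isB m : intg (fun w => Num.sqrt (B m w)).
  apply: (@integrable_le _ _ _ _ _ (fun w => (1 + e) + A m w)).
  - exact: measurable_fun_sqrtr.
  - by apply: integrableD_real => //; exact: integrable_cst_real.
  - move=> w; rewrite ger0_norm ?sqrtr_ge0//.
    have := sqr_sqrtr (ltW (B0 m w)); have := sqr_ge0 (Num.sqrt (B m w) - 1).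
    rewrite -[1 + e + _]addrA -/(B m w); nra.
pose f m w := Num.sqrt (S m w ^+ 2 + B m w).
have iF m : intg (f m).
  apply: (@integrable_le _ _ _ _ _ (fun w => `|S m w| + Num.sqrt (B m w))).
  - by apply: measurable_fun_sqrtr; apply: measurable_funD => //; exact: measurable_funX.
  - by apply: integrableD_real => //; exact: integrable_norm.
  - move=> w; rewrite ger0_norm ?sqrtr_ge0//.
    have sB := sqrtr_ge0 (B m w).
    have h : 0 <= `|S m w| + Num.sqrt (B m w) by rewrite addr_ge0.
    rewrite -[leRHS]ger0_norm// -sqrtr_sqr ler_sqrt ?sqr_ge0//.
    have e1 : `|S m w| ^+ 2 = S m w ^+ 2 by rewrite real_normK ?num_real.
    have e2 := sqr_sqrtr (ltW (B0 m w)).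
    have : 0 <= `|S m w| * Num.sqrt (B m w) by rewrite mulr_ge0.
    nra.
have step m : \int[P]_w f m.+1 w <= \int[P]_w f m w +
    2 * (\int[P]_w Num.sqrt (B m.+1 w) - \int[P]_w Num.sqrt (B m w)).
  pose g1 w := S m w / Num.sqrt (S m w ^+ 2 + B m.+1 w).
  pose g2 w := (2 * Num.sqrt (B m.+1 w))^-1.
  have mg1 : mF m g1.
    apply: measurable_funM => //; apply: measurable_fun_invr.
    apply: measurable_fun_sqrtr; apply: measurable_funD => //; exact: measurable_funX.
  have mg2 : mF m g2.
    by apply: measurable_fun_invr; apply: measurable_funM => //; exact: measurable_fun_sqrtr.
  have g1b w : `|g1 w| <= 1.
    rewrite /g1; set r := Num.sqrt _.
    have r0 : 0 < r by rewrite sqrtr_gt0; have := sqr_ge0 (S m w); have := B0 m.+1 w; lra.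
    rewrite normrM normfV (gtr0_norm r0) ler_pdivrMr// mul1r -sqrtr_sqr /r.
    by rewrite ler_sqrt; have := sqr_ge0 (S m w); have := B0 m.+1 w; lra.
  have g2b w : `|g2 w| <= (2 * t)^-1.
    have tB : t <= Num.sqrt (B m.+1 w).
      rewrite -[leLHS]gtr0_norm// -sqrtr_sqr ler_sqrt; last exact: ltW.
      by rewrite lerDl.
    rewrite ger0_norm ?invr_ge0 ?mulr_ge0 ?sqrtr_ge0//.
    by rewrite lef_pV2 ?posrE; lra.
  have i1 : intg (fun w => y m w * g1 w).
    exact: integrable_mul_bounded (md_iy m) (md_meas mg1) g1b.
  have i2 : intg (fun w => y m w ^+ 2 * g2 w).
    exact: integrable_mul_bounded (md_iy2 H m) (md_meas mg2) g2b.
  have i3 : intg (fun w => v m w * g2 w).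
    exact: integrable_mul_bounded (md_iv H m) (md_meas mg2) g2b.
  have iB w0 : intg (fun w => Num.sqrt (B w0.+1 w) - Num.sqrt (B w0 w)).
    exact: integrableB_real.
  apply: (@le_trans _ _ (\int[P]_w (f m w + (Num.sqrt (B m.+1 w) - Num.sqrt (B m w))
      + y m w * g1 w + y m w ^+ 2 * g2 w))).
    apply: le_RintegralT => //.
      by do !apply: integrableD_real => //.
    move=> w; rewrite /f /S big_ord_recr/=; apply: sqrt_step => //.
    by rewrite /B /A big_ord_recr/= lerD2l lerDl; exact: md_v0 H m w.
  rewrite RintegralD//; last by do !apply: integrableD_real => //.
  rewrite RintegralD//; last by do !apply: integrableD_real => //.
  rewrite RintegralD// RintegralB//.
  rewrite (md_Ey H m g1 1)// (md_Ey2 H m g2 (2 * t)^-1)//.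
  (* With [p], [q] the new and old roots, this is [(p^2 - q^2) / (2 p) <= p - q], which holds
     because [q <= p]. *)
  suff : \int[P]_w (v m w * g2 w) <= \int[P]_w (Num.sqrt (B m.+1 w) - Num.sqrt (B m w)).
    by rewrite RintegralB//; lra.
  apply: le_RintegralT => // w.
  rewrite /g2; set p := Num.sqrt (B m.+1 w); set q := Num.sqrt (B m w).
  have p0 : 0 < p by rewrite sqrtr_gt0.
  have q0 : 0 < q by rewrite sqrtr_gt0.
  have pE : p ^+ 2 = B m.+1 w by rewrite sqr_sqrtr// ltW.
  have qE : q ^+ 2 = B m w by rewrite sqr_sqrtr// ltW.
  have vE : v m w = p ^+ 2 - q ^+ 2.
    by rewrite pE qE /B /A big_ord_recr/=; ring.
  rewrite vE ler_pdivrMr; last lra.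
  have v0 := md_v0 H m w; rewrite vE in v0.
  have qp : q <= p by nra.
  nra.
have main m : \int[P]_w f m w <= 2 * \int[P]_w Num.sqrt (B m w).
  elim: m => [|m IH]; last by have := step m; lra.
  have -> : \int[P]_w f 0 w = t.
    rewrite (_ : f 0 = fun=> t) ?Rintegral_cst_prob//; apply/funext => w.
    rewrite /f /B /S /A !big_ord0 expr0n/= add0r addr0 sqrtr_sqr ger0_norm//; exact: ltW.
  have -> : \int[P]_w Num.sqrt (B 0 w) = t.
    rewrite (_ : (fun w => _) = fun=> t) ?Rintegral_cst_prob//; apply/funext => w.
    rewrite /B /A !big_ord0 addr0 sqrtr_sqr ger0_norm//; exact: ltW.
  lra.
have : E1 <= 2 * (E2 + t).
  apply: (@le_trans _ _ (\int[P]_w f n w)).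
    apply: le_RintegralT => //; first exact: (integrable_norm (iS n)).
    move=> w; rewrite -sqrtr_sqr ler_sqrt; last first.
      by have := sqr_ge0 (S n w); have := B0 n w; lra.
    by rewrite lerDl; apply: ltW.
  apply: le_trans (main n) _; rewrite ler_pM2l//.
  have it := integrable_cst_real P t.
  have -> : E2 + t = \int[P]_w (Num.sqrt (A n w) + t).
    by rewrite RintegralD// Rintegral_cst_prob.
  apply: le_RintegralT => //; first exact: integrableD_real.
  move=> w; have s0 := sqrtr_ge0 (A n w).
  have h : 0 <= Num.sqrt (A n w) + t by lra.
  rewrite -[leRHS]ger0_norm// -sqrtr_sqr ler_sqrt ?sqr_ge0//.
  rewrite sqrrD sqr_sqrtr// /B /e; nra.
rewrite /t; lra.
Qed.

End props.
End mdiff_theory.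

(** * Expansions of ratios of Gaussian densities *)

Section exp_bounds.
Variable R : realType.
Implicit Types q t z x a : R.

Lemma expR_sub1_le q : `|expR q - 1| <= `|q| * expR `|q|.
Proof.
have e1 := expR_ge1Dx q; have e0 := expR_gt0 q.
case: (lerP 0 q) => q0.
  rewrite !ger0_norm//; last lra.
  have := expR_ge1Dx (- q); rewrite expRN => h.
  have := ler_wpM2r (ltW e0) h; rewrite mulVf ?lt0r_neq0//; lra.
have e2 : expR q <= 1 by rewrite expR_le1 ltW.
rewrite ler0_norm; last lra.
rewrite (ler0_norm (ltW q0)); have := expR_ge1Dx (- q); nra.
Qed.

Lemma expR_sub1D_le q : `|expR q - 1 - q| <= q ^+ 2 * expR `|q|.
Proof.
have e1 := expR_ge1Dx q; have e0 := expR_gt0 q.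
rewrite ger0_norm; last lra.
have h1 : expR q - 1 - q <= q * (expR q - 1).
  have := expR_ge1Dx (- q); rewrite expRN => h.
  have := ler_wpM2r (ltW e0) h; rewrite mulVf ?lt0r_neq0//; lra.
apply: le_trans h1 _; apply: le_trans (ler_norm _) _.
rewrite normrM -real_normK ?num_real// expr2 -mulrA ler_wpM2l//.
exact: expR_sub1_le.
Qed.

(** Mean value theorem, the derivative being bounded by [expR_sub1D_le]. *)
Lemma expR_sub2_le q : `|expR q - 1 - q - q ^+ 2 / 2| <= `|q| ^+ 3 * expR `|q|.
Proof.
pose f x := expR x - 1 - x - x ^+ 2 / 2.
have df x : is_derive x (1 : R) f (expR x - 1 - x).
  rewrite /f; apply: is_derive_eq.
  by rewrite /GRing.scale/=; field.
have f0 : f 0 = 0 by rewrite /f expR0 expr0n/=; lra.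
have M a b : a <= b -> (forall x, x \in `[a, b] -> `|x| <= `|q|) ->
    `|f b - f a| <= q ^+ 2 * expR `|q| * (b - a).
  move=> ab xq.
  have cf : {within `[a, b], continuous f}.
    by apply: derivable_within_continuous => x _; exact: ex_derive.
  have [x xab ->] := MVT_segment ab (fun x _ => df x) cf.
  rewrite normrM (ger0_norm (_ : 0 <= b - a)) ?subr_ge0// ler_wpM2r ?subr_ge0//.
  apply: le_trans (expR_sub1D_le x) _.
  have := xq _ xab => xq'.
  apply: ler_pM; rewrite ?sqr_ge0 ?expR_ge0 ?ler_expR//.
  by rewrite -[leLHS]real_normK ?num_real// -[leRHS]real_normK ?num_real// lerXn2r ?nnegrE.
have -> : `|q| ^+ 3 * expR `|q| = q ^+ 2 * expR `|q| * `|q|.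
  by rewrite -(real_normK (num_real q)); ring.
rewrite -/(f q); case: (lerP 0 q) => q0.
  rewrite [X in _ * X]ger0_norm// -[leRHS]/(q ^+ 2 * expR `|q| * q).
  rewrite -[f q]subr0 -f0 -[X in _ * X]subr0; apply: M => // x.
  by rewrite in_itv/= => /andP[x0 xq]; rewrite !ger0_norm.
rewrite [X in _ * X]ltr0_norm// -[f q]subr0 -f0 distrC -[X in _ * X]add0r.
apply: M (ltW q0) _ => x; rewrite in_itv/= => /andP[x0 xq].
by rewrite (ler0_norm xq) ltr0_norm// lerN2.
Qed.

(** The rate 1/24 is such that the cube of the right side grows like [expR (z^2 / 8)], which
    together with a factor [expR (z^2 / 4)] exhausts the allowed rate 3/8 in [time_ratio_le]. *)
Lemma poly_le_expR z : 1 + z ^+ 2 <= 24 * expR (z ^+ 2 / 24).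
Proof. have := expR_ge1Dx (z ^+ 2 / 24); have := sqr_ge0 z; lra. Qed.

(* [expR (z * t - t ^ 2 / 2)] is the ratio of the densities of [N(t,1)] and
   [N(0,1)], expanded here to second order in [t] (Hermite polynomials). *)
Lemma space_ratio_le z t : `|t| <= 1 ->
  `|z| * `|expR (z * t - t ^+ 2 / 2) - 1 - z * t - (z ^+ 2 - 1) * t ^+ 2 / 2| <=
  2 * expR 20 * `|t| ^+ 3 * expR (3 / 8 * z ^+ 2).
Proof.
move=> t1; set q := z * t - t ^+ 2 / 2; set a := `|z| + 2^-1.
have t0 := normr_ge0 t; have z0 := normr_ge0 z.
have a0 : 0 <= a by rewrite /a; lra.
have qa : `|q| <= `|t| * a.
  apply: le_trans (ler_normB _ _) _.
  rewrite normrM normrM normrX (ger0_norm (_ : 0 <= 2^-1)) ?invr_ge0//.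
  rewrite /a; nra.
have qa1 : `|q| <= a by apply: le_trans qa _; nra.
have ea : a <= expR a by have := expR_ge1Dx a; lra.
have e0 : 0 <= expR a by exact: expR_ge0.
(* [q + q^2 / 2] agrees with the Hermite expansion up to [- z t^3 / 2 + t^4 / 8]. *)
have k1 : `|expR q - 1 - z * t - (z ^+ 2 - 1) * t ^+ 2 / 2| <=
    `|t| ^+ 3 * (a ^+ 3 * expR a + a).
  have -> : expR q - 1 - z * t - (z ^+ 2 - 1) * t ^+ 2 / 2 =
     (expR q - 1 - q - q ^+ 2 / 2) + (- (z / 2) * t ^+ 3 + t ^+ 4 / 8).
    by rewrite /q; field.
  apply: le_trans (ler_normD _ _) _; rewrite mulrDr; apply: lerD.
    apply: le_trans (expR_sub2_le q) _.
    rewrite mulrA -exprMn; apply: ler_pM; rewrite ?exprn_ge0 ?expR_ge0 ?ler_expR//.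
    by apply: lerXn2r; rewrite ?nnegrE ?mulr_ge0.
  apply: le_trans (ler_normD _ _) _.
  rewrite normrM (normrM (t ^+ 4)) normrN (normrM z) (normrX 3) (normrX 4).
  rewrite (ger0_norm (_ : 0 <= 2^-1)) ?invr_ge0//.
  rewrite (ger0_norm (_ : 0 <= 8^-1)) ?invr_ge0//.
  have : `|t| ^+ 4 <= `|t| ^+ 3 by rewrite exprS ler_piMl// exprn_ge0.
  have : 0 <= `|t| ^+ 3 by rewrite exprn_ge0.
  rewrite /a; nra.
have za : `|z| <= a by rewrite /a; lra.
apply: le_trans (ler_pM z0 (normr_ge0 _) za k1) _.
have -> : 2 * expR 20 * `|t| ^+ 3 * expR (3 / 8 * z ^+ 2) =
    `|t| ^+ 3 * (2 * (expR 20 * expR (3 / 8 * z ^+ 2))) by ring.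
rewrite mulrCA ler_wpM2l ?exprn_ge0//.
(* [3/8 z^2 - 5 |z|] is minimal at [|z| = 20/3]; its minimum is the origin of the constant 20. The
   five factors [expR a] absorb the powers of [a]. *)
have h5 : expR (5 * a) <= expR 20 * expR (3 / 8 * z ^+ 2).
  rewrite -expRD ler_expR /a; have := sqr_ge0 (`|z| - 20/3).
  rewrite -(real_normK (num_real z)); lra.
have e5 : expR (5 * a) = expR a ^+ 5 by rewrite mulrC -expRM_natr.
have e1 : 1 <= expR a by have := expR_ge1Dx a; lra.
have : a * (a ^+ 3 * expR a + a) <= 2 * expR a ^+ 5.
  have -> : a * (a ^+ 3 * expR a + a) = a ^+ 4 * expR a + a ^+ 2 by ring.
  have p4 : a ^+ 4 <= expR a ^+ 4 by rewrite lerXn2r ?nnegrE.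
  have p2 : a ^+ 2 <= expR a ^+ 2 by rewrite lerXn2r ?nnegrE.
  have p25 : expR a ^+ 2 <= expR a ^+ 5 by apply: ler_weXn2l.
  have : a ^+ 4 * expR a <= expR a ^+ 5 by rewrite [leRHS]exprSr ler_wpM2r.
  lra.
rewrite -e5 => h6; lra.
Qed.

(** The exponential is the ratio of the densities of [N(0, 1 + a)] and [N(0, 1)], expanded to first
    order in the variance. Its coefficient is the second Hermite weight of [space_ratio_le]: this is
    the heat equation. *)
Lemma time_ratio_le z a : 0 <= a <= 1 ->
  `|z| * `|expR (z ^+ 2 / 2 * (a / (1 + a)) - ln (1 + a) / 2) - 1 - (z ^+ 2 - 1) * a / 2| <=
  2 * 24 ^+ 3 * expR (2^-1) * a ^+ 2 * expR (3 / 8 * z ^+ 2).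
Proof.
move=> /andP[a0 a1]; have a1' : 0 < 1 + a by lra.
set b := a / (1 + a); set l := ln (1 + a).
have bE : b * (1 + a) = a by rewrite /b divfK ?lt0r_neq0.
have b0 : 0 <= b by rewrite divr_ge0// ltW.
have ba : b <= a by nra.
have b2 : b <= 2^-1 by nra.
have ab : a - b <= a ^+ 2 by nra.
have la : l <= a by have := le_ln1Dx (_ : -1 < a); apply; lra.
have lb : b <= l.
  have := le_ln1Dx (_ : -1 < - b).
  have -> : 1 + - b = (1 + a)^-1 by rewrite /b; field; exact: lt0r_neq0.
  rewrite lnV ?posrE// => h; have := h _; rewrite -/l; lra.
set q := z ^+ 2 / 2 * b - l / 2; set Z := z ^+ 2.
have Z0 : 0 <= Z by exact: sqr_ge0.
have q1 : `|q| <= a * (1 + Z).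
  by rewrite ler_norml /q -/Z; apply/andP; split; nra.
have q2 : `|q| <= Z / 4 + 2^-1.
  by rewrite ler_norml /q -/Z; apply/andP; split; nra.
have k1 : `|expR q - 1 - (Z - 1) * a / 2| <= a ^+ 2 * ((1 + Z) ^+ 2 * expR (Z / 4 + 2^-1) + (1 + Z)).
  have -> : expR q - 1 - (Z - 1) * a / 2 = (expR q - 1 - q) + (q - (Z - 1) * a / 2) by ring.
  apply: le_trans (ler_normD _ _) _; rewrite mulrDr; apply: lerD.
    apply: le_trans (expR_sub1D_le q) _.
    rewrite mulrA -exprMn; apply: ler_pM; rewrite ?sqr_ge0 ?expR_ge0 ?ler_expR//.
    rewrite -real_normK ?num_real//; apply: lerXn2r; rewrite ?nnegrE//.
    by rewrite mulr_ge0//; lra.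
  by rewrite ler_norml /q -/Z; apply/andP; split; nra.
have p := poly_le_expR z; rewrite -/Z in p.
have zZ : `|z| <= 1 + Z.
  by rewrite /Z ler_norml; have := sqr_ge0 (z - 1); have := sqr_ge0 (z + 1); nra.
apply: le_trans (ler_pM (normr_ge0 _) (normr_ge0 _) zZ k1) _.
have -> : 2 * 24 ^+ 3 * expR (2^-1) * a ^+ 2 * expR (3 / 8 * z ^+ 2) =
    a ^+ 2 * (2 * 24 ^+ 3 * (expR (2^-1) * expR (3 / 8 * z ^+ 2))) by ring.
rewrite mulrCA ler_wpM2l ?sqr_ge0//.
have -> : expR 2^-1 * expR (3 / 8 * z ^+ 2) = expR (Z / 4 + 2^-1) * expR (Z / 8).
  by rewrite -!expRD; congr expR; rewrite /Z; field.
set c3 : R := 24 ^+ 3.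
have E1 : 1 <= expR (Z / 4 + 2^-1) by have := expR_ge1Dx (Z / 4 + 2^-1); lra.
set G := expR (Z / 4 + 2^-1) in E1 *.
have p3 : (1 + Z) ^+ 3 <= c3 * expR (Z / 8).
  have -> : c3 * expR (Z / 8) = (24 * expR (Z / 24)) ^+ 3.
    rewrite exprMn -expRM_natr; congr (_ * expR _); by field.
  by apply: lerXn2r; rewrite ?nnegrE ?mulr_ge0 ?expR_ge0//; lra.
have p1 : (1 + Z) ^+ 2 <= (1 + Z) ^+ 3 by apply: ler_weXn2l => //; lra.
have p13 : 0 <= (1 + Z) ^+ 3 by rewrite exprn_ge0//; lra.
have E8 : 0 <= expR (Z / 8) by exact: expR_ge0.
have : (1 + Z) ^+ 3 * G <= c3 * expR (Z / 8) * G by rewrite ler_wpM2r//; lra.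
have : (1 + Z) ^+ 3 <= (1 + Z) ^+ 3 * G by rewrite ler_peMr.
have -> : (1 + Z) * ((1 + Z) ^+ 2 * G + (1 + Z)) = (1 + Z) ^+ 3 * G + (1 + Z) ^+ 2 by ring.
move: c3 p3 => c3 p3; lra.
Qed.

End exp_bounds.

Lemma ler_normBB (R : numDomainType) (u v x y z : R) :
  `|u - v - z| <= `|u - x| + `|v - y| + `|x - y| + `|z|.
Proof.
apply: le_trans (ler_normB _ _) _; rewrite lerD2r.
have -> : u - v = u - x - (v - y) + (x - y) by ring.
by apply: le_trans (ler_normD _ _) _; rewrite lerD2r ler_normB.
Qed.

(** * Gaussian smoothing of a Lipschitz function *)

Section gauss_smoothing.
Variable R : realType.
Local Notation mu := (@lebesgue_measure R).
Implicit Types (r x y w z t : R) (k : R -> R).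

(** Equal to [normal_pdf] for nonzero [r]; as a closed formula it lets joint measurability in [r],
    [x] and [w] be read off its factors. *)
Definition gdens r x w : R := normal_peak r * normal_fun x r w.

Lemma gdens_pdf r x : r != 0 -> gdens r x = normal_pdf x r.
Proof. by move=> r0; rewrite normal_pdfE. Qed.

Lemma gdensE r x w : 0 < r ->
  gdens r x w = normal_peak r * expR (- (((w - x) / r) ^+ 2 / 2)).
Proof.
move=> r0; rewrite /gdens /normal_fun; congr (_ * expR _).
by rewrite -mulr_natr; field; exact: lt0r_neq0.
Qed.

Lemma normal_peakM r a : 0 < r -> 0 < a ->
  normal_peak (r * Num.sqrt a) = normal_peak r * (Num.sqrt a)^-1.
Proof.
move=> r0 a0; rewrite /normal_peak -invfM; congr (_^-1).
rewrite exprMn sqr_sqrtr ?ltW// -!mulrnAr [_ * a]mulrC -mulrA sqrtrM ?ltW//.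
by rewrite mulrC.
Qed.

Lemma gdens2E r x w : 0 < r -> gdens (2 * r) x w =
  2^-1 * (normal_peak r * expR (- (((w - x) / r) ^+ 2 / 8))).
Proof.
move=> r0; have e2 : Num.sqrt 4 = 2 :> R.
  have -> : (4 : R) = 2 ^+ 2 by ring.
  by rewrite sqrtr_sqr ger0_norm.
have hp : normal_peak (2 * r) = 2^-1 * normal_peak r.
  by rewrite [2 * r]mulrC [RHS]mulrC -e2 normal_peakM.
rewrite gdensE ?mulr_gt0// hp -mulrA; congr (_ * (_ * expR _)).
by field; exact: lt0r_neq0.
Qed.

Lemma gdens_ge0 r x w : 0 <= gdens r x w.
Proof. by rewrite mulr_ge0 ?normal_peak_ge0// expR_ge0. Qed.

Lemma measurable_gdens r x : measurable_fun setT (gdens r x).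
Proof. by apply: measurable_funM => //; exact: measurable_normal_fun. Qed.

Lemma integrable_gdens r x : 0 < r -> mu.-integrable setT (EFin \o gdens r x).
Proof.
by move=> /lt0r_neq0 r0; rewrite gdens_pdf//; exact: integrable_normal_pdf.
Qed.

Lemma Rintegral_gdens r x : 0 < r -> \int[mu]_w gdens r x w = 1.
Proof.
by move=> /lt0r_neq0 r0; rewrite gdens_pdf// /Rintegral integral_normal_pdf.
Qed.

Variable H : R -> R.
Hypothesis Hlip : forall x y, `|H x - H y| <= `|x - y|.

Lemma lip_measurable : measurable_fun setT H.
Proof.
apply: continuous_measurable_fun => x.
apply/cvgrPdist_le => e e0; near=> y.
apply: le_trans (Hlip _ _) _; near: y.
by apply/nbhs_ballP; exists e => //= z; exact: ltW.
Unshelve. all: by end_near. Qed.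

(** Subtracting [H x] brings in the Lipschitz bound, and with it a factor [r]; it does not change
    the integral for the centred weights [z] and [z ^ 2 - 1]. *)
Definition gsub k r x w : R := (H w - H x) * k ((w - x) / r) * gdens r x w.

Definition gint k r x : R := \int[mu]_w gsub k r x w.

(** Up to a factor 2, [expR (3/8 z^2)] is the ratio of the Gaussian densities of deviations [2 r]
    and [r], since [1/2 - 1/8 = 3/8]; so an admissible weight gives an integrand dominated by a
    wider Gaussian. The factor [|z|] comes from the increment of [H]. *)
Definition gdom C k := measurable_fun setT k /\
  forall z, `|z| * `|k z| <= C * expR (3 / 8 * z ^+ 2).

Lemma measurable_gsub k r x : measurable_fun setT k -> measurable_fun setT (gsub k r x).
Proof.
move=> mk; apply: measurable_funM; last exact: measurable_gdens.
apply: measurable_funM.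
  by apply: measurable_funB => //; exact: lip_measurable.
apply: (measurableT_comp mk); apply: measurable_funM => //.
exact: measurable_funB.
Qed.

Lemma gsub_le C k r x w : 0 < r -> gdom C k ->
  `|gsub k r x w| <= 2 * r * C * gdens (2 * r) x w.
Proof.
move=> r0 [mk kC]; rewrite gdens2E// /gsub gdensE// normrM normrM.
set z := (w - x) / r.
rewrite (ger0_norm (_ : 0 <= normal_peak r * _)); last first.
  by rewrite mulr_ge0 ?normal_peak_ge0// expR_ge0.
have Hz : `|H w - H x| <= r * `|z|.
  by rewrite /z normrM normfV (gtr0_norm r0) mulrCA divff ?mulr1 ?Hlip// lt0r_neq0.
have e : expR (- (z ^+ 2 / 8)) = expR (3 / 8 * z ^+ 2) * expR (- (z ^+ 2 / 2)).
  by rewrite -expRD; congr expR; field.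
have -> : 2 * r * C * (2^-1 * (normal_peak r * expR (- (z ^+ 2 / 8)))) =
   r * (C * expR (3 / 8 * z ^+ 2)) * (normal_peak r * expR (- (z ^+ 2 / 2))).
  by rewrite e; field.
apply: ler_wpM2r; first by rewrite mulr_ge0 ?normal_peak_ge0// expR_ge0.
apply: (@le_trans _ _ (r * `|z| * `|k z|)); first exact: ler_wpM2r.
by rewrite -mulrA; apply: ler_wpM2l (ltW r0) _ _ (kC z).
Qed.

Lemma lebesgue_integrableZ c (f : R -> R) : mu.-integrable setT (EFin \o f) ->
  mu.-integrable setT (EFin \o (fun w => c * f w)).
Proof.
by move=> i; apply: (@integrableZl _ _ _ mu setT _ c (EFin \o f)).
Qed.

Lemma gsub_integrable C k r x : 0 < r -> gdom C k ->
  mu.-integrable setT (EFin \o gsub k r x).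
Proof.
move=> r0 kC; apply: (@le_integrable _ _ _ mu setT _ (EFin \o gsub k r x)
   (fun w => (2 * r * C * gdens (2 * r) x w)%:E)) => //.
- by apply/measurable_EFinP; apply: measurable_gsub; exact: kC.1.
- by move=> w _ /=; rewrite lee_fin (le_trans (gsub_le _ _ r0 kC))// ler_norm.
- by apply: lebesgue_integrableZ; apply: integrable_gdens; rewrite mulr_gt0.
Qed.

Lemma gint_le C k r x : 0 < r -> gdom C k -> `|gint k r x| <= 2 * r * C.
Proof.
move=> r0 kC; have r20 : 0 < 2 * r by rewrite mulr_gt0.
apply: le_trans (le_normr_Rintegral measurableT (gsub_integrable x r0 kC)) _.
have -> : 2 * r * C = \int[mu]_w (2 * r * C * gdens (2 * r) x w).
  by rewrite RintegralZl ?Rintegral_gdens ?mulr1//; exact: integrable_gdens.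
apply: le_Rintegral => //.
- by apply: integrable_norm; exact: gsub_integrable r0 kC.
- by apply: lebesgue_integrableZ; exact: integrable_gdens.
- by move=> w _; exact: gsub_le.
Qed.

Lemma gint_lin C1 C2 k1 k2 a r x : 0 < r -> gdom C1 k1 -> gdom C2 k2 ->
  gint (fun z => k1 z + a * k2 z) r x = gint k1 r x + a * gint k2 r x.
Proof.
move=> r0 d1 d2; rewrite /gint -RintegralZl//; last exact: gsub_integrable d2.
rewrite -RintegralD//.
- by apply: eq_Rintegral => w _; rewrite /gsub; ring.
- exact: gsub_integrable d1.
- by apply: lebesgue_integrableZ; exact: gsub_integrable d2.
Qed.

Lemma gdom_lin C1 C2 k1 k2 a : gdom C1 k1 -> gdom C2 k2 ->
  gdom (C1 + `|a| * C2) (fun z => k1 z + a * k2 z).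
Proof.
move=> [m1 d1] [m2 d2]; split.
  by apply: measurable_funD => //; exact: measurable_funM.
move=> z; apply: (@le_trans _ _ (`|z| * (`|k1 z| + `|a| * `|k2 z|))).
  by rewrite ler_wpM2l// -normrM ler_normD.
rewrite mulrDr mulrDl; apply: lerD => //.
by rewrite mulrCA -[leRHS]mulrA ler_wpM2l.
Qed.

Definition K1 : R := 24 ^+ 2.

Lemma sqr_le_expR z : (1 + z ^+ 2) ^+ 2 <= K1 * expR (3 / 8 * z ^+ 2).
Proof.
have e : expR (3 / 8 * z ^+ 2) = expR (z ^+ 2 / 24) ^+ 2 * expR (7 / 24 * z ^+ 2).
  by rewrite -expRM_natr -expRD; congr expR; field.
rewrite e mulrA -exprMn.
have p := poly_le_expR z; have z2 := sqr_ge0 z.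
have p2 : (1 + z ^+ 2) ^+ 2 <= (24 * expR (z ^+ 2 / 24)) ^+ 2.
  by apply: lerXn2r; rewrite ?nnegrE ?mulr_ge0 ?expR_ge0//; lra.
apply: le_trans p2 _; rewrite ler_peMr ?sqr_ge0//.
by rewrite -[leLHS]expR0 ler_expR mulr_ge0.
Qed.

Lemma gdom1 : gdom K1 (fun=> 1).
Proof.
split; first exact: measurable_cst.
move=> z; apply: le_trans (sqr_le_expR z); rewrite normr1 mulr1 ler_norml.
have := sqr_ge0 z; have := sqr_ge0 (z - 1); have := sqr_ge0 (z + 1); nra.
Qed.

Lemma gdomX : gdom K1 id.
Proof.
split; first exact: measurable_id.
move=> z; apply: le_trans (sqr_le_expR z).
by rewrite -expr2 real_normK ?num_real//; have := sqr_ge0 z; nra.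
Qed.

Lemma gdomX2 : gdom K1 (fun z => z ^+ 2 - 1).
Proof.
split; first by apply: measurable_funB => //; exact: measurable_funX.
move=> z; apply: le_trans (sqr_le_expR z); rewrite expr2; apply: ler_pM => //.
  by rewrite ler_norml; have := sqr_ge0 (z - 1); have := sqr_ge0 (z + 1); nra.
by rewrite ler_norml; have := sqr_ge0 z; lra.
Qed.

(* [gu r x] is the expectation of [H (x + r Z)] with [Z] standard normal; [gb]
   and [gc] are its first two derivatives in [x], obtained by differentiating
   the density, which produces the Hermite weights. *)
Definition gu r x := H x + gint (fun=> 1) r x.
Definition gb r x := r^-1 * gint id r x.
Definition gc r x := r^-1 ^+ 2 * gint (fun z => z ^+ 2 - 1) r x.

(** Recentres [H] at a point other than the mean, so that densities of different centres or widths
    are compared on the same factor [H w - H x]. *)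
Lemma guE r x x' : 0 < r -> gu r x' = H x + \int[mu]_w ((H w - H x) * gdens r x' w).
Proof.
move=> r0; rewrite /gu /gint.
have i1 := gsub_integrable x' r0 gdom1.
have i2 := integrable_gdens x' r0.
have i3 : mu.-integrable setT (EFin \o (fun w => (H x' - H x) * gdens r x' w)).
  exact: lebesgue_integrableZ.
rewrite (_ : \int[mu]_w ((H w - H x) * gdens r x' w) =
  \int[mu]_w (gsub (fun=> 1) r x' w + (H x' - H x) * gdens r x' w)); last first.
  by apply: eq_Rintegral => w _; rewrite /gsub; ring.
rewrite RintegralD// RintegralZl// Rintegral_gdens//; ring.
Qed.

Lemma gu_sub r x : 0 < r -> `|gu r x - H x| <= 2 * K1 * r.
Proof.
by move=> r0; rewrite /gu addrC addKr; have := gint_le x r0 gdom1; rewrite mulrAC.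
Qed.

Lemma gb_le r x : 0 < r -> `|gb r x| <= 2 * K1.
Proof.
move=> r0; rewrite /gb normrM normfV (gtr0_norm r0) ler_pdivrMl//.
by have := gint_le x r0 gdomX; lra.
Qed.

Lemma gc_le r x : 0 < r -> `|gc r x| <= 2 * K1 / r.
Proof.
move=> r0; rewrite /gc normrM normrX normfV (gtr0_norm r0).
have := gint_le x r0 gdomX2; set g := `|_| => gK.
have -> : 2 * K1 / r = r^-1 ^+ 2 * (2 * r * K1) by field; exact: lt0r_neq0.
by rewrite ler_wpM2l// sqr_ge0.
Qed.

Lemma gdens_shift r x y w : 0 < r ->
  gdens r (x + y) w = expR ((w - x) / r * (y / r) - (y / r) ^+ 2 / 2) * gdens r x w.
Proof.
move=> r0; rewrite !gdensE// mulrCA -expRD; congr (_ * expR _).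
by field; exact: lt0r_neq0.
Qed.

Lemma gdens_scale r a x w : 0 < r -> 0 <= a ->
  gdens (r * Num.sqrt (1 + a)) x w =
  expR (((w - x) / r) ^+ 2 / 2 * (a / (1 + a)) - ln (1 + a) / 2) * gdens r x w.
Proof.
move=> r0 a0; have a1 : 0 < 1 + a by lra.
have s0 : 0 < Num.sqrt (1 + a) by rewrite sqrtr_gt0.
rewrite !gdensE ?mulr_gt0// normal_peakM// expRB.
have -> : expR (ln (1 + a) / 2) = Num.sqrt (1 + a).
  apply/eqP; rewrite -(@eqrXn2 _ 2) ?expR_ge0 ?sqrtr_ge0// sqr_sqrtr ?ltW//.
  by rewrite -expRM_natr divfK// lnK.
rewrite [RHS]mulrCA -[LHS]mulrA; congr (_ * _).
rewrite [RHS]mulrAC mulrC; congr (_ * _); rewrite -expRD; congr expR.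
rewrite invfM mulrA exprMn exprVn sqr_sqrtr ?ltW//; field.
by rewrite !lt0r_neq0.
Qed.

(** What remains of the ratios in [gdens_shift] and [gdens_scale] after their Hermite expansions. *)
Definition kspace t z := expR (z * t - t ^+ 2 / 2) - 1 - z * t - (z ^+ 2 - 1) * t ^+ 2 / 2.
Definition ktime a z := expR (z ^+ 2 / 2 * (a / (1 + a)) - ln (1 + a) / 2) - 1 - (z ^+ 2 - 1) * a / 2.

Lemma gdom_kspace t : `|t| <= 1 -> gdom (2 * expR 20 * `|t| ^+ 3) (kspace t).
Proof.
move=> t1; split; last by move=> z; exact: space_ratio_le.
apply: measurable_funB; last first.
  apply: measurable_funM => //; apply: measurable_funM => //.
  by apply: measurable_funB => //; exact: measurable_funX.
apply: measurable_funB; last exact: measurable_funM.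
apply: measurable_funB => //; apply: (measurableT_comp (@measurable_expR R)).
by apply: measurable_funB => //; exact: measurable_funM.
Qed.

Lemma gdom_ktime a : 0 <= a <= 1 -> gdom (2 * 24 ^+ 3 * expR 2^-1 * a ^+ 2) (ktime a).
Proof.
move=> a1; split; last by move=> z; exact: time_ratio_le.
apply: measurable_funB; last first.
  apply: measurable_funM => //; apply: measurable_funM => //.
  by apply: measurable_funB => //; exact: measurable_funX.
apply: measurable_funB => //; apply: (measurableT_comp (@measurable_expR R)).
apply: measurable_funB => //; by do 2 apply: measurable_funM => //.
Qed.

(** The summands serve, in order, small shifts, small time steps, and large steps of either kind. *)
Definition K2 : R := 4 * expR 20 + 4 * 24 ^+ 3 * expR 2^-1 + 10 * K1 + 2.

Lemma K2_ge : [/\ 4 * expR 20 <= K2, 4 * 24 ^+ 3 * expR 2^-1 <= K2 & 10 * K1 + 2 <= K2].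
Proof.
have e1 := expR_ge0 (20 : R); have e2 := expR_ge0 (2^-1 : R).
by rewrite /K2 /K1; split; lra.
Qed.

(** For [|y| <= r] only the remainder of the density expansion survives, of third order. For
    [|y| > r] there is nothing to expand: each term is separately at most a multiple of [y^2 / r],
    as smoothing moves [H] by at most a multiple of [r]. *)
Lemma gu_space r x y : 0 < r ->
  `|gu r (x + y) - gu r x - gb r x * y - gc r x * y ^+ 2 / 2| <=
  K2 * Num.min (y ^+ 2 / r) (`|y| ^+ 3 / r ^+ 2).
Proof.
move=> r0; have [k1 k2 k3] := K2_ge; have rn := lt0r_neq0 r0.
have kk : (0 : R) <= K1 by rewrite /K1.
set t := y / r.
have ytE : y = t * r by rewrite /t divfK.
have tE : `|y| = `|t| * r by rewrite ytE normrM (gtr0_norm r0).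
have t0 := normr_ge0 t.
have y2 : y ^+ 2 / r = `|t| ^+ 2 * r.
  by rewrite -real_normK ?num_real// tE; field.
have y3 : `|y| ^+ 3 / r ^+ 2 = `|t| ^+ 3 * r by rewrite tE; field.
rewrite y2 y3; case: (lerP `|t| 1) => t1.
  have -> : Num.min (`|t| ^+ 2 * r) (`|t| ^+ 3 * r) = `|t| ^+ 3 * r.
    apply/min_idPr; rewrite ler_wpM2r ?(ltW r0)// exprS ler_piMl// sqr_ge0.
  have d1 := gdom_lin t gdom1 gdomX.
  have d2 := gdom_lin (t ^+ 2 / 2) d1 gdomX2.
  have d3 := gdom_kspace t1.
  rewrite (guE x (x + y) r0).
  have -> : \int[mu]_w ((H w - H x) * gdens r (x + y) w) =
     gint (fun z => ((1 + t * z) + t ^+ 2 / 2 * (z ^+ 2 - 1)) + 1 * kspace t z) r x.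
    apply: eq_Rintegral => w _; rewrite gdens_shift// /gsub mulrA; congr (_ * _ * _).
    by rewrite /kspace -/t; ring.
  rewrite (gint_lin 1 x r0 d2 d3) (gint_lin (t ^+ 2 / 2) x r0 d1 gdomX2).
  rewrite (gint_lin t x r0 gdom1 gdomX).
  have := gint_le x r0 d3; set g := gint (kspace t) r x.
  rewrite /gu /gb /gc ytE.
  set g1 := gint _ r x; set g2 := gint _ r x; set g3 := gint _ r x.
  have -> : H x + (g1 + t * g2 + t ^+ 2 / 2 * g3 + 1 * g) - (H x + g1) -
     r^-1 * g2 * (t * r) - r^-1 ^+ 2 * g3 * (t * r) ^+ 2 / 2 = g by field.
  move=> h; apply: le_trans h _.
  have t3 : 0 <= `|t| ^+ 3 * r by rewrite mulr_ge0 ?exprn_ge0// ltW.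
  have -> : 2 * r * (2 * expR 20 * `|t| ^+ 3) = 4 * expR 20 * (`|t| ^+ 3 * r) by ring.
  exact: ler_wpM2r.
have -> : Num.min (`|t| ^+ 2 * r) (`|t| ^+ 3 * r) = `|t| ^+ 2 * r.
  by apply/min_idPl; rewrite ler_wpM2r ?(ltW r0)// exprS ler_peMl ?sqr_ge0// ltW.
have h1 := gu_sub (x + y) r0; have h2 := gu_sub x r0.
have h3 : `|H (x + y) - H x| <= `|t| * r 
  by have := Hlip (x + y) x; have -> : x + y - x = y by [ring]; rewrite tE.
have h4 : `|gb r x * y| <= 2 * K1 * (`|t| * r).
  by rewrite normrM tE ler_wpM2r ?mulr_ge0 ?gb_le// ltW.
have h5 : `|gc r x * y ^+ 2 / 2| <= K1 * (`|t| ^+ 2 * r).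
  have c0 : 0 <= y ^+ 2 / 2 by rewrite divr_ge0 ?sqr_ge0.
  rewrite -mulrA normrM (ger0_norm c0) -y2.
  apply: le_trans (ler_wpM2r c0 (gc_le x r0)) _.
  by rewrite le_eqVlt; apply/orP; left; apply/eqP; field.
have h6 : `|t| * r <= `|t| ^+ 2 * r.
  by rewrite ler_wpM2r ?(ltW r0)// expr2 ler_peMl// ltW.
have h7 : r <= `|t| * r by apply: ler_peMl; apply: ltW.
have : `|gu r (x + y) - gu r x - gb r x * y - gc r x * y ^+ 2 / 2| <=
  `|gu r (x + y) - H (x + y)| + `|gu r x - H x| + `|H (x + y) - H x| +
  `|gb r x * y| + `|gc r x * y ^+ 2 / 2|.
  by apply: le_trans (ler_normB _ _) _; rewrite lerD2r ler_normBB.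
move=> h; apply: le_trans h _.
have k4 : (10 * K1 + 2) * (`|t| ^+ 2 * r) <= K2 * (`|t| ^+ 2 * r).
  by rewrite ler_wpM2r// mulr_ge0 ?sqr_ge0// ltW.
have k5 : K1 * r <= K1 * (`|t| ^+ 2 * r).
  by rewrite ler_wpM2l// (le_trans h7).
have k6 : K1 * (`|t| * r) <= K1 * (`|t| ^+ 2 * r) by rewrite ler_wpM2l.
have k7 : 0 <= `|t| ^+ 2 * r by rewrite mulr_ge0 ?sqr_ge0// ltW.
have k8 : 0 <= K1 * (`|t| ^+ 2 * r) by rewrite mulr_ge0.
lra.
Qed.

(** Adding variance [s] changes the smoothing by half of [gc] times [s], the coefficient of [y ^ 2]
    in [gu_space]; this makes the two expansions cancel on average. The cases [s <= r^2] and
    [s > r^2] are treated as there. *)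
Lemma gu_time r x s : 0 < r -> 0 <= s ->
  `|gu (Num.sqrt (r ^+ 2 + s)) x - gu r x - gc r x * s / 2| <=
  K2 * Num.min (s / r) (s ^+ 2 / r ^+ 3).
Proof.
move=> r0 s0; have [k1 k2 k3] := K2_ge; have rn := lt0r_neq0 r0.
have kk : (0 : R) <= K1 by rewrite /K1.
set a := s / r ^+ 2.
have r20 : 0 < r ^+ 2 by rewrite exprn_gt0.
have a0 : 0 <= a by rewrite divr_ge0// ltW.
have sE : s = a * r ^+ 2 by rewrite /a divfK ?lt0r_neq0.
have rE : Num.sqrt (r ^+ 2 + s) = r * Num.sqrt (1 + a).
  have -> : r ^+ 2 + s = r ^+ 2 * (1 + a) by rewrite sE; ring.
  by rewrite sqrtrM ?sqr_ge0// sqrtr_sqr gtr0_norm.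
have s1 : s / r = a * r by rewrite sE; field.
have s2 : s ^+ 2 / r ^+ 3 = a ^+ 2 * r by rewrite sE; field.
rewrite s1 s2; case: (lerP a 1) => a1.
  have -> : Num.min (a * r) (a ^+ 2 * r) = a ^+ 2 * r.
    by apply/min_idPr; rewrite ler_wpM2r ?(ltW r0)// expr2 ler_piMl.
  have a01 : 0 <= a <= 1 by rewrite a0.
  have d2 := gdom_lin (a / 2) gdom1 gdomX2.
  have d3 := gdom_ktime a01.
  have r0' : 0 < Num.sqrt (r ^+ 2 + s) by rewrite sqrtr_gt0; lra.
  rewrite (guE x x r0') rE.
  have -> : \int[mu]_w ((H w - H x) * gdens (r * Num.sqrt (1 + a)) x w) =
     gint (fun z => (1 + a / 2 * (z ^+ 2 - 1)) + 1 * ktime a z) r x.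
    apply: eq_Rintegral => w _; rewrite gdens_scale// /gsub mulrA; congr (_ * _ * _).
    by rewrite /ktime; ring.
  rewrite (gint_lin 1 x r0 d2 d3) (gint_lin (a / 2) x r0 gdom1 gdomX2).
  have := gint_le x r0 d3; set g := gint (ktime a) r x.
  rewrite /gu /gc sE.
  set g1 := gint _ r x; set g3 := gint _ r x.
  have -> : H x + (g1 + a / 2 * g3 + 1 * g) - (H x + g1) -
     r^-1 ^+ 2 * g3 * (a * r ^+ 2) / 2 = g by field.
  move=> h; apply: le_trans h _.
  have t3 : 0 <= a ^+ 2 * r by rewrite mulr_ge0 ?exprn_ge0// ltW.
  have -> : 2 * r * (2 * 24 ^+ 3 * expR 2^-1 * a ^+ 2) = 4 * 24 ^+ 3 * expR 2^-1 * (a ^+ 2 * r) by ring.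
  exact: ler_wpM2r.
have -> : Num.min (a * r) (a ^+ 2 * r) = a * r.
  by apply/min_idPl; rewrite ler_wpM2r ?(ltW r0)// expr2 ler_peMl// ltW.
have sq : Num.sqrt (1 + a) <= 2 * a.
  have a2 : 0 <= 2 * a by lra.
  rewrite -[leRHS]ger0_norm// -sqrtr_sqr ler_sqrt ?sqr_ge0//; nra.
have sq0 : 0 < Num.sqrt (1 + a) by rewrite sqrtr_gt0; lra.
have r0' : 0 < r * Num.sqrt (1 + a) by rewrite mulr_gt0.
rewrite rE.
have h1 := gu_sub x r0'; have h2 := gu_sub x r0.
have h5 : `|gc r x * s / 2| <= K1 * (a * r).
  have c0 : 0 <= s / 2 by rewrite divr_ge0.
  rewrite -mulrA normrM (ger0_norm c0).
  apply: le_trans (ler_wpM2r c0 (gc_le x r0)) _.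
  by rewrite -s1 le_eqVlt; apply/orP; left; apply/eqP; field.
have h7 : r <= a * r by apply: ler_peMl; apply: ltW.
have h8 : r * Num.sqrt (1 + a) <= 2 * (a * r).
  by rewrite mulrA [2 * a * r]mulrC ler_wpM2l// ltW.
have : `|gu (r * Num.sqrt (1 + a)) x - gu r x - gc r x * s / 2| <=
  `|gu (r * Num.sqrt (1 + a)) x - H x| + `|gu r x - H x| + `|gc r x * s / 2|.
  have := ler_normBB (gu (r * Num.sqrt (1 + a)) x) (gu r x) (H x) (H x)
    (gc r x * s / 2).
  by rewrite subrr normr0 addr0.
move=> h; apply: le_trans h _.
have k4 : (10 * K1 + 2) * (a * r) <= K2 * (a * r).
  by rewrite ler_wpM2r// mulr_ge0// ltW.
have k5 : K1 * r <= K1 * (a * r) by rewrite ler_wpM2l.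
have k6 : K1 * (r * Num.sqrt (1 + a)) <= K1 * (2 * (a * r)) by rewrite ler_wpM2l.
have k7 : 0 <= a * r by rewrite mulr_ge0// ltW.
have k8 : 0 <= K1 * (a * r) by rewrite mulr_ge0.
apply: le_trans (lerD (lerD h1 h2) h5) _; move: k4 k5 k6 k7 k8.
move: (a * r) (r * Num.sqrt (1 + a)) => b c.
by move: K1 K2 => k l; clear; lra.
Qed.

End gauss_smoothing.

(** * The normal expectation as a smoothing at bandwidth 1 *)

Section normal_expectation.
Variable R : realType.
Local Notation mu := (@lebesgue_measure R).
Local Notation nu := (@normal_prob R 0 1).

(** The Radon-Nikodym derivative is identified with the density almost everywhere, as both have the
    same integral over every measurable set. *)
Lemma ge0_integral_normal_prob (f : measurableTypeR R -> \bar R) :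
  measurable_fun setT f -> (forall x, 0 <= f x)%E ->
  (\int[nu]_x f x = \int[mu]_x (f x * (normal_pdf 0 1 x)%:E))%E.
Proof.
move=> mf f0.
have dom := @normal_prob_dominates R 0 1.
rewrite -(Radon_Nikodym_SigmaFinite.change_of_variables dom)//=.
apply: ae_eq_integral => //.
- apply: emeasurable_funM => //; apply: (measurable_int mu).
  exact: Radon_Nikodym_SigmaFinite.f_integrable.
- apply: emeasurable_funM => //=; apply/measurable_EFinP.
  exact: measurable_normal_pdf.
- apply: ae_eqe_mul2l => /=.
  apply: integral_ae_eq => //=.
  + exact: Radon_Nikodym_SigmaFinite.f_integrable.
  + apply/measurable_EFinP; exact: measurable_normal_pdf.
  + by move=> E E01 mE; rewrite -Radon_Nikodym_SigmaFinite.f_integral.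
Qed.

Definition normal_id : {RV nu >-> R} :=
  HB.pack (idfun : R -> R)
   (@isMeasurableFun.Build _ _ (measurableTypeR R) R idfun (@measurable_id _ _ setT)).

Variable H : R -> R.
Hypothesis Hlip : forall x y, `|H x - H y| <= `|x - y|.

Lemma normal_lip_integrable : nu.-integrable setT (EFin \o H).
Proof.
have mH := lip_measurable Hlip.
have i1 : mu.-integrable setT (EFin \o (fun w => `|gsub H (fun=> 1) 1 0 w| + `|H 0| * gdens 1 0 w)).
  have := gsub_integrable Hlip 0 ltr01 (gdom1 R) => h1.
  have := lebesgue_integrableZ `|H 0| (integrable_gdens 0 (@ltr01 R)) => h2.
  exact: (integrableD measurableT (integrable_norm h1) h2).
apply/integrableP; split; first exact/measurable_EFinP.
rewrite ge0_integral_normal_prob//; last first.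
  by apply: measurableT_comp => //; exact/measurable_EFinP.
move/integrableP : i1 => [_]; apply: le_lt_trans; apply: ge0_le_integral => //=.
- by move=> x _; rewrite mule_ge0// lee_fin normal_pdf_ge0.
- apply: emeasurable_funM.
    by apply/measurable_EFinP; apply: measurableT_comp.
  by apply/measurable_EFinP; exact: measurable_normal_pdf.
- apply/measurable_EFinP; apply: measurableT_comp => //.
  apply: measurable_funD.
    apply: measurableT_comp => //; apply: measurable_gsub => //.
  by apply: measurable_funM => //; exact: measurable_gdens.
- move=> w _; rewrite -EFinM lee_fin -gdens_pdf ?oner_neq0//.
  apply: le_trans (ler_norm _).
  rewrite /gsub mulr1 normrM (ger0_norm (gdens_ge0 _ _ _)) -mulrDl.
  rewrite ler_wpM2r ?gdens_ge0//.
  by have := ler_normD (H w - H 0) (H 0); rewrite subrK.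
Qed.

Lemma Rintegral_normal_lip : \int[nu]_w H w = gu H 1 0.
Proof.
have iH := normal_lip_integrable.
have mH := lip_measurable Hlip.
have mfp : measurable_fun setT (EFin \o H) by exact/measurable_EFinP.
have mp : measurable_fun setT (fun x => (normal_pdf 0 1 x)%:E : \bar R).
  by apply/measurable_EFinP; exact: measurable_normal_pdf.
rewrite /gu; have := guE Hlip 0 0 ltr01; rewrite /gu => ->.
have iG := integrable_gdens 0 (@ltr01 R).
transitivity (\int[mu]_w (H w * gdens 1 0 w)).
  rewrite /Rintegral; congr fine.
  rewrite [LHS]integralE [RHS]integralE.
  rewrite !ge0_integral_normal_prob//.
  - congr (_ - _)%E; apply: eq_integral => w _; rewrite -gdens_pdf ?oner_neq0//.
    + rewrite /= !funeposE/= -!EFin_max -EFinM maxr_pMl ?gdens_ge0// mul0r//.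
    + rewrite /= !funenegE/= -!EFin_max -EFinM maxr_pMl ?gdens_ge0// mul0r mulNr//.
  - exact: measurable_funeneg.
  - exact: measurable_funepos.
have h1 := gsub_integrable Hlip 0 ltr01 (gdom1 R).
have h2 := lebesgue_integrableZ (H 0) iG.
transitivity (\int[mu]_w (gsub H (fun=> 1) 1 0 w + H 0 * gdens 1 0 w)).
  by apply: eq_Rintegral => w _; rewrite /gsub; ring.
rewrite RintegralD// RintegralZl// Rintegral_gdens// mulr1 addrC; congr (_ + _).
by apply: eq_Rintegral => w _; rewrite /gsub mulr1.
Qed.

End normal_expectation.

Lemma wasserstein1_normal d (T : measurableType d) (R : realType) (P : probability T R)
  (X : {RV P >-> R}) : P.-integrable setT (EFin \o X) ->
  exists h : R -> R, (forall x y, `|h x - h y| <= `|x - y|) /\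
   (wasserstein 1 (distribution P X) (normal_prob 0 1) <=
    (\int[P]_w h (X w) - gu h 1 0)%:E)%E.
Proof.
move=> iX.
have iZ : (@normal_prob R 0 1).-integrable setT (EFin \o normal_id R).
  exact: (@normal_lip_integrable R id).
have [h [hl hw]] := wasserstein1_lip iX iZ; exists h; split => //.
by rewrite -Rintegral_normal_lip.
Qed.

(** * Measurability of the smoothings at random centre and bandwidth *)

Section measurable_param.
Variable R : realType.
Local Notation mu := (@lebesgue_measure R).

Lemma measurable_Rintegral_param d (T : measurableType d) (f : T * R -> R) :
  measurable_fun setT f -> measurable_fun setT (fun t => \int[mu]_w f (t, w)).
Proof.
move=> mf.
have mEf : measurable_fun setT (EFin \o f) by exact/measurable_EFinP.
apply: (measurableT_comp (f := @fine R)) => //.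
rewrite (_ : (fun t => _) = fun t => (\int[mu]_w (EFin \o f)^\+ (t, w) - \int[mu]_w (EFin \o f)^\- (t, w))%E).
  apply: emeasurable_funB.
    apply: (@measurable_fun_fubini_tonelli_F _ _ T (measurableTypeR R) R mu ((EFin \o f)^\+)%E) => //.
    exact: measurable_funepos.
  apply: (@measurable_fun_fubini_tonelli_F _ _ T (measurableTypeR R) R mu ((EFin \o f)^\-)%E) => //.
  exact: measurable_funeneg.
apply/funext => t; rewrite [LHS]integralE; congr (_ - _)%E.
- by apply: eq_integral => w _; rewrite !funeposE.
- by apply: eq_integral => w _; rewrite !funenegE.
Qed.

Variable H : R -> R.
Hypothesis Hlip : forall x y, `|H x - H y| <= `|x - y|.

Lemma measurable_gint d (T : measurableType d) (k : R -> R) (r x : T -> R) :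
  measurable_fun setT k -> measurable_fun setT r -> measurable_fun setT x ->
  measurable_fun setT (fun t => gint H k (r t) (x t)).
Proof.
move=> mk mr mx; have mH := lip_measurable Hlip.
apply: (measurable_Rintegral_param (f := fun p : T * R => gsub H k (r p.1) (x p.1) p.2)).
have mr1 : measurable_fun setT (fun p : T * R => r p.1).
  by apply: measurableT_comp => //; exact: measurable_fst.
have mx1 : measurable_fun setT (fun p : T * R => x p.1).
  by apply: measurableT_comp => //; exact: measurable_fst.
have mw : measurable_fun setT (fun p : T * R => p.2) by exact: measurable_snd.
have mwx : measurable_fun setT (fun p : T * R => p.2 - x p.1) by exact: measurable_funB.
have msub : measurable_fun setT (fun p : T * R => H p.2 - H (x p.1)).
  by apply: measurable_funB; apply: measurableT_comp.
have mk1 : measurable_fun setT (fun p : T * R => k ((p.2 - x p.1) / r p.1)).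
  apply: (measurableT_comp mk); apply: measurable_funM => //.
  exact: measurable_fun_invr.
have mpeak : measurable_fun setT (fun p : T * R => normal_peak (r p.1)).
  apply: measurable_fun_invr; apply: measurable_fun_sqrtr.
  rewrite (_ : (fun x0 => _) = fun p : T * R => (r p.1 ^+ 2 * pi) + (r p.1 ^+ 2 * pi)).
    by apply: measurable_funD; apply: measurable_funM => //; exact: measurable_funX.
  by apply/funext => p; rewrite mulr2n.
have mnf : measurable_fun setT (fun p : T * R => normal_fun (x p.1) (r p.1) p.2).
  apply: (measurableT_comp (@measurable_expR R)).
  apply: measurable_funM.
    rewrite (_ : (fun x0 => _) = fun p : T * R => -1 * (p.2 - x p.1) ^+ 2).
      by apply: measurable_funM => //; exact: measurable_funX.
    by apply/funext => p; rewrite mulN1r.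
  apply: measurable_fun_invr.
  rewrite (_ : (fun x0 => _) = fun p : T * R => r p.1 ^+ 2 + r p.1 ^+ 2).
    by apply: measurable_funD; exact: measurable_funX.
  by apply/funext => p; rewrite mulr2n.
apply: measurable_funM; first exact: measurable_funM.
exact: measurable_funM.
Qed.

Lemma measurable_gu d (T : measurableType d) (r x : T -> R) :
  measurable_fun setT r -> measurable_fun setT x ->
  measurable_fun setT (fun t => gu H (r t) (x t)).
Proof.
move=> mr mx; apply: measurable_funD.
  by apply: measurableT_comp => //; exact: lip_measurable.
by apply: measurable_gint => //; exact: measurable_cst.
Qed.

Lemma measurable_gb d (T : measurableType d) (r x : T -> R) :
  measurable_fun setT r -> measurable_fun setT x ->
  measurable_fun setT (fun t => gb H (r t) (x t)).
Proof.
move=> mr mx; apply: measurable_funM; first exact: measurable_fun_invr.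
by apply: measurable_gint => //; exact: measurable_id.
Qed.

Lemma measurable_gc d (T : measurableType d) (r x : T -> R) :
  measurable_fun setT r -> measurable_fun setT x ->
  measurable_fun setT (fun t => gc H (r t) (x t)).
Proof.
move=> mr mx; apply: measurable_funM.
  by apply: measurable_funX; exact: measurable_fun_invr.
apply: measurable_gint => //.
by apply: measurable_funB => //; exact: measurable_funX.
Qed.

End measurable_param.

(** * Remainder of one step *)

Section mm.
Variable R : realType.
Implicit Types x r : R.

Definition mm x r := Num.min (x ^+ 2 / r) (`|x| ^+ 3 / r ^+ 2).

Lemma mm_ge0 x r : 0 < r -> 0 <= mm x r.
Proof.
move=> r0; rewrite /mm le_min; apply/andP; split.
  by rewrite divr_ge0 ?sqr_ge0 ?ltW.
by apply: divr_ge0; apply: exprn_ge0 => //; exact: ltW.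
Qed.

(* tangent-line (Jensen) bound for the convex function [w ^ 2 / (1 + w)] at
   [w = v / r ^ 2], evaluated at [x ^ 2 / r ^ 2] *)
Lemma min_le_mm x v r : 0 < r -> 0 <= v ->
  Num.min (v / r) (v ^+ 2 / r ^+ 3) <=
  2 * (mm x r - (x ^+ 2 - v) * ((1 - ((1 + v / r ^+ 2)^-1) ^+ 2) / r)).
Proof.
move=> r0 v0; have rn := lt0r_neq0 r0.
set W := v / r ^+ 2; set z := `|x| / r; set Z := z ^+ 2.
have r20 : 0 < r ^+ 2 by rewrite exprn_gt0.
have W0 : 0 <= W by rewrite divr_ge0// ltW.
have z0 : 0 <= z by rewrite divr_ge0// ltW.
have Z0 : 0 <= Z by rewrite sqr_ge0.
have vE : v = W * r ^+ 2 by rewrite /W divfK// lt0r_neq0.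
have axE : `|x| = z * r by rewrite /z divfK.
have xE : x ^+ 2 = Z * r ^+ 2 by rewrite -real_normK ?num_real// axE exprMn.
have -> : v / r = W * r by rewrite vE; field.
have -> : v ^+ 2 / r ^+ 3 = W ^+ 2 * r by rewrite vE; field.
have -> : mm x r = Num.min (Z * r) (z ^+ 3 * r).
  rewrite /mm xE axE; congr Num.min; field; done.
have -> : (x ^+ 2 - v) * ((1 - (1 + W)^-1 ^+ 2) / r) = (Z - W) * (1 - (1 + W)^-1 ^+ 2) * r.
  rewrite xE vE; field.
  by rewrite rn lt0r_neq0//; lra.
have W1 : 0 < 1 + W by lra.
have Z1 : 0 < 1 + Z by lra.
(* [W - 1 + (1 + W)^-1] is [W^2 / (1 + W)]. It is at least half of [min (W, W^2)], and at [Z = z^2]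
   at most [min (Z, z^3)]. *)
have k1 : Num.min (W * r) (W ^+ 2 * r) <= 2 * (W - 1 + (1 + W)^-1) * r.
  have e : (W - 1 + (1 + W)^-1) * (1 + W) = W ^+ 2.
    by rewrite mulrDl mulVf ?lt0r_neq0//; ring.
  have [W1'|W1'] := lerP W 1.
    apply: (@le_trans _ _ (W ^+ 2 * r)); first by rewrite ge_min lexx orbT.
    by rewrite ler_wpM2r ?(ltW r0)//; nra.
  apply: (@le_trans _ _ (W * r)); first by rewrite ge_min lexx.
  by rewrite ler_wpM2r ?(ltW r0)//; nra.
have k2 : (Z - 1 + (1 + Z)^-1) * r <= Num.min (Z * r) (z ^+ 3 * r).
  have e : (Z - 1 + (1 + Z)^-1) * (1 + Z) = Z ^+ 2.
    by rewrite mulrDl mulVf ?lt0r_neq0//; ring.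
  have i1 : (1 + Z)^-1 <= 1 by rewrite invf_le1//; lra.
  rewrite le_min; apply/andP; split; rewrite ler_wpM2r ?(ltW r0)//; first lra.
  rewrite -(ler_pM2r Z1) e /Z.
  have := sqr_ge0 (z - 1); have : 0 <= z ^+ 3 by rewrite exprn_ge0.
  have -> : (z ^+ 2) ^+ 2 = z ^+ 3 * z by ring.
  nra.
have k3 : (W - 1 + (1 + W)^-1) + (Z - W) * (1 - (1 + W)^-1 ^+ 2) <= Z - 1 + (1 + Z)^-1.
  set a := (1 + W)^-1; set b := (1 + Z)^-1.
  have a0 : 0 < a by rewrite invr_gt0.
  have b0 : 0 < b by rewrite invr_gt0.
  have -> : Z = b^-1 - 1 by rewrite /b invrK; lra.
  have -> : W = a^-1 - 1 by rewrite /a invrK; lra.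
  have e : b^-1 - 1 - 1 + b - (a^-1 - 1 - 1 + a + (b^-1 - 1 - (a^-1 - 1)) * (1 - a ^+ 2)) =
     (b - a) ^+ 2 / b by field; rewrite !lt0r_neq0.
  rewrite -subr_ge0 e divr_ge0 ?sqr_ge0//; exact: ltW.
have k4 := ler_wpM2r (ltW r0) k3.
lra.
Qed.

End mm.

Lemma measurable_fun_mm d (T : measurableType d) (R : realType) (x r : T -> R) :
  measurable_fun setT x -> measurable_fun setT r ->
  measurable_fun setT (fun w => mm (x w) (r w)).
Proof.
move=> mx mr; apply: measurable_minr.
  apply: measurable_funM; first exact: measurable_funX.
  exact: measurable_fun_invr.
apply: measurable_funM.
  by apply: measurable_funX; apply: measurableT_comp.
by apply: measurable_fun_invr; exact: measurable_funX.
Qed.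

(** * The telescoping sum with predictable bandwidth *)

Section telescope.
Context d (T : measurableType d) (R : realType) (P : probability T R).
Variables (F : nat -> set (set T)) (y v : nat -> T -> R).
Hypothesis Hm : mdiff P F y v.
Local Notation intg f := (P.-integrable setT (EFin \o f)).
Local Notation mF k f := (@measurable_fun _ _ (g_sigma_algebraType (F k)) R setT f).
Variable H : R -> R.
Hypothesis Hlip : forall x y, `|H x - H y| <= `|x - y|.
Variable dl : R.
Hypothesis dl0 : 0 < dl.

Definition psum (f : nat -> T -> R) m w := \sum_(k < m) f k w.

Hypothesis A1 : forall m w, psum v m w <= 1.

(* The variance still to come, plus [dl ^+ 2] to keep the bandwidth positive. *)
Definition bw m w := Num.sqrt (1 + dl ^+ 2 - psum v m w).

Lemma bw_ge m w : dl <= bw m w.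
Proof.
rewrite -[leLHS]gtr0_norm// -sqrtr_sqr ler_sqrt.
  by have := A1 m w; lra.
by have := A1 m w; have := sqr_ge0 dl; lra.
Qed.

Lemma bw_gt0 m w : 0 < bw m w. Proof. exact: lt_le_trans (bw_ge m w). Qed.

Lemma bw_sqr m w : bw m w ^+ 2 = 1 + dl ^+ 2 - psum v m w.
Proof. by rewrite sqr_sqrtr//; have := A1 m w; have := sqr_ge0 dl; lra. Qed.

Lemma psum_ge0 m w : 0 <= psum v m w.
Proof. by apply: sumr_ge0 => k _; exact: md_v0 Hm k w. Qed.

Lemma bw_le m w : bw m w <= Num.sqrt (1 + dl ^+ 2).
Proof. by rewrite ler_wsqrtr// gerBl psum_ge0. Qed.

Lemma bw_step m w : bw m w = Num.sqrt (bw m.+1 w ^+ 2 + v m w).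
Proof. by rewrite bw_sqr /bw /psum big_ord_recr/=; congr Num.sqrt; ring. Qed.

(** The shift of index matters: [bw m.+1] involves [v m] but no later variance, so it is known
    before the increment [y m]. *)
Lemma bw_meas m : mF m (bw m.+1).
Proof.
apply: measurable_fun_sqrtr; apply: measurable_funB => //; exact: (md_sum_v Hm).
Qed.

Lemma psum_y_meas m : mF m (psum y m).
Proof. exact: (md_sum_y Hm). Qed.

Lemma psum_y_int m : intg (psum y m).
Proof. by apply: integrable_sum_real => k; exact: md_iy Hm k. Qed.

Lemma bw_measT m : measurable_fun setT (bw m).
Proof.
apply: measurable_fun_sqrtr; apply: measurable_funB => //.
apply: (@integrable_measurable _ _ _ P); apply: integrable_sum_real => k.
exact: md_iv Hm k.
Qed.

Lemma gu_bw_int m : intg (fun w => gu H (bw m w) (psum y m w)).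
Proof.
apply: (@integrable_le _ _ _ _ _ (fun w =>
  (`|H 0| + 2 * K1 R * Num.sqrt (1 + dl ^+ 2)) + `|psum y m w|)).
- apply: measurable_gu => //; first exact: bw_measT.
  exact: integrable_measurable (psum_y_int m).
- apply: integrableD_real; first exact: integrable_cst_real.
  exact: (integrable_norm (psum_y_int m)).
- move=> w; have := gu_sub Hlip (psum y m w) (bw_gt0 m w).
  have := Hlip (psum y m w) 0; rewrite subr0.
  have : 2 * K1 R * bw m w <= 2 * K1 R * Num.sqrt (1 + dl ^+ 2).
    by rewrite ler_wpM2l ?bw_le// /K1; lra.
  set g := gu _ _ _; set h := H (psum y m w); set h0 := H 0.
  have := ler_normD (g - h) h; rewrite subrK.
  have := ler_normD (h - h0) h0; rewrite subrK; lra.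
Qed.

Lemma mm_int m : intg (fun w => mm (y m w) (bw m.+1 w)).
Proof.
apply: (@integrable_le _ _ _ _ _ (fun w => dl^-1 * y m w ^+ 2)).
- apply: measurable_fun_mm; last exact: bw_measT.
  exact: integrable_measurable (md_iy Hm m).
- by apply: integrableZ_real; exact: md_iy2 Hm m.
- move=> w; rewrite ger0_norm ?mm_ge0 ?bw_gt0// ge_min; apply/orP; left.
  rewrite mulrC ler_wpM2r ?sqr_ge0// lef_pV2 ?posrE ?bw_ge ?bw_gt0//.
Qed.

(** Both expectations are compared with the smoothing at the old sum and the new bandwidth: one
    differs by the shift [y m], the other by the variance [v m]. The constant 3 is one remainder for
    the shift plus the factor 2 of [min_le_mm], which converts the remainder for the variance. *)
Lemma lindeberg_step m :
  `|\int[P]_w gu H (bw m.+1 w) (psum y m.+1 w) - \int[P]_w gu H (bw m w) (psum y m w)|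
  <= 3 * K2 R * \int[P]_w mm (y m w) (bw m.+1 w).
Proof.
pose r := bw m.+1; pose S := psum y m.
have r0 w : 0 < r w by exact: bw_gt0.
have rd w : dl <= r w by exact: bw_ge.
have [K2a _ _] := K2_ge R.
have K20 : 0 <= K2 R by apply: le_trans K2a; rewrite mulr_ge0 ?expR_ge0.
have kk : 0 <= K1 R by rewrite /K1 sqr_ge0.
have mSF : mF m S by exact: psum_y_meas.
have mrF : mF m r by exact: bw_meas.
pose b w := gb H (r w) (S w); pose c w := gc H (r w) (S w) / 2.
have mb : mF m b by exact: measurable_gb.
have mc : mF m c by apply: measurable_funM => //; exact: measurable_gc.
have bb w : `|b w| <= 2 * K1 R by exact: gb_le.
have cb w : `|c w| <= K1 R / dl.
  rewrite /c normrM (ger0_norm (_ : 0 <= 2^-1)) ?invr_ge0//.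
  have h := gc_le Hlip (S w) (r0 w).
  have : 2 * K1 R / r w <= 2 * K1 R / dl.
    by rewrite ler_wpM2l ?mulr_ge0// lef_pV2 ?posrE.
  lra.
(* The slope of the tangent in [min_le_mm]; it is predictable, so its product with [y m ^ 2 - v m]
   has mean zero. *)
pose g w := (1 - ((1 + v m w / r w ^+ 2)^-1) ^+ 2) / r w.
have mg : mF m g.
  apply: measurable_funM; last exact: measurable_fun_invr.
  apply: measurable_funB => //; apply: measurable_funX; apply: measurable_fun_invr.
  apply: measurable_funD => //; apply: measurable_funM; first exact: md_v Hm m.
  by apply: measurable_fun_invr; exact: measurable_funX.
have gb' w : `|g w| <= dl^-1.
  have W0 : 0 <= v m w / r w ^+ 2 by rewrite divr_ge0 ?sqr_ge0 ?(md_v0 Hm).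
  set a := (1 + v m w / r w ^+ 2)^-1.
  have a0 : 0 <= a by rewrite invr_ge0; lra.
  have a1 : a <= 1 by rewrite invf_le1; lra.
  rewrite /g -/a normrM normfV (gtr0_norm (r0 w)).
  apply: (@le_trans _ _ (1 * (r w)^-1)).
    by rewrite ler_wpM2r ?invr_ge0 ?(ltW (r0 w))// ler_norml; apply/andP; split; nra.
  by rewrite mul1r lef_pV2 ?posrE.
have iyb : intg (fun w => y m w * b w).
  exact: integrable_mul_bounded (md_iy Hm m) (md_meas Hm mb) bb.
have iyc : intg (fun w => y m w ^+ 2 * c w).
  exact: integrable_mul_bounded (md_iy2 Hm m) (md_meas Hm mc) cb.
have ivc : intg (fun w => v m w * c w).
  exact: integrable_mul_bounded (md_iv Hm m) (md_meas Hm mc) cb.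
have iyg : intg (fun w => y m w ^+ 2 * g w).
  exact: integrable_mul_bounded (md_iy2 Hm m) (md_meas Hm mg) gb'.
have ivg : intg (fun w => v m w * g w).
  exact: integrable_mul_bounded (md_iv Hm m) (md_meas Hm mg) gb'.
have im := mm_int m.
have ig := gu_bw_int.
(* [lin] has zero mean and [bnd] has mean [3 * K2] times that of [mm] *)
pose lin w := y m w * b w + (y m w ^+ 2 * c w - v m w * c w).
pose bnd w := K2 R * (3 * mm (y m w) (r w) - 2 * (y m w ^+ 2 * g w - v m w * g w)).
have ilin : intg lin by apply: integrableD_real => //; exact: integrableB_real.
have iq : intg (fun w => 3 * mm (y m w) (r w) - 2 * (y m w ^+ 2 * g w - v m w * g w)).
  apply: integrableB_real; first exact: integrableZ_real.
  by apply: integrableZ_real; exact: integrableB_real.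
have ibnd : intg bnd by exact: integrableZ_real.
have Elin : \int[P]_w lin w = 0.
  have iyv : intg (fun w => y m w ^+ 2 * c w - v m w * c w) by exact: integrableB_real.
  by rewrite RintegralD// RintegralB// (md_Ey Hm _ _ _ mb bb) (md_Ey2 Hm _ _ _ mc cb) subrr addr0.
have Ebnd : \int[P]_w bnd w = 3 * K2 R * \int[P]_w mm (y m w) (r w).
  have iyv : intg (fun w => y m w ^+ 2 * g w - v m w * g w) by exact: integrableB_real.
  have i1 := integrableZ_real 3 im; have i2 := integrableZ_real 2 iyv.
  rewrite RintegralZl// RintegralB// !RintegralZl// RintegralB//.
  by rewrite (md_Ey2 Hm _ _ _ mg gb') subrr mulr0 subr0 mulrA [K2 R * 3]mulrC.
rewrite -RintegralB//.
have idf := integrableB_real (ig m.+1) (ig m).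
have idl := integrableB_real idf ilin.
rewrite -[X in `|X|]subr0 -Elin -RintegralB//.
apply: le_trans (le_normr_Rintegral measurableT idl) _.
rewrite -Ebnd; apply: le_RintegralT => //; first exact: (integrable_norm idl).
move=> w.
have -> : psum y m.+1 w = S w + y m w by rewrite /psum big_ord_recr.
rewrite (bw_step m w) -/(r w) -/(S w).
have h1 := gu_space Hlip (S w) (y m w) (r0 w).
have h2 := gu_time Hlip (S w) (r0 w) (md_v0 Hm m w).
have h3 := min_le_mm (y m w) (r0 w) (md_v0 Hm m w).
rewrite -/(mm _ _) in h1.
have h4 := ler_wpM2l K20 h3.
set X1 := gu H (r w) (S w + y m w) in h1 *.
set X2 := gu H (Num.sqrt _) (S w) in h2 *.
set X0 := gu H (r w) (S w) in h1 h2 *.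
have -> : X1 - X2 - lin w =
  (X1 - X0 - gb H (r w) (S w) * y m w - gc H (r w) (S w) * y m w ^+ 2 / 2) -
  (X2 - X0 - gc H (r w) (S w) * v m w / 2).
  by rewrite /lin /b /c; field.
apply: le_trans (ler_normB _ _) _.
rewrite /bnd -/(g w) in h4 *; lra.
Qed.

Lemma lindeberg_sum n :
  `|\int[P]_w gu H (bw n w) (psum y n w) - gu H (Num.sqrt (1 + dl ^+ 2)) 0| <=
  3 * K2 R * \sum_(k < n) \int[P]_w mm (y k w) (bw k.+1 w).
Proof.
pose U m := \int[P]_w gu H (bw m w) (psum y m w).
pose M k := \int[P]_w mm (y k w) (bw k.+1 w).
have U0 : gu H (Num.sqrt (1 + dl ^+ 2)) 0 = U 0%N.
  rewrite -[LHS](Rintegral_cst_prob P); apply: eq_Rintegral => w _.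
  by rewrite /bw /psum !big_ord0 subr0.
have step m : `|U m.+1 - U m| <= 3 * K2 R * M m by exact: lindeberg_step.
rewrite U0; change (`|U n - U 0%N| <= 3 * K2 R * \sum_(k < n) M k).
clearbody U M; elim: n => [|n IH]; first by rewrite subrr normr0 big_ord0 mulr0.
rewrite big_ord_recr/= mulrDr -(subrK (U n) (U n.+1)) -addrA addrC.
by apply: le_trans (ler_normD _ _) _; apply: lerD.
Qed.

End telescope.

(** * Power weights for the sum of the remainders *)

Section weights.
Variable R : realType.
Implicit Types x D : R.

Definition wt (eta x : R) := expR (- eta * ln x).

Definition tail2 (dl x : R) := if dl < `|x| then x ^+ 2 else 0.

Lemma measurable_tail2 dl : measurable_fun setT (tail2 dl).
Proof.
apply: measurable_fun_ifT => //.
by apply: measurable_fun_ltr => //; exact: measurableT_comp.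
Qed.

Lemma tail2_ge0 dl x : 0 <= tail2 dl x.
Proof. by rewrite /tail2; case: ifP => // _; rewrite sqr_ge0. Qed.

Lemma tail2_le dl x : tail2 dl x <= x ^+ 2.
Proof. by rewrite /tail2; case: ifP => // _; rewrite sqr_ge0. Qed.

Lemma wt_ge0 eta x : 0 <= wt eta x. Proof. exact: expR_ge0. Qed.

Lemma wt_le1 eta x : 0 <= eta -> 1 <= x -> wt eta x <= 1.
Proof.
move=> e0 x1; rewrite -[leRHS]expR0 ler_expR mulNr oppr_le0.
by rewrite mulr_ge0// ln_ge0.
Qed.

Lemma wt_noninc eta x x' : 0 <= eta -> 0 < x -> x <= x' -> wt eta x' <= wt eta x.
Proof.
move=> e0 x0 xx; rewrite ler_expR !mulNr lerN2 ler_wpM2l// ler_ln ?posrE//.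
exact: lt_le_trans xx.
Qed.

(* discrete form of [x ^ (- (1 + eta)) = - (x ^ - eta / eta)'] *)
Lemma wt_step eta x D : 0 < eta <= 1 -> 1 <= x -> 0 <= D <= 1 ->
  D * (wt eta x / x) <= 3 / eta * (wt eta x - wt eta (x + D)).
Proof.
move=> /andP[e0 e1] x1 /andP[D0 D1]; have x0 : 0 < x by lra.
set q := D / x; have qE : D = q * x by rewrite /q divfK// lt0r_neq0.
have q0 : 0 <= q by rewrite divr_ge0// ltW.
have q1 : q <= 1 by rewrite ler_pdivrMr//; lra.
have q1' : 0 < 1 + q by lra.
have lq : q / 2 <= ln (1 + q).
  have h := @le_ln1Dx R (- (q / (1 + q))).
  have e : 1 + - (q / (1 + q)) = (1 + q)^-1 by field; exact: lt0r_neq0.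
  rewrite e lnV ?posrE// in h.
  have b : q / 2 <= q / (1 + q) by rewrite ler_wpM2l// lef_pV2 ?posrE//; lra.
  have : q / (1 + q) < 1 by rewrite ltr_pdivrMr//; lra.
  by move=> c; have := h _; lra.
have -> : wt eta (x + D) = wt eta x * expR (- eta * ln (1 + q)).
  rewrite /wt -expRD -mulrDr -lnM ?posrE//; congr expR; congr (_ * ln _).
  by rewrite qE; ring.
have -> : D * (wt eta x / x) = wt eta x * q by rewrite qE; field; exact: lt0r_neq0.
have -> : 3 / eta * (wt eta x - wt eta x * expR (- eta * ln (1 + q))) =
  wt eta x * (3 / eta * (1 - expR (- eta * ln (1 + q)))) by ring.
(* Since [s <= 1/2], one has [1 - (1 + s)^-1 >= 2/3 s], and [3/eta * (2/3 * s) = q]; hence the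
   constant 3. *)
set s := eta * q / 2.
have s0 : 0 <= s by rewrite divr_ge0// mulr_ge0// ltW.
have s1 : s <= 2^-1 by rewrite /s; nra.
have h1 : expR (- eta * ln (1 + q)) <= (1 + s)^-1.
  apply: (@le_trans _ _ (expR (- s))).
    by rewrite ler_expR mulNr lerN2 /s -mulrA ler_wpM2l// ltW.
  by rewrite expRN lef_pV2 ?posrE ?expR_gt0 ?expR_ge1Dx//; lra.
have h2 : 2 / 3 * s <= 1 - (1 + s)^-1.
  have e : (1 - (1 + s)^-1) * (1 + s) = s by rewrite mulrBl mulVf ?lt0r_neq0//; lra.
  have : 0 <= 1 - (1 + s)^-1.
    by rewrite subr_ge0 invf_le1; lra.
  nra.
have -> : wt eta x * q = wt eta x * (3 / eta * (2 / 3 * s)).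
  by rewrite /s; field; exact: lt0r_neq0.
have p : 0 <= 3 / eta by rewrite divr_ge0// ltW.
by rewrite ler_wpM2l ?wt_ge0//; apply: (ler_wpM2l p); lra.
Qed.

End weights.

(** * Summing the remainders *)

Section mm_sum.
Context d (T : measurableType d) (R : realType) (P : probability T R).
Variables (F : nat -> set (set T)) (y v : nat -> T -> R).
Hypothesis Hm : mdiff P F y v.
Local Notation intg f := (P.-integrable setT (EFin \o f)).
Local Notation mF k f := (@measurable_fun _ _ (g_sigma_algebraType (F k)) R setT f).
Variable dl : R.
Hypothesis dl0 : 0 < dl.

Lemma tail2_int k : intg (fun w => tail2 dl (y k w)).
Proof.
apply: (@integrable_le _ _ _ _ _ (fun w => y k w ^+ 2)).
- apply: (measurableT_comp (measurable_tail2 dl)).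
  exact: integrable_measurable (md_iy Hm k).
- exact: md_iy2 Hm k.
- by move=> w; rewrite ger0_norm ?tail2_ge0// tail2_le.
Qed.

(** On the event [v k > dl^2], known at time [k], [v k] may be replaced by [y k ^ 2] under the
    integral, and [y^2 - dl^2 <= tail2 dl y] pointwise. *)
Lemma pos_var_le k :
  \int[P]_w Num.max (v k w - dl ^+ 2) 0 <= \int[P]_w tail2 dl (y k w).
Proof.
pose J w : R := if dl ^+ 2 < v k w then 1 else 0.
have mJ : mF k J.
  apply: measurable_fun_ifT => //; apply: measurable_fun_ltr => //.
  exact: md_v Hm k.
have Jb w : `|J w| <= 1 by rewrite /J; case: ifP; rewrite ?normr1 ?normr0.
have i1 := integrable_mul_bounded (md_iy2 Hm k) (md_meas Hm mJ) Jb.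
have i2 := integrable_mul_bounded (md_iv Hm k) (md_meas Hm mJ) Jb.
have i3 := integrableB_real i1 i2.
have it := tail2_int k.
have -> : \int[P]_w tail2 dl (y k w) =
    \int[P]_w (tail2 dl (y k w) - (y k w ^+ 2 * J w - v k w * J w)).
  by rewrite RintegralB// RintegralB// (md_Ey2 Hm _ _ _ mJ Jb) subrr subr0.
apply: le_RintegralT.
- apply: (@integrable_le _ _ _ _ _ (v k)).
  + apply: measurable_maxr => //; apply: measurable_funB => //.
    exact: integrable_measurable (md_iv Hm k).
  + exact: md_iv Hm k.
  + move=> w; have v0 := md_v0 Hm k w; have := sqr_ge0 dl => d0.
    rewrite ger0_norm ?le_max ?lexx ?orbT// ge_max; apply/andP; split; lra.
- exact: integrableB_real.
- move=> w; rewrite /J; case: ltP => vd; last first.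
    rewrite !mulr0 subrr subr0 (_ : Num.max _ _ = 0) ?tail2_ge0//.
    by apply/max_idPr; rewrite subr_le0.
  rewrite !mulr1 (_ : Num.max _ _ = v k w - dl ^+ 2); last first.
    by apply/max_idPl; rewrite subr_ge0 ltW.
  rewrite /tail2; have d2 := sqr_ge0 dl; case: ltP => yd; first lra.
  have : y k w ^+ 2 <= dl ^+ 2.
    by rewrite -real_normK ?num_real//; apply: lerXn2r; rewrite ?nnegrE ?(ltW dl0).
  lra.
Qed.

Hypothesis A1 : forall m w, psum v m w <= 1.
Local Notation r := (bw v dl).
Variable n : nat.
Variable eta : R.
Hypothesis eta01 : 0 < eta <= 1.
(** [g] collects the part of the cubic remainder that the telescoping weight cannot absorb: zero for
    the logarithmic bound, a truncated p-th power for the other one. *)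
Variable g : R -> R.
Hypothesis g0 : forall x, 0 <= g x.
Hypothesis ig : forall k, intg (fun w => g (y k w)).
Hypothesis gP : forall x s, `|x| <= dl -> dl <= s -> s ^+ 2 <= 1 + dl ^+ 2 ->
  `|x| ^+ 3 / s ^+ 2 <=
  2 * dl * ((x / dl) ^+ 2 * (wt eta (s ^+ 2 / dl ^+ 2) / (s ^+ 2 / dl ^+ 2))) + g x.
Hypothesis tailP : \sum_(k < n) \int[P]_w tail2 dl (y k w) <= dl ^+ 2.
Hypothesis gsumP : \sum_(k < n) \int[P]_w g (y k w) <= dl.

Local Notation xr k w := (r k w ^+ 2 / dl ^+ 2).

Lemma xr_ge1 k w : 1 <= xr k w.
Proof.
have h := bw_ge dl0 A1 k w.
rewrite ler_pdivlMr ?exprn_gt0// mul1r; apply: lerXn2r; rewrite ?nnegrE//.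
  exact: ltW.
exact: ltW (bw_gt0 dl0 A1 k w).
Qed.

(** Jumps above [dl] are charged to [tail2] through [r >= dl], the others to [g] and to the decrease
    of the weight. The last product is centred, as its second factor is predictable. *)
Lemma mm_pointwise k w :
  mm (y k w) (r k.+1 w) <= dl^-1 * tail2 dl (y k w) + g (y k w) +
   (2 * dl) * (3 / eta * (wt eta (xr k.+1 w) - wt eta (xr k w)) +
     (y k w ^+ 2 - v k w) * (dl^-1 ^+ 2 * ((if v k w <= dl ^+ 2 then 1 else 0) * (wt eta (xr k.+1 w) / xr k.+1 w)))).
Proof.
set J := if v k w <= _ then _ else _; have /andP[e0 e1] := eta01.
have X1 := xr_ge1 k.+1 w.
have v0 := md_v0 Hm k w.
have d20 : 0 < dl ^+ 2 by rewrite exprn_gt0.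
have dn := lt0r_neq0 dl0.
set V := v k w / dl ^+ 2.
have V0 : 0 <= V by rewrite divr_ge0// ltW.
have XV : xr k w = xr k.+1 w + V.
  by rewrite !(bw_sqr dl A1) /V /psum big_ord_recr/=; field.
set X := xr k.+1 w in X1 XV *; rewrite XV.
have X0 : 0 < X by lra.
set G := wt eta X / X.
have G0 : 0 <= G by rewrite divr_ge0 ?wt_ge0// ltW.
set q := (y k w / dl) ^+ 2.
have q0 : 0 <= q by rewrite sqr_ge0.
(* If [V <= 1], [wt_step] applies with [D = V], and exchanging [V] for [q] produces the centred
   term. If [V > 1], it applies with [D = 1] and the weight only drops further; this suffices
   because [q <= 1] for small jumps. *)
have key : (if V <= 1 then q else 1) * G <= 3 / eta * (wt eta X - wt eta (X + V)) +
     (y k w ^+ 2 - v k w) * (dl^-1 ^+ 2 * (J * G)).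
  have JE : J = if V <= 1 then 1 else 0 by rewrite /J /V ler_pdivrMr// mul1r.
  rewrite JE; case: (leP V 1) => V1.
    have := @wt_step R eta X V eta01 X1; rewrite V0 V1 => /(_ isT); rewrite -/G.
    have -> : (y k w ^+ 2 - v k w) * (dl^-1 ^+ 2 * (1 * G)) = q * G - V * G.
      by rewrite /q /V; field.
    lra.
  have := @wt_step R eta X 1 eta01 X1; rewrite lexx ler01 mul1r -/G => /(_ isT) h.
  have h2 : wt eta (X + V) <= wt eta (X + 1) by apply: wt_noninc; lra.
  have h3 : 3 / eta * (wt eta X - wt eta (X + 1)) <= 3 / eta * (wt eta X - wt eta (X + V)).
    have p : 0 <= 3 / eta by rewrite divr_ge0// ltW.
    by apply: (ler_wpM2l p); lra.
  by rewrite mul0r !mulr0 addr0; exact: le_trans h h3.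
have kG : 0 <= (if V <= 1 then q else 1) * G by rewrite mulr_ge0//; case: ifP.
have r0 := bw_gt0 dl0 A1 k.+1 w; have rd := bw_ge dl0 A1 k.+1 w.
have dl20 : 0 <= 2 * dl by rewrite mulr_ge0// ltW.
apply: (@le_trans _ _ (dl^-1 * tail2 dl (y k w) + g (y k w) +
   2 * dl * ((if V <= 1 then q else 1) * G))); last first.
  by rewrite lerD2l ler_wpM2l.
have := g0 (y k w); rewrite /tail2; case: ltP => yd gy.
  apply: (@le_trans _ _ (dl^-1 * y k w ^+ 2)).
    rewrite /mm ge_min; apply/orP; left.
    by rewrite mulrC ler_wpM2r ?sqr_ge0// lef_pV2 ?posrE.
  have := mulr_ge0 dl20 kG; lra.
rewrite mulr0 add0r addrC.
apply: (@le_trans _ _ (2 * dl * (q * G) + g (y k w))).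
  apply: (@le_trans _ _ (`|y k w| ^+ 3 / r k.+1 w ^+ 2)).
    by rewrite /mm ge_min lexx orbT.
  apply: gP => //; rewrite (bw_sqr dl A1) gerBl.
  exact: (psum_ge0 Hm).
rewrite lerD2r ler_wpM2l// ler_wpM2r//.
case: ifP => // _.
have : (`|y k w| / dl) ^+ 2 <= 1.
  by rewrite expr_le1// ?divr_ge0// ?(ltW dl0)// ler_pdivrMr// mul1r.
by rewrite expr_div_n real_normK ?num_real// -expr_div_n.
Qed.

Lemma wt_xr_int k : intg (fun w => wt eta (xr k w)).
Proof.
have /andP[e0 e1] := eta01.
apply: (@integrable_le _ _ _ _ _ (fun=> 1)).
- apply: (measurableT_comp (@measurable_expR R)); apply: measurable_funM => //.
  apply: (measurableT_comp (@measurable_ln R)); apply: measurable_funM => //.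
  by apply: measurable_funX; exact: bw_measT Hm _ _.
- exact: integrable_cst_real.
- by move=> w; rewrite ger0_norm ?wt_ge0// wt_le1 ?xr_ge1// ltW.
Qed.

(** The tails and [g] contribute [dl] each; the weights lie between 0 and 1, so their telescoping
    sum contributes [2 * dl * (3 / eta)]. As [eta <= 1], this gives the constant 8. *)
Lemma mm_sum_bound :
  \sum_(k < n) \int[P]_w mm (y k w) (r k.+1 w) <= 8 * dl / eta.
Proof.
have /andP[e0 e1] := eta01.
pose W k := \int[P]_w wt eta (xr k w).
have step k : \int[P]_w mm (y k w) (r k.+1 w) <=
   dl^-1 * \int[P]_w tail2 dl (y k w) + \int[P]_w g (y k w) +
   2 * dl * (3 / eta) * (W k.+1 - W k).
  pose J w : R := if v k w <= dl ^+ 2 then 1 else 0.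
  pose h w := dl^-1 ^+ 2 * (J w * (wt eta (xr k.+1 w) / xr k.+1 w)).
  have mJ : mF k J.
    apply: measurable_fun_ifT => //; apply: measurable_fun_ler => //.
    exact: md_v Hm k.
  have mxr : mF k (fun w => xr k.+1 w).
    apply: measurable_funM => //; apply: measurable_funX; exact: bw_meas Hm _ _.
  have mh : mF k h.
    apply: measurable_funM => //; apply: measurable_funM => //.
    apply: measurable_funM; last exact: measurable_fun_invr.
    apply: (measurableT_comp (@measurable_expR R)); apply: measurable_funM => //.
    exact: (measurableT_comp (@measurable_ln R)).
  have hb w : `|h w| <= dl^-1 ^+ 2.
    have X1 := xr_ge1 k.+1 w.
    have G0 : 0 <= wt eta (xr k.+1 w) / xr k.+1 w by rewrite divr_ge0 ?wt_ge0//; lra.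
    have G1 : wt eta (xr k.+1 w) / xr k.+1 w <= 1.
      have h1 := wt_le1 (ltW e0) X1.
      by rewrite ler_pdivrMr; lra.
    have J0 : 0 <= J w <= 1 by rewrite /J; case: ifP; rewrite ?lexx ?ler01.
    rewrite ger0_norm; last by rewrite mulr_ge0 ?sqr_ge0// mulr_ge0//; lra.
    by rewrite ler_piMr ?sqr_ge0//; nra.
  have iyh := integrable_mul_bounded (md_iy2 Hm k) (md_meas Hm mh) hb.
  have ivh := integrable_mul_bounded (md_iv Hm k) (md_meas Hm mh) hb.
  have it := integrableZ_real dl^-1 (tail2_int k).
  have iw := integrableB_real (wt_xr_int k.+1) (wt_xr_int k).
  have iw2 := integrableZ_real (3 / eta) iw.
  have iyv := integrableB_real iyh ivh.
  have itg := integrableD_real it (ig k).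
  have iB := integrableD_real iw2 iyv.
  have iBB := integrableZ_real (2 * dl) iB.
  apply: (@le_trans _ _ (\int[P]_w (dl^-1 * tail2 dl (y k w) + g (y k w) +
   (2 * dl) * (3 / eta * (wt eta (xr k.+1 w) - wt eta (xr k w)) +
     (y k w ^+ 2 * h w - v k w * h w))))).
    apply: le_RintegralT.
    - exact: (mm_int Hm dl0 A1 k).
    - exact: integrableD_real.
    - by move=> w; apply: le_trans (mm_pointwise k w) _; rewrite -mulrBl.
  rewrite (RintegralD measurableT itg iBB) (RintegralD measurableT it (ig k)).
  rewrite (RintegralZl _ measurableT (tail2_int k)) (RintegralZl _ measurableT iB).
  rewrite (RintegralD measurableT iw2 iyv) (RintegralZl _ measurableT iw).
  rewrite (RintegralB measurableT iyh ivh) (md_Ey2 Hm _ _ _ mh hb) subrr addr0.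
  by rewrite (RintegralB measurableT (wt_xr_int k.+1) (wt_xr_int k)) [2 * dl * (_ * _)]mulrA.
apply: (@le_trans _ _ (\sum_(k < n) (dl^-1 * \int[P]_w tail2 dl (y k w) +
   \int[P]_w g (y k w) + 2 * dl * (3 / eta) * (W k.+1 - W k)))).
  by apply: ler_sum => k _; exact: step.
rewrite big_split big_split/= -mulr_sumr -mulr_sumr.
have -> : \sum_(k < n) (W k.+1 - W k) = W n - W 0%N.
  by rewrite -(big_mkord xpredT (fun k => W k.+1 - W k)) telescope_sumr.
have W0 k : 0 <= W k <= 1.
  apply/andP; split; first by apply: Rintegral_ge0 => w _; exact: wt_ge0.
  rewrite -(Rintegral_cst_prob P 1); apply: le_RintegralT.
  - exact: wt_xr_int.
  - exact: integrable_cst_real.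
  - by move=> w; rewrite wt_le1 ?xr_ge1// ltW.
have h1 : dl^-1 * \sum_(k < n) \int[P]_w tail2 dl (y k w) <= dl.
  by rewrite mulrC ler_pdivrMr// -expr2.
have p : 0 <= 2 * dl * (3 / eta) by rewrite !mulr_ge0 ?invr_ge0// ltW.
have h2 : 2 * dl * (3 / eta) * (W n - W 0%N) <= 2 * dl * (3 / eta).
  have /andP[_ a1] := W0 n; have /andP[b0 _] := W0 0%N.
  by rewrite ler_piMr// lerBlDr (le_trans a1)// lerDl.
have h3 : 2 * dl * (3 / eta) = 6 * (dl / eta).
  by rewrite mulrACA; congr (_ * _); ring.
have h4 : dl <= dl / eta by rewrite ler_peMr ?(ltW dl0)// invf_ge1.
have -> : 8 * dl / eta = dl / eta + dl / eta + 6 * (dl / eta).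
  by rewrite -mulrA; set z := dl / eta; ring.
rewrite -h3; apply: lerD h2; apply: lerD; first exact: le_trans h1 h4.
exact: le_trans gsumP h4.
Qed.

End mm_sum.

(** * Pathwise effect of stopping the variance at level 1 *)

Section stopping.
Context (R : realType) (v : nat -> R).
Hypothesis v0 : forall k, 0 <= v k.
Variable c : R.
Hypothesis c0 : 0 <= c.

Let A m := \sum_(k < m) v k.
(** The test includes [v k], so the increment that would cross level 1 is already dropped and there
    is no overshoot. *)
Let J k : R := if A k.+1 <= 1 then 1 else 0.
Let A' m := \sum_(k < m) J k * v k.
(** Dominates every [v k] with [k < m], and has small mean when [c = dl^2], by [pos_var_le]. *)
Let B m := c + \sum_(k < m) Num.max (v k - c) 0.

Let A_incr m : A m <= A m.+1.
Proof. by rewrite /A big_ord_recr/= lerDl. Qed.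

Let stop_eq0 m : 1 < A m.+1 -> J m = 0.
Proof. by rewrite /J ltNge => /negbTE ->. Qed.

Let stopped_eq m : A m <= 1 -> A' m = A m.
Proof.
elim: m => [|m IH] Am; first by rewrite /A /A' !big_ord0.
have Am' : A m <= 1 by exact: le_trans (A_incr m) Am.
by rewrite /A' /A !big_ord_recr/= -/(A' m) -/(A m) IH// /J Am mul1r.
Qed.

Lemma stopped_le1 m : \sum_(k < m) J k * v k <= 1.
Proof.
elim: m => [|m IH]; first by rewrite big_ord0.
case: (lerP (A m.+1) 1) => Am; first by rewrite -[leLHS]/(A' m.+1) stopped_eq.
by rewrite big_ord_recr/= stop_eq0// mul0r addr0.
Qed.

Let B_incr m : B m <= B m.+1.
Proof. by rewrite /B big_ord_recr/= addrA lerDl le_max lexx orbT. Qed.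

Let B_ge0 m : 0 <= B m.
Proof. by rewrite addr_ge0// sumr_ge0// => k _; rewrite le_max lexx orbT. Qed.

(** At the crossing the missing variance is less than the increment that crosses, which [B]
    dominates; afterwards the stopped sum is frozen and [B] only grows. *)
Let stopped_gap m : 1 < A m -> 1 - A' m <= B m.
Proof.
elim: m => [|m IH]; first by rewrite /A big_ord0 ltr10.
move=> Am.
have eA' : A' m.+1 = A' m.
  by rewrite /A' big_ord_recr/= stop_eq0// mul0r addr0.
rewrite eA'; case: (lerP (A m) 1) => Am'; last exact: le_trans (IH Am') (B_incr m).
rewrite stopped_eq//.
have : B m.+1 >= v m.
  rewrite /B big_ord_recr/=.
  have : 0 <= \sum_(k < m) Num.max (v k - c) 0.
    by apply: sumr_ge0 => k _; rewrite le_max lexx orbT.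
  have : v m - c <= Num.max (v m - c) 0 by rewrite le_max lexx.
  lra.
move: Am; rewrite /A big_ord_recr/= -/(A m); lra.
Qed.

Lemma stopped_left m : 1 - \sum_(k < m) J k * v k <= `|A m - 1| + B m.
Proof.
rewrite -/(A' m); case: (lerP (A m) 1) => Am.
  by rewrite stopped_eq//; have := B_ge0 m; lra.
by have := stopped_gap Am; lra.
Qed.

Lemma stopped_right m : \sum_(k < m) v k - \sum_(k < m) J k * v k <= `|A m - 1| + B m.
Proof.
rewrite -/(A m) -/(A' m); case: (lerP (A m) 1) => Am.
  by rewrite stopped_eq//; have := B_ge0 m; lra.
by have := stopped_gap Am; lra.
Qed.

End stopping.

Lemma sqrtrD_le (R : realType) (a b : R) : 0 <= a -> 0 <= b ->
  Num.sqrt (a + b) <= Num.sqrt a + Num.sqrt b.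
Proof.
move=> a0 b0; have s0 := addr_ge0 (sqrtr_ge0 a) (sqrtr_ge0 b).
rewrite -[leRHS]ger0_norm// -sqrtr_sqr ler_sqrt ?sqr_ge0//.
rewrite sqrrD !sqr_sqrtr//.
have : 0 <= Num.sqrt a * Num.sqrt b by rewrite mulr_ge0.
rewrite mulr2n; lra.
Qed.

(** Linear in [b]: after integration with [a = dl], a mean at most [dl^2] costs only another
    [dl]. *)
Lemma sqrtr_sqrD_le (R : realType) (a b : R) : 0 < a -> 0 <= b ->
  Num.sqrt (a ^+ 2 + b) <= a + a^-1 * b.
Proof.
move=> a0 b0; have s0 : 0 <= a + a^-1 * b.
  by rewrite addr_ge0 ?(ltW a0)// mulr_ge0// invr_ge0 ltW.
rewrite -[leRHS]ger0_norm// -sqrtr_sqr ler_sqrt ?sqr_ge0//.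
have -> : (a + a^-1 * b) ^+ 2 = a ^+ 2 + 2 * b + (a^-1 * b) ^+ 2.
  by field; exact: lt0r_neq0.
have := sqr_ge0 (a^-1 * b); lra.
Qed.

(** In [mdiff_clt] the coefficient of [dl / eta] adds up to [25 K2 + 12 K1 + 4] and that of the
    variance term to [2 K1 + 2]; [K3] is their sum. *)
Definition K3 (R : realType) : R := 25 * K2 R + 14 * K1 R + 6.

(** Removes the extra variance [dl^2] of the initial bandwidth: a single heat step from 1 if
    [dl <= 1], and otherwise a comparison of both smoothings with [H 0]. *)
Lemma gu_bandwidth (R : realType) (H : R -> R) (dl : R) :
  (forall x y, `|H x - H y| <= `|x - y|) -> 0 < dl ->
  `|gu H (Num.sqrt (1 + dl ^+ 2)) 0 - gu H 1 0| <= (6 * K1 R + K2 R) * dl.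
Proof.
move=> Hlip dl0; have [K2a _ _] := K2_ge R.
have K20 : 0 <= K2 R by apply: le_trans K2a; rewrite mulr_ge0 ?expR_ge0.
have K10 : 0 <= K1 R by rewrite /K1 sqr_ge0.
have d2 := sqr_ge0 dl.
have K1dl : 0 <= K1 R * dl by rewrite mulr_ge0// ltW.
have K2dl : 0 <= K2 R * dl by rewrite mulr_ge0// ltW.
case: (lerP dl 1) => dl1.
  have h := gu_time Hlip 0 ltr01 d2; rewrite !expr1n !divr1 in h.
  have h2 := gc_le Hlip 0 ltr01; rewrite divr1 in h2.
  have dd : dl ^+ 2 <= dl by rewrite expr2 ler_piMr// ltW.
  have h3 : Num.min (dl ^+ 2) ((dl ^+ 2) ^+ 2) <= dl by rewrite ge_min dd.
  have h4 := ler_wpM2l K20 h3.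
  have h5 : `|gc H 1 0 * dl ^+ 2 / 2| <= K1 R * dl.
    rewrite -mulrA normrM (ger0_norm (_ : 0 <= dl ^+ 2 / 2)) ?divr_ge0//.
    apply: (@le_trans _ _ (2 * K1 R * (dl ^+ 2 / 2))).
      by rewrite ler_wpM2r// divr_ge0.
    have := ler_wpM2l K10 dd; lra.
  set a := gu H _ 0 in h *; set b := gu H 1 0 in h *.
  have := ler_normD (a - b - gc H 1 0 * dl ^+ 2 / 2) (gc H 1 0 * dl ^+ 2 / 2).
  rewrite subrK => /le_trans; apply; apply: le_trans (lerD h h5) _.
  by move: h4 K1dl; clear; lra.
have s0 : 0 < Num.sqrt (1 + dl ^+ 2) by rewrite sqrtr_gt0; lra.
have h1 := gu_sub Hlip 0 s0; have h2 := gu_sub Hlip 0 ltr01.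
have h3 : Num.sqrt (1 + dl ^+ 2) <= 2 * dl.
  have : Num.sqrt (dl ^+ 2 + 1) <= dl + dl^-1 * 1 by exact: sqrtr_sqrD_le.
  rewrite mulr1 [dl ^+ 2 + 1]addrC.
  have : dl^-1 <= 1 by rewrite invf_le1// ltW.
  lra.
have h4 := ler_wpM2l K10 h3.
have h5 : K1 R <= K1 R * dl by rewrite ler_peMr// ltW.
set a := gu H _ 0 in h1 *; set b := gu H 1 0 in h2 *.
have := ler_normB (a - H 0) (b - H 0).
have -> : a - H 0 - (b - H 0) = a - b by ring.
move=> /le_trans; apply; apply: le_trans (lerD h1 h2) _.
by move: h4 h5 K1dl K2dl; clear; lra.
Qed.

(** * The bound for a normalized martingale difference sequence *)

Section assemble.
Context d (T : measurableType d) (R : realType) (P : probability T R).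
Variables (F : nat -> set (set T)) (y v : nat -> T -> R).
Hypothesis Hm : mdiff P F y v.
Local Notation intg f := (P.-integrable setT (EFin \o f)).
Local Notation mF k f := (@measurable_fun _ _ (g_sigma_algebraType (F k)) R setT f).
Variable dl : R.
Hypothesis dl0 : 0 < dl.
Variable n : nat.
Variable eta : R.
Hypothesis eta01 : 0 < eta <= 1.
Variable g : R -> R.
Hypothesis g0 : forall x, 0 <= g x.
Hypothesis g00 : g 0 = 0.
Hypothesis mg : measurable_fun setT g.
Hypothesis ig : forall k, intg (fun w => g (y k w)).
Hypothesis gP : forall x s, `|x| <= dl -> dl <= s -> s ^+ 2 <= 1 + dl ^+ 2 ->
  `|x| ^+ 3 / s ^+ 2 <=
  2 * dl * ((x / dl) ^+ 2 * (wt eta (s ^+ 2 / dl ^+ 2) / (s ^+ 2 / dl ^+ 2))) + g x.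
Hypothesis tailP : \sum_(k < n) \int[P]_w tail2 dl (y k w) <= dl ^+ 2.
Hypothesis gsumP : \sum_(k < n) \int[P]_w g (y k w) <= dl.
Variable H : R -> R.
Hypothesis Hlip : forall x y, `|H x - H y| <= `|x - y|.

(** Triangle inequality through the stopped sum, its smoothing at the final bandwidth, the smoothing
    at the initial bandwidth, and the one at bandwidth 1. *)
Lemma mdiff_clt :
  `|\int[P]_w H (psum y n w) - gu H 1 0| <=
  K3 R * (dl / eta + \int[P]_w Num.sqrt `|psum v n w - 1|).
Proof.
have /andP[e0 e1] := eta01.
have mH := lip_measurable Hlip.
pose J k w : R := if psum v k.+1 w <= 1 then 1 else 0.
have mJ k : mF k (J k).
  by apply: measurable_fun_ifT => //; apply: measurable_fun_ler => //; exact: md_sum_v Hm k.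
have J01 k w : J k w = 0 \/ J k w = 1 by rewrite /J; case: ifP; [right|left].
have J01' k w : 1 - J k w = 0 \/ 1 - J k w = 1.
  by case: (J01 k w) => ->; rewrite ?subr0 ?subrr; [right|left].
have mJ' k : mF k (fun w => 1 - J k w) by exact: measurable_funB.
have H1 := md_stop Hm mJ J01.
have H2 := md_stop Hm mJ' J01'.
set y1 := (fun k w => J k w * y k w) in H1.
set v1 := (fun k w => J k w * v k w) in H1.
set y2 := (fun k w => _) in H2; set v2 := (fun k w => (1 - J k w) * v k w) in H2.
have v0 w k : 0 <= v k w := md_v0 Hm k w.
have A1 m w : psum v1 m w <= 1 := stopped_le1 (v0 w) m.
pose D w := Num.sqrt `|psum v n w - 1|.
pose Q w := \sum_(k < n) Num.max (v k w - dl ^+ 2) 0.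
have Q0 w : 0 <= Q w by apply: sumr_ge0 => k _; rewrite le_max lexx orbT.
have dl20 : 0 <= dl ^+ 2 by exact: sqr_ge0.
have iA := @integrable_sum_real _ _ _ P n v (md_iv Hm).
have iD : intg D.
  apply: (@integrable_le _ _ _ _ _ (fun w => 2 + psum v n w)).
  - apply: measurable_fun_sqrtr; apply: measurableT_comp => //.
    by apply: measurable_funB => //; exact: integrable_measurable iA.
  - by apply: integrableD_real => //; exact: integrable_cst_real.
  - move=> w; rewrite /D ger0_norm ?sqrtr_ge0//.
    have A0 := psum_ge0 Hm n w.
    have h : `|psum v n w - 1| <= psum v n w + 1.
      by apply: le_trans (ler_normB _ _) _; rewrite normr1 ger0_norm.
    have := sqr_sqrtr (normr_ge0 (psum v n w - 1)).
    have := sqr_ge0 (Num.sqrt `|psum v n w - 1| - 1); nra.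
have ipos k : intg (fun w => Num.max (v k w - dl ^+ 2) 0).
  apply: (@integrable_le _ _ _ _ _ (v k)).
  - apply: measurable_maxr => //; apply: measurable_funB => //.
    exact: integrable_measurable (md_iv Hm k).
  - exact: md_iv Hm k.
  - move=> w; have vk := v0 w k.
    rewrite ger0_norm ?le_max ?lexx ?orbT// ge_max; apply/andP; split; lra.
have iQ : intg Q := @integrable_sum_real _ _ _ P n (fun k w => Num.max (v k w - dl ^+ 2) 0) ipos.
have EQ : \int[P]_w Q w <= dl ^+ 2.
  rewrite (@Rintegral_sum _ _ _ P n (fun k w => Num.max (v k w - dl ^+ 2) 0) ipos).
  apply: le_trans tailP; apply: ler_sum => k _.
  exact: (pos_var_le Hm).
pose U w := D w + (dl + dl^-1 * Q w).
have idQ := integrableZ_real dl^-1 iQ.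
have idQ2 := integrableD_real (integrable_cst_real P dl) idQ.
have iU : intg U by exact: integrableD_real iD idQ2.
have EU : \int[P]_w U w <= \int[P]_w D w + 2 * dl.
  rewrite (RintegralD measurableT iD idQ2).
  rewrite (RintegralD measurableT (integrable_cst_real P dl) idQ).
  rewrite Rintegral_cst_prob (RintegralZl _ measurableT iQ) lerD2l mulrDl mul1r lerD2l.
  by rewrite mulrC ler_pdivrMr// -expr2.
have sqrtU x w : x <= `|psum v n w - 1| + (dl ^+ 2 + Q w) -> Num.sqrt x <= U w.
  move=> xle; apply: le_trans (ler_wsqrtr xle) _.
  have h := sqrtrD_le (normr_ge0 (psum v n w - 1)) (addr_ge0 dl20 (Q0 w)).
  by apply: le_trans h _; rewrite lerD2l; exact: sqrtr_sqrD_le.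
have left w : Num.sqrt (1 - psum v1 n w) <= U w.
  by apply: sqrtU; exact: (stopped_left (v0 w) dl20 n).
have right w : Num.sqrt (psum v2 n w) <= U w.
  apply: sqrtU; have -> : psum v2 n w = psum v n w - psum v1 n w.
    by rewrite /psum -sumrB; apply: eq_bigr => k _; rewrite /v1 /v2; ring.
  exact: (stopped_right (v0 w) dl20 n).
have iS := @integrable_sum_real _ _ _ P n y (md_iy Hm).
have iS1 := @integrable_sum_real _ _ _ P n y1 (md_iy H1).
have iS2 := @integrable_sum_real _ _ _ P n y2 (md_iy H2).
have iv2 := @integrable_sum_real _ _ _ P n v2 (md_iv H2).
have iH f : intg f -> intg (fun w => H (f w)).
  move=> iF; apply: (@integrable_le _ _ _ _ _ (fun w => `|H 0| + `|f w|)).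
  - by apply: (measurableT_comp mH); exact: integrable_measurable iF.
  - by apply: integrableD_real; [exact: integrable_cst_real|exact: (integrable_norm iF)].
  - move=> w; have := Hlip (f w) 0; rewrite subr0.
    have := ler_normD (H (f w) - H 0) (H 0); rewrite subrK; lra.
have iHS := iH _ iS; have iHS1 := iH _ iS1.
have igu := gu_bw_int H1 Hlip dl0 A1 n.
(* removing the increments after the stopping time *)
have p1 : `|\int[P]_w H (psum y n w) - \int[P]_w H (psum y1 n w)| <= 2 * \int[P]_w U w.
  rewrite -RintegralB//; have iB := integrableB_real iHS iHS1.
  apply: le_trans (le_normr_Rintegral measurableT iB) _.
  apply: (@le_trans _ _ (\int[P]_w `|psum y2 n w|)).
    apply: le_RintegralT; [exact: (integrable_norm iB)|exact: (integrable_norm iS2)|].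
    move=> w; apply: le_trans (Hlip _ _) _.
    rewrite /psum -sumrB (eq_bigr (fun k : 'I_n => y2 k w))// => k _.
    by rewrite /y1 /y2; ring.
  apply: le_trans (abs_le_bracket H2 n) _.
  rewrite ler_pM2l//; apply: le_RintegralT => //.
  apply: (@integrable_le _ _ _ _ _ U) => //.
    by apply: measurable_fun_sqrtr; exact: integrable_measurable iv2.
  by move=> w; rewrite ger0_norm ?sqrtr_ge0// right.
(* removing the smoothing at the end *)
have K10 : 0 <= K1 R by rewrite /K1 sqr_ge0.
have p2 : `|\int[P]_w H (psum y1 n w) - \int[P]_w gu H (bw v1 dl n w) (psum y1 n w)|
    <= 2 * K1 R * (dl + \int[P]_w U w).
  rewrite -RintegralB//; have iB := integrableB_real iHS1 igu.
  have iU2 := integrableD_real (integrable_cst_real P dl) iU.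
  apply: le_trans (le_normr_Rintegral measurableT iB) _.
  rewrite -[X in _ * (X + _)](Rintegral_cst_prob P dl).
  rewrite -(RintegralD measurableT (integrable_cst_real P dl) iU).
  rewrite -(RintegralZl _ measurableT iU2).
  apply: le_RintegralT; [exact: (integrable_norm iB)|exact: integrableZ_real|].
  move=> w; rewrite distrC; apply: le_trans (gu_sub Hlip _ (bw_gt0 dl0 A1 n w)) _.
  rewrite ler_wpM2l ?mulr_ge0// /bw addrAC addrC.
  have A1' : 0 <= 1 - psum v1 n w by rewrite subr_ge0.
  apply: le_trans (sqrtrD_le dl20 A1') _.
  by rewrite sqrtr_sqr gtr0_norm// lerD2l.
have tail1 : \sum_(k < n) \int[P]_w tail2 dl (y1 k w) <= dl ^+ 2.
  apply: le_trans tailP; apply: ler_sum => k _; apply: le_RintegralT.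
  - exact: (tail2_int H1 dl).
  - exact: (tail2_int Hm dl).
  - move=> w; rewrite /y1; case: (J01 k w) => ->; rewrite ?mul1r// mul0r.
    rewrite {1}/tail2 normr0 ltNge (ltW dl0)/=; exact: tail2_ge0.
have gy1 k w : g (y1 k w) <= g (y k w).
  by rewrite /y1; case: (J01 k w) => ->; rewrite ?mul1r// mul0r g00.
have ig1 k : intg (fun w => g (y1 k w)).
  apply: (@integrable_le _ _ _ _ _ (fun w => g (y k w))) => //.
    by apply: (measurableT_comp mg); exact: integrable_measurable (md_iy H1 k).
  by move=> w; rewrite ger0_norm.
have gsum1 : \sum_(k < n) \int[P]_w g (y1 k w) <= dl.
  apply: le_trans gsumP; apply: ler_sum => k _; exact: le_RintegralT.
have p3 := lindeberg_sum H1 Hlip dl0 A1 n.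
have p4 := mm_sum_bound H1 dl0 A1 eta01 g0 ig1 gP tail1 gsum1.
have p5 := gu_bandwidth Hlip dl0.
have [K2a _ _] := K2_ge R.
have K20 : 0 <= K2 R by apply: le_trans K2a; rewrite mulr_ge0 ?expR_ge0.
have p6 : 3 * K2 R * \sum_(k < n) \int[P]_w mm (y1 k w) (bw v1 dl k.+1 w) <= 3 * K2 R * (8 * dl / eta).
  by rewrite ler_wpM2l// mulr_ge0.
move: p1 p2 (le_trans p3 p6) p5 EU.
set E0 := \int[P]_w H _; set E1 := \int[P]_w H _.
set E2 := \int[P]_w gu H _ _; set E3 := gu H (Num.sqrt _) 0; set E4 := gu H 1 0.
set u := \int[P]_w U w; set dd := \int[P]_w D w.
have dd0 : 0 <= dd by apply: Rintegral_ge0 => w _; exact: sqrtr_ge0.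
rewrite -/dd; have h4 : dl <= dl / eta by rewrite ler_peMr ?(ltW dl0)// invf_ge1.
have -> : 8 * dl / eta = 8 * (dl / eta) by rewrite mulrA.
set z := dl / eta in h4 *.
clearbody E0 E1 E2 E3 E4 u dd z.
rewrite /K3; move: (K1 R) (K2 R) K10 K20 dl0 dd0 h4; clear.
move=> a b a0 b0 dl0 dd0 h4 p1 p2 p3 p5 EU.
have t1 := ler_distD E1 E0 E4; have t2 := ler_distD E2 E1 E4.
have t3 := ler_distD E3 E2 E4.
have au := ler_wpM2l a0 EU; have az := ler_wpM2l a0 h4; have bz := ler_wpM2l b0 h4.
have z0 : 0 <= z by exact: le_trans (ltW dl0) h4.
have := mulr_ge0 b0 dd0; have := mulr_ge0 a0 dd0; have := mulr_ge0 a0 z0; lra.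
Qed.

End assemble.

(** * From conditional expectations to [mdiff] *)

Lemma sigma_measurable_fun d (T : measurableType d) (R : realType)
    (G : set (set T)) (Z : T -> R) :
  sigma_measurable G Z -> @measurable_fun _ _ (g_sigma_algebraType G) R setT Z.
Proof. by move=> GZ _ A mA; apply: sub_sigma_algebra; apply: GZ; exists A. Qed.

(** The event [Z < 0] belongs to [G], and over it [Z] and the nonnegative [X] have the same
    integral, which must vanish; so the positive part is again a version. *)
Lemma is_condexp_pos d (T : measurableType d) (R : realType) (P : probability T R)
    (G : set (set T)) (X Z : T -> R) :
  sigma_algebra setT G -> G `<=` measurable -> (forall w, 0 <= X w) ->
  is_condexp P G X Z ->
  (forall A, G A -> \int[P]_(w in A) Num.max (Z w) 0 = \int[P]_(w in A) X w) /\
  {ae P, forall w, Z w = Num.max (Z w) 0}.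
Proof.
move=> sG Gm X0 [iX iZ mZ eXZ].
have mZG := sigma_measurable_fun mZ.
have mZT := measurable_fun_sub Gm mZG.
pose N := Z @^-1` `]-oo, 0[%classic.
have GN : G N by apply: mZ; exists (`]-oo, 0[%classic) => //; rewrite setTI.
have eR A : G A -> \int[P]_(w in A) Z w = \int[P]_(w in A) X w.
  by move=> GA; rewrite /Rintegral eXZ.
have TG : <<s G >> = G by exact: sigma_algebra_id.
have GI A B : G A -> G B -> G (A `&` B).
  rewrite -TG => GA GB; exact: (@measurableI _ (g_sigma_algebraType G)).
have GD A B : G A -> G B -> G (A `\` B).
  rewrite -TG => GA GB; exact: (@measurableD _ (g_sigma_algebraType G)).
have iS A f : G A -> P.-integrable setT (EFin \o f) -> P.-integrable A (EFin \o f).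
  by move=> GA; apply: integrableS => //; exact: Gm.
have XN0 A : G A -> \int[P]_(w in A `&` N) X w = 0.
  move=> GA; apply/eqP; rewrite eq_le; apply/andP; split; last first.
    by apply: Rintegral_ge0.
  rewrite -eR; last exact: GI.
  rewrite -oppr_ge0 -mulN1r -RintegralZl; last 2 first.
  - by apply: Gm; exact: GI.
  - by apply: iS => //; exact: GI.
  apply: Rintegral_ge0 => w [_]; rewrite /N/= in_itv/= => Zw; lra.
have imax : P.-integrable setT (EFin \o (fun w => Num.max (Z w) 0)).
  apply: (@integrable_le _ _ _ _ _ (fun w => `|Z w|)).
  - exact: measurable_maxr.
  - exact: (integrable_norm iZ).
  - move=> w; rewrite ger0_norm ?le_max ?lexx ?orbT// ge_max normr_ge0 andbT.
    exact: ler_norm.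
have main A : G A -> \int[P]_(w in A) Num.max (Z w) 0 = \int[P]_(w in A) X w.
  move=> GA.
  have mA := Gm _ GA; have mN := Gm _ GN.
  have spl f : P.-integrable setT (EFin \o f) ->
      \int[P]_(w in A) f w = \int[P]_(w in A `&` N) f w + \int[P]_(w in A `\` N) f w.
    move=> iF; rewrite -Rintegral_setU; first by rewrite setUIDK.
    - by apply: Gm; exact: GI.
    - by apply: Gm; exact: GD.
    - by rewrite setUIDK; apply: iS.
    - apply/disj_setPS => w [[_ Nw] [_ nNw]]; exact: nNw.
  rewrite (spl _ iX) (spl _ imax) XN0// -eR; last exact: GD.
  rewrite [X in X + _ = _](_ : _ = 0); last first.
    rewrite /Rintegral integral0_eq// => w [_]; rewrite /N/= in_itv/= => Zw.
    by congr (_%:E); apply/max_idPr; exact: ltW.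
  congr (0 + _); apply: eq_Rintegral => w; rewrite inE => -[_].
  rewrite /N/= in_itv/= => /negP; rewrite -leNgt => Zw.
  exact/max_idPl.
split=> //.
have GT : G setT by rewrite -TG; exact: (@measurableT _ (g_sigma_algebraType G)).
have e : (\int[P]_w `|(Num.max (Z w) 0 - Z w)%:E| = 0)%E.
  have h : \int[P]_w (Num.max (Z w) 0 - Z w) = 0.
    by rewrite RintegralB// main// eR// subrr.
  have i : P.-integrable setT (EFin \o (fun w => Num.max (Z w) 0 - Z w)).
    exact: integrableB_real.
  transitivity (\int[P]_w (Num.max (Z w) 0 - Z w)%:E)%E.
    apply: eq_integral => w _; rewrite gee0_abs// lee_fin subr_ge0.
    by rewrite le_max lexx.
  rewrite -[LHS]fineK; first by rewrite -/(Rintegral P setT (fun w => Num.max (Z w) 0 - Z w)) h.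
  exact: integrable_fin_num.
have mD : measurable_fun setT (fun w => (Num.max (Z w) 0 - Z w)%:E : \bar R).
  by apply/measurable_EFinP; apply: measurable_funB => //; exact: measurable_maxr.
have := (@ae_eq_integral_abs _ _ _ P setT measurableT _ mD).1 e.
apply: filterS => w /(_ I) /= [] /eqP; rewrite subr_eq0 => /eqP ->; reflexivity.
Qed.

Section martingale_setup.
Context (n : nat) (d : measure_display) (T : measurableType d) (R : realType)
    (P : probability T R) (F : nat -> set (set T))
    (Y : nat -> {RV P >-> R}) (sigma2 : nat -> T -> R).
Hypothesis n1 : (1 <= n)%N.
Hypothesis filtF : filtration n F.
Hypothesis mdY : martingale_difference n F Y.
Hypothesis cvY : conditional_variances n F Y sigma2.
Local Notation s := (s_ n Y).
Hypothesis s0 : 0 < s.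
Local Notation intg f := (P.-integrable setT (EFin \o f)).

(** Freezing at [n] gives a filtration increasing at all times, [F] being constrained only up to
    [n]. *)
Definition trunc_filt k := F (minn k n).
(* The increments are reindexed from 0 and extended by 0 after time [n]; a
   version of the conditional variance may be negative on a null set. *)
Definition ndiff k w : R := if (k < n)%N then Y k.+1 w / s else 0.
Definition nvar k w : R := if (k < n)%N then Num.max (sigma2 k.+1 w) 0 / s ^+ 2 else 0.

Lemma Y_int m : (1 <= m <= n)%N -> intg (Y m).
Proof. by move=> mn; have [_ [? _ _ _]] := mdY mn. Qed.

Lemma Y2_int m : (1 <= m <= n)%N -> intg (fun w => Y m w ^+ 2).
Proof. by move=> mn; have [? _ _ _] := cvY mn. Qed.

Lemma normalized_mdiff : mdiff P trunc_filt ndiff nvar.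
Proof.
have [Fs Fi] := filtF.
have sn := lt0r_neq0 s0.
have tf k : (k < n)%N -> trunc_filt k = F k /\ trunc_filt k.+1 = F k.+1.
  move=> kn; rewrite /trunc_filt; split; congr F; apply/minn_idPl => //; exact: ltnW.
have Fsub k : trunc_filt k `<=` measurable by apply: (Fs _ _).2; exact: geq_minr.
have Fsig k : sigma_algebra setT (trunc_filt k) by apply: (Fs _ _).1; exact: geq_minr.
have Fid k : <<s trunc_filt k >> = trunc_filt k by exact: sigma_algebra_id.
have kn1 k : (k < n)%N -> (1 <= k.+1 <= n)%N by [].
have iv k : (k < n)%N -> intg (fun w => Num.max (sigma2 k.+1 w) 0).
  move=> kn; have [_ is2 ms2 _] := cvY (kn1 _ kn).
  apply: (@integrable_le _ _ _ _ _ (fun w => `|sigma2 k.+1 w|)).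
  - by apply: measurable_maxr => //; exact: integrable_measurable is2.
  - exact: (integrable_norm is2).
  - move=> w; rewrite ger0_norm ?le_max ?lexx ?orbT// ge_max normr_ge0 andbT.
    exact: ler_norm.
split.
- exact: Fsub.
- move=> k; rewrite /trunc_filt; case: (ltnP k n) => kn.
    have -> : minn k.+1 n = k.+1 by apply/minn_idPl.
    exact: Fi.
  by have -> : minn k.+1 n = n by apply/minn_idPr; exact: leqW.
- move=> k; rewrite /ndiff; case: (ltnP k n) => kn; last exact: measurable_cst.
  apply: measurable_funM => //; rewrite (tf k kn).2.
  by apply: sigma_measurable_fun; exact: (mdY (kn1 _ kn)).1.
- move=> k; rewrite /nvar; case: (ltnP k n) => kn; last exact: measurable_cst.
  apply: measurable_funM => //; rewrite (tf k kn).1.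
  apply: measurable_maxr => //.
  by apply: sigma_measurable_fun; have [_ _ ? _] := cvY (kn1 _ kn).
- move=> k w; rewrite /nvar; case: ifP => // _.
  by rewrite divr_ge0 ?sqr_ge0// le_max lexx orbT.
- move=> k; rewrite /ndiff; case: (ltnP k n) => kn; last first.
    rewrite (_ : (fun w => _) = fun=> 0); first exact: integrable_cst_real.
    by apply/funext => w; rewrite expr0n.
  rewrite (_ : (fun w => _) = fun w => s^-1 ^+ 2 * Y k.+1 w ^+ 2).
    by apply: integrableZ_real; exact: Y2_int.
  by apply/funext => w; rewrite exprMn mulrC.
- move=> k; rewrite /nvar; case: (ltnP k n) => kn; last exact: integrable_cst_real.
  rewrite (_ : (fun w => _) = fun w => (s ^+ 2)^-1 * Num.max (sigma2 k.+1 w) 0).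
    by apply: integrableZ_real; exact: iv.
  by apply/funext => w; rewrite mulrC.
- move=> k g M mg gM; rewrite /ndiff; case: (ltnP k n) => kn; last first.
    by under eq_Rintegral do rewrite mul0r; rewrite Rintegral_cst_prob.
  apply: (@Rintegral_mul_eq0 _ _ _ P _ (Fsub k) _ _ M) => //.
    under [X in EFin \o X]funext do rewrite mulrC.
    by apply: integrableZ_real; exact: Y_int.
  move=> A; rewrite Fid => FA; rewrite RintegralZr.
  - have [_ [_ _ _ e]] := mdY (kn1 _ kn).
    have FA' : F k A by rewrite -(tf k kn).1.
    by rewrite /Rintegral -(e A FA') integral0_eq// mul0r.
  - exact: Fsub FA.
  - by apply: integrableS (Y_int (kn1 _ kn)) => //; exact: Fsub FA.
- move=> k g M mg gM; rewrite /ndiff /nvar; case: (ltnP k n) => kn; last first.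
    by apply: eq_Rintegral => w _; rewrite expr0n.
  have iY := Y2_int (kn1 _ kn); have im := iv _ kn.
  have iB := integrableB_real iY im.
  have mgT := measurable_fun_sub (Fsub k) mg.
  have h : \int[P]_w ((Y k.+1 w ^+ 2 - Num.max (sigma2 k.+1 w) 0) * g w) = 0.
    apply: (@Rintegral_mul_eq0 _ _ _ P _ (Fsub k) _ _ M) => // A; rewrite Fid => FA.
    have mA := Fsub k _ FA.
    rewrite RintegralB//.
    - have e := is_condexp_pos (Fsig k) (Fsub k) (fun w => sqr_ge0 (Y k.+1 w)) (_ : is_condexp P (trunc_filt k) _ (sigma2 k.+1)).
      rewrite (e _).1 ?subrr//; rewrite (tf k kn).1; exact: cvY (kn1 _ kn).
    - by apply: integrableS iY.
    - by apply: integrableS im.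
  have i1 := integrable_mul_bounded iY mgT gM; have i2 := integrable_mul_bounded im mgT gM.
  have h2 : \int[P]_w (Y k.+1 w ^+ 2 * g w) = \int[P]_w (Num.max (sigma2 k.+1 w) 0 * g w).
    apply/eqP; rewrite -subr_eq0 -RintegralB//; apply/eqP; apply: etrans h.
    by apply: eq_Rintegral => w _; rewrite mulrBl.
  transitivity ((s ^+ 2)^-1 * \int[P]_w (Y k.+1 w ^+ 2 * g w)).
    rewrite -RintegralZl//; apply: eq_Rintegral => w _; rewrite exprMn exprVn; ring.
  rewrite h2 -RintegralZl//; apply: eq_Rintegral => w _; ring.
Qed.

End martingale_setup.

(** * Wasserstein bounds in terms of a threshold *)

Section W1_bound.
Context (n : nat) (d : measure_display) (T : measurableType d) (R : realType)
    (P : probability T R) (F : nat -> set (set T))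
    (Y : nat -> {RV P >-> R}) (sigma2 : nat -> T -> R).
Hypothesis n1 : (1 <= n)%N.
Hypothesis filtF : filtration n F.
Hypothesis mdY : martingale_difference n F Y.
Hypothesis cvY : conditional_variances n F Y sigma2.
Local Notation s := (s_ n Y).
Hypothesis s0 : 0 < s.
Local Notation intg f := (P.-integrable setT (EFin \o f)).
Local Notation y := (ndiff n Y).
Local Notation v := (nvar n Y sigma2).

Let Hm : mdiff P (trunc_filt n F) y v.
Proof. exact: normalized_mdiff. Qed.

Lemma X_psum w : X_ n Y w = psum y n w.
Proof.
rewrite /X_ /psum; transitivity (s^-1 * \sum_(1 <= i < n.+1) Y i w).
  change (s^-1 * (\sum_(1 <= i < n.+1) (Y i : {mfun T >-> R}) : {mfun T >-> R}) w =
    s^-1 * \sum_(1 <= i < n.+1) Y i w); congr (_ * _).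
  elim/big_ind2: _ => //; first by move=> f1 x1 f2 x2 <- <-.
rewrite big_add1/= big_mkord mulr_sumr; apply: eq_bigr => k _.
by rewrite /ndiff ltn_ord mulrC.
Qed.

Lemma X_int : intg (X_ n Y).
Proof.
rewrite (_ : (X_ n Y : T -> R) = psum y n); last by apply/funext => w; exact: X_psum.
by apply: integrable_sum_real => k; exact: md_iy Hm k.
Qed.

Lemma psum_v_ae : {ae P, forall w, psum v n w = V2_ n Y sigma2 w}.
Proof.
have h k : {ae P, forall w, (k < n)%N -> sigma2 k.+1 w = Num.max (sigma2 k.+1 w) 0}.
  case: (ltnP k n) => kn; last by apply: nearW.
  have [Fs Fi] := filtF.
  have [|//|//|_] := is_condexp_pos (_ : sigma_algebra setT (F k)) _
    (fun w => sqr_ge0 (Y k.+1 w)) (cvY (_ : (1 <= k.+1 <= n)%N)).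
  - by apply: (Fs _ _).1; exact: ltnW.
  - by apply: (Fs _ _).2; exact: ltnW.
  - by apply: filterS => w e _.
have : {ae P, forall w, forall k, (k < n)%N -> sigma2 k.+1 w = Num.max (sigma2 k.+1 w) 0}.
  by apply/ae_foralln.
apply: filterS => w e; rewrite /psum /V2_ big_add1/= big_mkord mulr_sumr.
by apply: eq_bigr => k _; rewrite /nvar ltn_ord -e// mulrC.
Qed.

Lemma V2_termE : (\int[P]_w Num.sqrt `|psum v n w - 1|)%:E = V2_term n Y sigma2.
Proof.
have iv : intg (psum v n) by apply: integrable_sum_real => k; exact: md_iv Hm k.
have mv := integrable_measurable iv.
have mD : measurable_fun setT (fun w => Num.sqrt `|psum v n w - 1|).
  apply: measurable_fun_sqrtr; apply: measurableT_comp => //.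
  exact: measurable_funB.
have iD : intg (fun w => Num.sqrt `|psum v n w - 1|).
  apply: (@integrable_le _ _ _ _ _ (fun w => 2 + psum v n w)) => //.
  - by apply: integrableD_real => //; exact: integrable_cst_real.
  - move=> w; rewrite ger0_norm ?sqrtr_ge0//.
    have A0 := psum_ge0 Hm n w.
    have h : `|psum v n w - 1| <= psum v n w + 1.
      by apply: le_trans (ler_normB _ _) _; rewrite normr1 ger0_norm.
    have := sqr_sqrtr (normr_ge0 (psum v n w - 1)).
    have := sqr_ge0 (Num.sqrt `|psum v n w - 1| - 1); nra.
rewrite /V2_term powR_Lnorm ?invr_neq0// /Rintegral fineK; last exact: integrable_fin_num.
have mV : measurable_fun setT (V2_ n Y sigma2).
  apply: measurable_funM => //.
  rewrite (_ : (fun w => _) = fun w => \sum_(k < n) sigma2 k.+1 w); last first.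
    by apply/funext => w; rewrite big_add1/= big_mkord.
  apply: measurable_sum => k; have [_ is2 _ _] := cvY (ltn_ord k : (1 <= k.+1 <= n)%N).
  exact: integrable_measurable is2.
have e w : (`|(V2_ n Y sigma2 w - 1)%:E| `^ 2^-1 = (Num.sqrt `|V2_ n Y sigma2 w - 1|)%:E)%E.
  by rewrite -powR12_sqrt// poweR_EFin.
apply: ge0_ae_eq_integral => //.
- by apply/measurable_EFinP.
- rewrite (_ : (fun w => _) = fun w => (Num.sqrt `|V2_ n Y sigma2 w - 1|)%:E); last exact/funext.
  apply/measurable_EFinP; apply: measurable_fun_sqrtr; apply: measurableT_comp => //.
  exact: measurable_funB.
- by move=> w _ /=; rewrite lee_fin powR_ge0.
- by move: psum_v_ae; apply: filterS => w ew _ /=; rewrite ew -powR12_sqrt.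
Qed.

Section kernel_bound.
Variable dl : R.
Hypothesis dl0 : 0 < dl.
Variable eta : R.
Hypothesis eta01 : 0 < eta <= 1.
Variable g : R -> R.
Hypothesis g0 : forall x, 0 <= g x.
Hypothesis g00 : g 0 = 0.
Hypothesis mg : measurable_fun setT g.
Hypothesis ig : forall k, intg (fun w => g (y k w)).
Hypothesis gP : forall x t, `|x| <= dl -> dl <= t -> t ^+ 2 <= 1 + dl ^+ 2 ->
  `|x| ^+ 3 / t ^+ 2 <=
  2 * dl * ((x / dl) ^+ 2 * (wt eta (t ^+ 2 / dl ^+ 2) / (t ^+ 2 / dl ^+ 2))) + g x.
Hypothesis tailP : \sum_(k < n) \int[P]_w tail2 dl (y k w) <= dl ^+ 2.
Hypothesis gsumP : \sum_(k < n) \int[P]_w g (y k w) <= dl.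

Lemma W1_bound :
  (W1_normal n Y <= (K3 R)%:E * ((dl / eta)%:E + V2_term n Y sigma2))%E.
Proof.
have [h [hl hw]] := wasserstein1_normal X_int.
apply: le_trans hw _; rewrite -V2_termE -EFinD -EFinM lee_fin.
apply: le_trans (mdiff_clt Hm dl0 eta01 g0 g00 mg ig gP tailP gsumP hl).
have -> : \int[P]_w h (X_ n Y w) = \int[P]_w h (psum y n w).
  by apply: eq_Rintegral => w _; rewrite X_psum.
exact: ler_norm.
Qed.

End kernel_bound.

Lemma sum_y2 : \sum_(k < n) \int[P]_w (y k w ^+ 2) = 1.
Proof.
have sn := lt0r_neq0 s0.
have iY k : (k < n)%N -> intg (fun w => Y k.+1 w ^+ 2).
  by move=> kn; have [? _ _ _] := cvY (kn : (1 <= k.+1 <= n)%N).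
have e k : (k < n)%N -> \int[P]_w (y k w ^+ 2) = (s ^+ 2)^-1 * fine 'E_P[(fun w => Y k.+1 w ^+ 2)].
  move=> kn; rewrite /ndiff kn unlock -[X in _ * X]/(\int[P]_w (Y k.+1 w ^+ 2)).
  rewrite -RintegralZl//; last exact: iY.
  by apply: eq_Rintegral => w _; rewrite exprMn exprVn mulrC.
rewrite (eq_bigr _ (fun (k : 'I_n) _ => e k (ltn_ord k))) -mulr_sumr.
have S0 : 0 <= \sum_(k < n) fine 'E_P[(fun w => Y k.+1 w ^+ 2)].
  by apply: sumr_ge0 => k _; apply: fine_ge0; apply: expectation_ge0 => w; exact: sqr_ge0.
have -> : s ^+ 2 = \sum_(k < n) fine 'E_P[(fun w => Y k.+1 w ^+ 2)].
  by rewrite /s_ big_add1/= big_mkord sqr_sqrtr.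
rewrite mulVf// gt_eqF// lt_neqAle S0 andbT eq_sym.
apply: contraTneq s0 => e0.
by rewrite /s_ big_add1/= big_mkord e0 sqrtr0 ltxx.
Qed.

(** [y^2 <= dl^2 + tail2 dl y], and the variances add up to 1. This prevents the threshold, hence a
    Lyapunov coefficient, from vanishing. *)
Lemma tail_lower_bound dl :
  \sum_(k < n) \int[P]_w tail2 dl (y k w) <= dl ^+ 2 -> 1 <= n.+1%:R * dl ^+ 2.
Proof.
move=> h; rewrite -[leLHS]sum_y2.
apply: (@le_trans _ _ (\sum_(k < n) (dl ^+ 2 + \int[P]_w tail2 dl (y k w)))).
  apply: ler_sum => k _; have ic := integrable_cst_real P (dl ^+ 2).
  rewrite -[X in X + _](Rintegral_cst_prob P) -(RintegralD measurableT ic (tail2_int Hm dl k)).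
  apply: le_RintegralT; first exact: md_iy2 Hm k.
    by apply: integrableD_real ic (tail2_int Hm dl k).
  move=> w; rewrite /tail2; case: ltP => yd; first by rewrite lerDr sqr_ge0.
  rewrite addr0 -real_normK ?num_real//; apply: lerXn2r => //; rewrite nnegrE//.
  exact: le_trans (normr_ge0 _) yd.
have -> : n.+1%:R * dl ^+ 2 = n%:R * dl ^+ 2 + dl ^+ 2 by rewrite -natr1; ring.
by rewrite big_split/= sumr_const card_ord -[X in X + _ <= _]mulr_natl lerD2l.
Qed.

(* With no control of the p-th moments, [x ^ eta] stays bounded on the relevant
   range [1 <= x <= e + dl ^- 2] when [eta = 1 / (2 ln (e + dl ^- 2))]. *)
Lemma W1_log dl : 0 < dl -> \sum_(k < n) \int[P]_w tail2 dl (y k w) <= dl ^+ 2 ->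
  (W1_normal n Y <= (K3 R)%:E *
    ((2 * dl * ln (expR 1 + (dl ^+ 2)^-1))%:E + V2_term n Y sigma2))%E.
Proof.
move=> dl0 h; set l := ln _.
have d20 : 0 < dl ^+ 2 by rewrite exprn_gt0.
have di0 : 0 <= (dl ^+ 2)^-1 by rewrite invr_ge0 ltW.
have e0 : 0 < expR 1 + (dl ^+ 2)^-1 by rewrite ltr_pwDl// expR_gt0.
have l1 : 1 <= l by rewrite -[leLHS](expRK 1) ler_ln ?posrE ?expR_gt0// lerDl.
have l0 : 0 < l by lra.
have eta0 : 0 < (2 * l)^-1 by rewrite invr_gt0 mulr_gt0.
have eta1 : (2 * l)^-1 <= 1 by rewrite invf_le1 ?mulr_gt0//; lra.
have eta01 : 0 < (2 * l)^-1 <= 1 by rewrite eta0.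
have -> : 2 * dl * l = dl / (2 * l)^-1 by rewrite invrK mulrA [dl * 2]mulrC.
apply: (@W1_bound dl dl0 _ eta01 (fun=> 0)) => //.
- by move=> k; exact: integrable_cst_real.
- move=> x t xd dt t2; rewrite addr0.
  have t0 : 0 < t by exact: lt_le_trans dt.
  set u := `|x| / dl; set X := t ^+ 2 / dl ^+ 2.
  have u0 : 0 <= u by rewrite divr_ge0// ltW.
  have u1 : u <= 1 by rewrite ler_pdivrMr// mul1r.
  have X0 : 0 < X by rewrite divr_gt0// exprn_gt0.
  have X1 : 1 <= X.
    by rewrite ler_pdivlMr// mul1r; apply: lerXn2r; rewrite ?nnegrE ?(ltW dl0) ?(ltW t0).
  have xE : `|x| = u * dl by rewrite /u divfK// gt_eqF.
  have -> : `|x| ^+ 3 / t ^+ 2 = dl * (u ^+ 2 * (u / X)).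
    by rewrite xE /X; field; rewrite !gt_eqF.
  have -> : (x / dl) ^+ 2 = u ^+ 2.
    by rewrite /u !expr_div_n real_normK ?num_real.
  (* [ln X <= l] gives a weight at least [expR (- 1/2)]; the factor 2 in the hypothesis on [g] is
     there to compensate this loss. *)
  have w1 : 2^-1 <= wt (2 * l)^-1 X.
    have Xl : ln X <= l.
      rewrite ler_ln ?posrE// /X ler_pdivrMr// mulrDl mulVf ?gt_eqF//.
      apply: le_trans t2 _; rewrite addrC lerD2r ler_peMl ?ltW//.
      by have := @expR_ge1Dx R 1; lra.
    apply: (@le_trans _ _ (expR (- 2^-1))).
      by have := @expR_ge1Dx R (- 2^-1); lra.
    rewrite ler_expR mulNr lerN2 -[leRHS]mulr1 invfM -mulrA ler_wpM2l//.
    by rewrite mulrC ler_pdivrMr// mul1r.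
  have : u ^+ 2 * (u / X) <= 2 * (u ^+ 2 * (wt (2 * l)^-1 X / X)).
    rewrite [leRHS]mulrCA ler_wpM2l ?sqr_ge0// mulrA ler_wpM2r ?invr_ge0 ?(ltW X0)//; lra.
  move/(ler_wpM2l (ltW dl0)); lra.
- rewrite big1 ?(ltW dl0)// => k _; exact: Rintegral_cst_prob.
Qed.

(** The power [dl * (|x| / dl)^p], cut off above [dl]. The cut keeps it bounded, hence integrable,
    also when [psi] grows more slowly than the p-th power and p-th moments may be infinite. *)
Definition ppow (p dl x : R) := if `|x| <= dl then `|x| `^ p * dl `^ (1 - p) else 0.

Lemma measurable_ppow p dl : measurable_fun setT (ppow p dl).
Proof.
apply: measurable_fun_ifT => //.
  by apply: measurable_fun_ler => //; exact: measurableT_comp.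
apply: measurable_funM => //.
by apply: (measurableT_comp (measurable_powR p)).
Qed.

Lemma ppow_ge0 p dl x : 0 <= ppow p dl x.
Proof. by rewrite /ppow; case: ifP => // _; rewrite mulr_ge0 ?powR_ge0. Qed.

Lemma ppow_le p dl x : 0 <= p -> 0 < dl -> ppow p dl x <= dl.
Proof.
move=> p0 dl0; rewrite /ppow; case: ifP => xd; last exact: ltW.
apply: (@le_trans _ _ (dl `^ p * dl `^ (1 - p))).
  by rewrite ler_wpM2r ?powR_ge0// ge0_ler_powR ?nnegrE// ltW.
rewrite -powRD; last by apply/implyP => _; rewrite gt_eqF.
by rewrite addrC subrK powRr1// ltW.
Qed.

Lemma W1_power p dl : 2 < p -> 0 < dl ->
  \sum_(k < n) \int[P]_w tail2 dl (y k w) <= dl ^+ 2 ->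
  \sum_(k < n) \int[P]_w ppow p dl (y k w) <= dl ->
  (W1_normal n Y <= (K3 R)%:E * ((p * dl)%:E + V2_term n Y sigma2))%E.
Proof.
move=> p2 dl0 h hp; have p0 : 0 < p by lra.
have eta01 : 0 < p^-1 <= 1 by rewrite invr_gt0 p0/= invf_le1//; lra.
have -> : p * dl = dl / p^-1 by rewrite invrK mulrC.
have ip k : intg (fun w => ppow p dl (y k w)).
  apply: (@integrable_le _ _ _ _ _ (fun=> dl)).
  - apply: (measurableT_comp (measurable_ppow p dl)).
    exact: integrable_measurable (md_iy Hm k).
  - exact: integrable_cst_real.
  - by move=> w; rewrite ger0_norm ?ppow_ge0// ppow_le// ltW.
apply: (@W1_bound dl dl0 _ eta01 (ppow p dl)) => //.
- exact: ppow_ge0.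
- by rewrite /ppow normr0 (ltW dl0) powR0 ?mul0r// gt_eqF.
- exact: measurable_ppow.
move=> x t xd dt t2; rewrite /ppow xd.
have t0 : 0 < t by exact: lt_le_trans dt.
set u := `|x| / dl; set X := t ^+ 2 / dl ^+ 2.
have u0 : 0 <= u by rewrite divr_ge0// ltW.
have u1 : u <= 1 by rewrite ler_pdivrMr// mul1r.
have d20 : 0 < dl ^+ 2 by rewrite exprn_gt0.
have X0 : 0 < X by rewrite divr_gt0// exprn_gt0.
have xE : `|x| = u * dl by rewrite /u divfK// gt_eqF.
have -> : `|x| ^+ 3 / t ^+ 2 = dl * (u ^+ 2 * (u / X)).
  by rewrite xE /X; field; rewrite !gt_eqF.
have -> : (x / dl) ^+ 2 = u ^+ 2.
  by rewrite /u !expr_div_n real_normK ?num_real.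
have -> : `|x| `^ p * dl `^ (1 - p) = dl * u `^ p.
  rewrite xE powRM// ?(ltW dl0)// -mulrA -powRD; last by apply/implyP => _; rewrite gt_eqF.
  by rewrite [p + _]addrC subrK powRr1 ?(ltW dl0)// mulrC.
have w0 := wt_ge0 p^-1 X.
have Xi0 : 0 <= X^-1 by rewrite invr_ge0 ltW.
suff : u ^+ 2 * (u / X) <= 2 * (u ^+ 2 * (wt p^-1 X / X)) + u `^ p.
  by move/(ler_wpM2l (ltW dl0)); lra.
have up0 := powR_ge0 u p.
have uw0 : 0 <= u ^+ 2 * (wt p^-1 X / X) by rewrite mulr_ge0 ?sqr_ge0// mulr_ge0.
case: (lerP u (wt p^-1 X)) => uw.
  have : u ^+ 2 * (u / X) <= u ^+ 2 * (wt p^-1 X / X).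
    by rewrite ler_wpM2l ?sqr_ge0// ler_wpM2r.
  lra.
suff : u ^+ 2 * (u / X) <= u `^ p by lra.
apply: (@le_trans _ _ X^-1).
  by rewrite mulrA ler_piMl// -exprSr exprn_ile1.
have -> : X^-1 = wt p^-1 X `^ p.
  rewrite /wt -expRM mulrAC mulNr mulVf ?gt_eqF// mulN1r expRN lnK ?posrE//.
by rewrite ge0_ler_powR ?nnegrE// ltW.
Qed.

End W1_bound.

(** * N-functions and their inverses *)

Section N_functions.
Variables (R : realType) (psi : R -> R).
Hypothesis Npsi : N_function psi.

Lemma N_function_conv (t x y : R) : 0 <= t <= 1 -> 0 <= x -> 0 <= y ->
  psi (t * x + (1 - t) * y) <= t * psi x + (1 - t) * psi y.
Proof.
move=> /andP[t0 t1] x0 y0; have [cpsi _ _ _ _] := Npsi.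
have t01 : (0 <= t) && (t <= 1) by rewrite t0.
have hx : (x : R^o) \in (`[0, +oo[%classic : set R^o) by rewrite inE/= in_itv/= x0.
have hy : (y : R^o) \in (`[0, +oo[%classic : set R^o) by rewrite inE/= in_itv/= y0.
exact: (cpsi (Itv01 t0 t1) _ _ hx hy).
Qed.

Lemma N_function_ge0 x : 0 <= x -> 0 <= psi x.
Proof.
have [_ p0 pp _ _] := Npsi.
by rewrite le_eqVlt => /predU1P[<-|/pp/ltW//]; rewrite p0.
Qed.

(** Convexity between 0 and [y], with [psi 0 = 0]; strict monotonicity follows. *)
Lemma N_function_star x y : 0 <= x -> x <= y -> 0 < y -> psi x <= x / y * psi y.
Proof.
move=> x0 xy y0; have [_ p0 _ _ _] := Npsi.
have t01 : 0 <= x / y <= 1 by rewrite divr_ge0 ?(ltW y0)//= ler_pdivrMr// mul1r.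
have := N_function_conv t01 (ltW y0) (lexx 0).
by rewrite p0 !mulr0 !addr0 divfK// gt_eqF.
Qed.

Lemma N_function_lt x y : 0 <= x -> x < y -> psi x < psi y.
Proof.
move=> x0 xy; have y0 : 0 < y by exact: le_lt_trans xy.
apply: le_lt_trans (N_function_star x0 (ltW xy) y0) _.
have [_ _ pp _ _] := Npsi.
by rewrite gtr_pMl ?pp// ltr_pdivrMr// mul1r.
Qed.

Lemma N_function_le x y : 0 <= x -> x <= y -> psi x <= psi y.
Proof.
move=> x0; rewrite le_eqVlt => /predU1P[->//|xy]; exact/ltW/N_function_lt.
Qed.

(** The witness is the supremum of the sublevel set. Convexity replaces continuity: interpolation
    towards [2 * A] excludes [psi A > N], and interpolation towards [B0] excludes [psi A < N]. *)
Lemma N_function_surj N : 0 < N -> exists2 A, 0 < A & psi A = N.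
Proof.
move=> N0; have [_ p0 pp _ pinf] := Npsi.
have [M [_ hM]] : \forall x \near +oo, N + 1 <= psi x / x.
  by move/cvgryPge : pinf; apply.
pose B0 := Num.max M 1 + 1.
have big x : B0 <= x -> N < psi x.
  move=> Bx; have x1 : 1 < x.
    by apply: lt_le_trans Bx; rewrite /B0 ltr_pwDr// le_max lexx orbT.
  have Mx : M < x.
    by apply: lt_le_trans Bx; rewrite /B0 ltr_pwDr// le_max lexx.
  have := hM _ Mx; rewrite ler_pdivlMr; last lra.
  nra.
pose S := [set x | 0 <= x /\ psi x <= N].
have S0 : S 0 by split=> //; rewrite p0 ltW.
have ubS : ubound S B0.
  by move=> x [x0 xN]; rewrite leNgt; apply/negP => /ltW/big; rewrite ltNge xN.
have supS : has_sup S by split; [exists 0|exists B0].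
pose A := sup S.
have A0 : 0 <= A by apply: ub_le_sup => //; exists B0.
have AB : A <= B0 by apply: ge_sup => //; exists 0.
have B00 : 0 < B0.
  by rewrite /B0 ltr_pwDr// le_max ler01 orbT.
suff AN : psi A = N.
  exists A => //; rewrite lt_neqAle A0 andbT; apply/eqP => A00.
  by move: N0; rewrite -AN -A00 p0 ltxx.
apply/eqP; rewrite eq_le; apply/andP; split; rewrite leNgt; apply/negP => h.
- have Apos : 0 < A.
    rewrite lt_neqAle A0 andbT; apply/eqP => A00.
    by move: h; rewrite -A00 p0 ltNge ltW.
  have P2 : 0 < psi (2 * A) by apply: pp; rewrite mulr_gt0.
  (* With [x > A - e], the weight [t <= (A - x) / A] of the point [2 * A] is so small that its
     contribution stays below [psi A - N]. *)
  pose e := A * ((psi A - N) / psi (2 * A)).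
  have e0 : 0 < e by rewrite mulr_gt0// divr_gt0// subr_gt0.
  have [x [x0 xN] xA] : exists2 x, S x & A - e < x by exact: sup_adherent.
  have xA' : x <= A by apply: ub_le_sup; [exists B0|split].
  have d0 : 0 < 2 * A - x by lra.
  pose t := (A - x) / (2 * A - x).
  have t0 : 0 <= t by rewrite divr_ge0//; lra.
  have t1 : t <= 1 by rewrite ler_pdivrMr//; lra.
  have tA : t <= (A - x) / A by rewrite ler_wpM2l ?subr_ge0// lef_pV2 ?posrE//; lra.
  have AE : A = t * (2 * A) + (1 - t) * x.
    have : t * (2 * A - x) = A - x by rewrite divfK// gt_eqF.
    lra.
  have := @N_function_conv t (2 * A) x; rewrite -AE t0 t1 => /(_ isT).
  move=> /(_ _ x0) hc; have := hc (ltW (mulr_gt0 _ Apos)) => {}hc.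
  have {}hc := hc (ltr0Sn _ _).
  have tx : (1 - t) * psi x <= N.
    have := N_function_ge0 x0; nra.
  have te : t * psi (2 * A) < psi A - N.
    rewrite -ltr_pdivlMr//; apply: le_lt_trans tA _.
    by rewrite ltr_pdivrMr// mulrC -/e ltrBlDr addrC -ltrBlDr.
  lra.
- have hB : N < psi B0 by exact: big.
  have pB : 0 < psi B0 by exact: lt_trans hB.
  have AltB : A < B0.
    rewrite lt_neqAle AB andbT; apply/eqP => AB'.
    by move: h; rewrite AB' ltNge ltW.
  pose t := (N - psi A) / psi B0.
  have pA := N_function_ge0 A0.
  have t0 : 0 < t by rewrite divr_gt0// subr_gt0.
  have t1 : t <= 1 by rewrite ler_pdivrMr//; lra.
  have t01 : 0 <= t <= 1 by rewrite ltW.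
  have hc := N_function_conv t01 (ltW B00) A0.
  have tB : t * psi B0 = N - psi A by rewrite divfK// gt_eqF.
  have Sx : S (t * B0 + (1 - t) * A).
    split; first by rewrite addr_ge0// mulr_ge0//; lra.
    apply: le_trans hc _; rewrite tB; nra.
  have : t * B0 + (1 - t) * A <= A by apply: ub_le_sup => //; exists B0.
  have : 0 < t * (B0 - A) by rewrite mulr_gt0// subr_gt0.
  lra.
Qed.

Lemma psi_invP N : 0 < N -> 0 < psi_inv psi N /\ psi (psi_inv psi N) = N.
Proof.
move=> N0; have [A A0 AN] := N_function_surj N0.
suff -> : psi_inv psi N = A by [].
rewrite -AN /psi_inv pinvKV//; last by rewrite inE/= in_itv/= ltW.
move=> x y; rewrite !inE/= !in_itv/= !andbT => x0 y0 xy.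
case: (ltgtP x y) => // h.
  by have := N_function_lt x0 h; rewrite xy ltxx.
by have := N_function_lt y0 h; rewrite xy ltxx.
Qed.

Lemma measurable_N_function d (T : measurableType d) (f : T -> R) :
  measurable_fun setT f -> (forall w, 0 <= f w) ->
  measurable_fun setT (fun w => psi (f w)).
Proof.
move=> mf f0; rewrite (_ : (fun w => _) = (fun x => psi (Num.max x 0)) \o f).
  apply: measurableT_comp mf; apply: nondecreasing_measurable => // x y xy.
  by apply: N_function_le; [rewrite le_max lexx orbT|rewrite ge_max !le_max xy lexx orbT].
by apply/funext => w /=; congr psi; apply/esym/max_idPl.
Qed.

End N_functions.

(** The bridge from moment conditions, stated in the extended reals, to real integrals of truncated
    functions. *)
Lemma sum_Rintegral_le d (T : measurableType d) (R : realType) (P : probability T R)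
    (n : nat) (f : nat -> T -> R) (G : nat -> T -> R) (c : R) : 0 <= c ->
  (forall k, (k < n)%N -> P.-integrable setT (EFin \o f k)) ->
  (forall k w, (k < n)%N -> 0 <= f k w <= c * G k w) ->
  (forall k, (k < n)%N -> measurable_fun setT (G k)) ->
  (forall k w, (k < n)%N -> 0 <= G k w) ->
  (\sum_(k < n) \int[P]_w (G k w)%:E <= 1)%E ->
  \sum_(k < n) \int[P]_w f k w <= c.
Proof.
move=> c0 iF fG mG G0 sG.
rewrite -lee_fin -sumEFin; apply: (@le_trans _ _ (c%:E * 1)%E); last by rewrite mule1.
apply: le_trans (lee_wpmul2l _ sG); last by rewrite lee_fin.
rewrite ge0_sume_distrr; last first.
  by move=> k _; apply: integral_ge0 => w _; rewrite lee_fin G0.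
apply: lee_sum => k _.
have mk : measurable_fun setT (EFin \o G k) by apply/measurable_EFinP; exact: mG.
rewrite -(@ge0_integralZl_EFin _ _ _ P setT _ (EFin \o G k))//; last first.
  by move=> w _; rewrite lee_fin G0.
rewrite /Rintegral fineK; last by apply: integrable_fin_num => //; exact: iF.
apply: ge0_le_integral => //.
- by move=> w _; rewrite lee_fin; have /andP[] := fG _ w (ltn_ord k).
- by have /measurable_int := iF _ (ltn_ord k).
- by apply: measurable_funeM.
- by move=> w _; rewrite -EFinM lee_fin; have /andP[] := fG _ w (ltn_ord k).
Qed.

Lemma K3_ge0 (R : realType) : 0 <= K3 R.
Proof.
have [K2a _ _] := K2_ge R; have e := expR_ge0 (20 : R).
have k1 : 0 <= K1 R by rewrite /K1 sqr_ge0.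
rewrite /K3; lra.
Qed.

Lemma log_term_EFin (R : realType) (L : R) : 0 < L ->
  log_term L%:E = (ln (expR 1 + (L ^+ 2)^-1))%:E.
Proof.
move=> L0; rewrite /log_term -EFin_expe inver gt_eqF ?exprn_gt0// -EFinD lne_EFin//.
by rewrite addr_gt0 ?expR_gt0// invr_gt0 exprn_gt0.
Qed.

Lemma log_term_y (R : realType) : log_term (+oo : \bar R)%E = 1%E.
Proof.
by rewrite /log_term expe2 mulyy invey adde0 lne_EFin ?expR_gt0// expRK.
Qed.

Lemma ppowE (R : realType) (p dl x : R) : 0 < dl -> `|x| <= dl ->
  ppow p dl x = dl * (`|x| / dl) `^ p.
Proof.
move=> dl0 xd; rewrite /ppow xd; set u := `|x| / dl.
have u0 : 0 <= u by rewrite divr_ge0// ltW.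
have -> : `|x| = u * dl by rewrite /u divfK// gt_eqF.
rewrite powRM// ?(ltW dl0)// -mulrA -powRD; last by apply/implyP => _; rewrite gt_eqF.
by rewrite [p + _]addrC subrK powRr1 ?(ltW dl0)// mulrC.
Qed.

(** * Thresholds from the Lyapunov coefficients *)

Section final.
Context (n : nat) (d : measure_display) (T : measurableType d) (R : realType)
    (P : probability T R) (F : nat -> set (set T))
    (Y : nat -> {RV P >-> R}) (sigma2 : nat -> T -> R).
Hypothesis n1 : (1 <= n)%N.
Hypothesis filtF : filtration n F.
Hypothesis mdY : martingale_difference n F Y.
Hypothesis cvY : conditional_variances n F Y sigma2.
Local Notation s := (s_ n Y).
Hypothesis s0 : 0 < s.
Local Notation intg f := (P.-integrable setT (EFin \o f)).
Local Notation y := (ndiff n Y).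
Local Notation v := (nvar n Y sigma2).
Local Notation W := (W1_normal n Y).
Local Notation V2 := (V2_term n Y sigma2).
Local Notation C := (4 * K3 R).
Local Notation tail dl := (\sum_(k < n) \int[P]_w tail2 dl (y k w) <= dl ^+ 2).

Let Hm : mdiff P (trunc_filt n F) y v.
Proof. exact: normalized_mdiff. Qed.

Lemma V2_ge0 : (0 <= V2)%E.
Proof. exact: poweR_ge0. Qed.

(** The factor 4 covers the 2 of [W1_log] and the 2 lost when the threshold is only within a factor
    2 of the coefficient. *)
Lemma bound_trans (a b : R) : 0 <= a -> a <= 4 * b ->
  (W <= (K3 R)%:E * (a%:E + V2) -> W <= C%:E * (b%:E + V2))%E.
Proof.
move=> a0 ab h; apply: (le_trans h); rewrite mulrC EFinM -muleA.
apply: lee_wpmul2l; first by rewrite lee_fin K3_ge0.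
rewrite ge0_muleDr ?V2_ge0 ?lee_fin//; last by lra.
apply: leeD; first by rewrite -EFinM lee_fin.
by rewrite lee_pemull ?V2_ge0// lee_fin; lra.
Qed.

Lemma final_log L dl : 0 < L -> L <= dl -> dl <= 2 * L -> tail dl ->
  (W <= C%:E * (L%:E * log_term L%:E + V2))%E.
Proof.
move=> L0 Ld dL td; have dl0 : 0 < dl by exact: lt_le_trans Ld.
rewrite log_term_EFin// -EFinM.
have h := W1_log filtF mdY cvY s0 dl0 td.
apply: (bound_trans _ _ h).
  by rewrite !mulr_ge0 ?(ltW dl0)// ln_ge0//; have := @expR_ge1Dx R 1;
    have : 0 <= (dl ^+ 2)^-1 by [rewrite invr_ge0 sqr_ge0]; lra.
set ld := ln _; set lL := ln _.
have i0 (x : R) : 0 < x -> 0 < expR 1 + (x ^+ 2)^-1.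
  by move=> x0; rewrite addr_gt0 ?expR_gt0// invr_gt0 exprn_gt0.
have dL' : ld <= lL.
  rewrite ler_ln ?posrE ?i0// lerD2l lef_pV2 ?posrE ?exprn_gt0//.
  by apply: lerXn2r; rewrite ?nnegrE ?(ltW dl0) ?(ltW L0).
have ld0 : 0 <= ld.
  rewrite ln_ge0//; have := @expR_ge1Dx R 1.
  have : 0 <= (dl ^+ 2)^-1 by rewrite invr_ge0 sqr_ge0.
  lra.
have : dl * ld <= 2 * L * lL by apply: ler_pM => //; exact: ltW.
lra.
Qed.

Lemma final_power p L dl : 2 < p -> 0 < dl -> dl <= 2 * L -> tail dl ->
  \sum_(k < n) \int[P]_w ppow p dl (y k w) <= dl ->
  (W <= C%:E * (p%:E * L%:E + V2))%E.
Proof.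
move=> p2 dl0 dL td pd; rewrite -EFinM.
have h := W1_power filtF mdY cvY s0 p2 dl0 td pd.
apply: (bound_trans _ _ h).
  by rewrite mulr_ge0 ?(ltW dl0)//; lra.
have : p * dl <= p * (2 * L) by rewrite ler_wpM2l//; lra.
have : 0 <= p * (2 * L) by rewrite mulr_ge0//; lra.
lra.
Qed.

(** If [L] were 0, every positive threshold would be admissible, against [tail_lower_bound].
    Positivity keeps [log_term] finite. *)
Lemma tail_pos L : 0 <= L -> (forall dl, 0 < dl -> L <= dl -> tail dl) -> 0 < L.
Proof.
move=> L0 h; rewrite lt_neqAle L0 andbT; apply/eqP => Le.
have n0 : 0 < n.+1%:R :> R by [].
(* At this threshold [n.+1 * dl^2] is [1 / (4 * n.+1)], which is less than 1. *)
have dl0 : 0 < (2 * n.+1%:R)^-1 :> R by rewrite invr_gt0 mulr_gt0.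
have := tail_lower_bound filtF mdY cvY s0 (h _ dl0 _).
rewrite -Le (ltW dl0) => /(_ isT).
have n2 : 1 <= n.+1%:R :> R by rewrite ler1n.
have -> : n.+1%:R * (2 * n.+1%:R)^-1 ^+ 2 = 4^-1 * n.+1%:R^-1 :> R.
  by field; rewrite gt_eqF.
have : n.+1%:R^-1 <= 1 :> R by rewrite invf_le1.
by move: (n.+1%:R^-1) => z; lra.
Qed.

Lemma tail_mono a b : 0 < a -> a <= b -> tail a -> tail b.
Proof.
move=> a0 ab ta; apply: (@le_trans _ _ (a ^+ 2)); last first.
  by apply: lerXn2r; rewrite ?nnegrE ?(ltW a0)//; exact: le_trans (ltW a0) ab.
apply: le_trans ta; apply: ler_sum => k _; apply: le_RintegralT.
- exact: tail2_int Hm b k.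
- exact: tail2_int Hm a k.
- move=> w; rewrite /tail2; case: (ltP b) => yb; first by rewrite (le_lt_trans ab yb).
  by case: ifP => // _; exact: sqr_ge0.
Qed.

Lemma y_norm k w : (k < n)%N -> `|y k w| = `|Y k.+1 w| / s.
Proof. by move=> kn; rewrite /ndiff kn normrM normfV (gtr0_norm s0). Qed.

Lemma ppow_int p dl k : 0 <= p -> 0 < dl -> intg (fun w => ppow p dl (y k w)).
Proof.
move=> p0 dl0; apply: (@integrable_le _ _ _ _ _ (fun=> dl)).
- apply: (measurableT_comp (measurable_ppow p dl)).
  exact: integrable_measurable (md_iy Hm k).
- exact: integrable_cst_real.
- by move=> w; rewrite ger0_norm ?ppow_ge0// ppow_le.
Qed.

Section orlicz.
Variable psi : R -> R.
Hypothesis Npsi : N_function psi.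
Hypothesis psi2 : preccurly (fun x => x `^ 2) psi.
Local Notation A := (psi_inv psi n%:R).

Let n0 : 0 < n%:R :> R. Proof. by rewrite ltr0n. Qed.
Let A0 : 0 < A. Proof. by have [] := psi_invP Npsi n0. Qed.
Let AN : psi A = n%:R. Proof. by have [] := psi_invP Npsi n0. Qed.

Variable c : R.
Hypothesis c0 : 0 < c.
Hypothesis cP : ((n%:R^-1)%:E *
      \sum_(1 <= i < n.+1) 'E_P[(fun w => psi (`|Y i w| / c))%R] <= 1)%E.

(** [|y k w|] reaches [dl] exactly when [|Y k.+1 w| / c] reaches [A], where [psi] takes the value
    [n]. *)
Let dl := s^-1 * c * A.
Let dl0 : 0 < dl. Proof. by rewrite !mulr_gt0// invr_gt0. Qed.
Let x k w := `|Y k.+1 w| / c.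
Let x0 k w : 0 <= x k w. Proof. by rewrite divr_ge0// ltW. Qed.

Let yx k w : (k < n)%N -> `|y k w| = x k w / A * dl.
Proof.
move=> kn; rewrite y_norm// /x /dl; field.
by rewrite !gt_eqF.
Qed.

Let G k w := psi (x k w) / n%:R.

Let G0 k w : 0 <= G k w.
Proof. by rewrite divr_ge0// N_function_ge0. Qed.

Let mG k : measurable_fun setT (G k).
Proof.
apply: measurable_funM => //; apply: measurable_N_function => //.
by apply: measurable_funM => //; apply: measurableT_comp.
Qed.

Let sumG : (\sum_(k < n) \int[P]_w (G k w)%:E <= 1)%E.
Proof.
apply: le_trans cP; rewrite big_add1/= big_mkord ge0_sume_distrr; last first.
  by move=> k _; apply: expectation_ge0 => w; rewrite N_function_ge0// x0.
apply: lee_sum => k _; rewrite unlock -ge0_integralZl_EFin ?invr_ge0//.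
- by rewrite le_eqVlt; apply/orP; left; apply/eqP; apply: eq_integral => w _;
    rewrite /G EFinM muleC.
- by move=> w _; rewrite lee_fin N_function_ge0// x0.
- apply/measurable_EFinP; apply: measurable_N_function => //; last exact: x0.
  by apply: measurable_funM => //; apply: measurableT_comp.
Qed.

(** Above [A], monotonicity of [psi x / x^2] gives [(x / A)^2 <= psi x / n], and the right sides
    have total mean at most 1. *)
Lemma orlicz_tail : tail dl.
Proof.
apply: (@sum_Rintegral_le _ _ _ P n (fun k w => tail2 dl (y k w)) G) => //.
- exact: sqr_ge0.
- by move=> k _; exact: tail2_int Hm dl k.
- move=> k w kn; rewrite tail2_ge0/=.
  have dG : 0 <= dl ^+ 2 * G k w by rewrite mulr_ge0 ?sqr_ge0.
  rewrite /tail2; case: ltP => // yd.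
  have xA : A < x k w.
    by move: yd; rewrite yx// ltr_pMl// ltr_pdivlMr// mul1r.
  have xp : 0 < x k w by exact: lt_trans xA.
  have := psi2 (x := A) (y := x k w).
  rewrite !in_itv/= !andbT A0 xp => /(_ isT isT (ltW xA)).
  rewrite AN !powR_mulrn ?(ltW A0)// ler_pdivrMr ?exprn_gt0// => h.
  rewrite -real_normK ?num_real// yx// exprMn mulrC ler_wpM2l ?sqr_ge0//.
  rewrite expr_div_n ler_pdivrMr ?exprn_gt0// /G mulrAC ler_pdivlMr//.
  move: h; rewrite mulrAC ler_pdivlMr ?exprn_gt0//; lra.
Qed.

(** Below [A], monotonicity of [x^p / psi x] gives [(x / A)^p <= psi x / n]. *)
Lemma orlicz_ppow p : 2 < p -> preccurly psi (fun x => x `^ p) ->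
  \sum_(k < n) \int[P]_w ppow p dl (y k w) <= dl.
Proof.
move=> p2 psip; have p0 : 0 <= p by lra.
apply: (@sum_Rintegral_le _ _ _ P n (fun k w => ppow p dl (y k w)) G) => //.
- exact: ltW.
- by move=> k _; apply: ppow_int.
- move=> k w kn; rewrite ppow_ge0/=.
  have dG : 0 <= dl * G k w by rewrite mulr_ge0// ltW.
  case: (lerP `|y k w| dl) => yd; last by rewrite /ppow (lt_geF yd).
  rewrite ppowE// ler_wpM2l ?(ltW dl0)//.
  have -> : `|y k w| / dl = x k w / A by rewrite yx// mulfK// gt_eqF.
  have xA : x k w <= A.
    by move: yd; rewrite yx// ger_pMl// ler_pdivrMr// mul1r.
  have := x0 k w; rewrite le_eqVlt => /predU1P[xe|xp].
    by rewrite -xe mul0r powR0 ?G0// gt_eqF//; lra.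
  have := psip (x k w) A.
  rewrite !in_itv/= !andbT A0 xp => /(_ isT isT xA).
  have [_ _ pp _ _] := Npsi.
  rewrite AN ler_pdivrMr ?pp// => h.
  have Ap : 0 < A `^ p by rewrite powR_gt0.
  have e : (x k w / A) `^ p * A `^ p = x k w `^ p.
    have xA0 : 0 <= x k w / A by rewrite divr_ge0// ltW.
    by rewrite -(powRM _ xA0 (ltW A0)) divfK// gt_eqF.
  rewrite -(ler_pM2r Ap) e.
  by move: h; rewrite /G; congr (_ <= _); ring.
Qed.

End orlicz.

Lemma W1_psi_log (psi : R -> R) : N_function psi ->
  preccurly (fun x => x `^ 2) psi ->
  (W <= C%:E * (L_psi n Y psi * log_term (L_psi n Y psi) + V2))%E /\
  forall p, 2 < p -> preccurly psi (fun x => x `^ p) ->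
  (W <= C%:E * (p%:E * L_psi n Y psi + V2))%E.
Proof.
move=> Npsi psi2; have n0 : 0 < n%:R :> R by rewrite ltr0n.
have [A0 AN] := psi_invP Npsi n0; set A := psi_inv psi n%:R in A0 AN.
have C0 : 0 < C by have := K2_ge R => -[h _ _]; have := expR_gt0 (20 : R);
  have : 0 <= K1 R by [rewrite /K1 sqr_ge0]; rewrite /K3; lra.
have V20 := V2_ge0.
have sA : 0 < s^-1 * A by rewrite mulr_gt0// invr_gt0.
have K0 : (0 <= orlicz_norm n Y psi)%E.
  by apply: le_ereal_inf_tmp => _ [c [c0 _] <-]; rewrite lee_fin ltW.
have LE : L_psi n Y psi = (orlicz_norm n Y psi * (s^-1 * A)%:E)%E.
  by rewrite /L_psi -/A muleAC [RHS]muleC EFinM.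
(* At an infinite norm [log_term] is 1 and both right sides are infinite. *)
rewrite LE; case E : (orlicz_norm n Y psi) K0 => [K| |]// K0; last first.
  rewrite gt0_mulye ?lte_fin// log_term_y mule1.
  have V2y : (+oo + V2 = +oo)%E by rewrite addye// gt_eqF// (lt_le_trans _ V20).
  rewrite V2y gt0_muley ?lte_fin//; split; first exact: leey.
  move=> p p2 _; rewrite gt0_muley ?lte_fin; last lra.
  by rewrite V2y gt0_muley ?lte_fin// leey.
rewrite -EFinM; set L := K * _.
have feas e : K < e -> exists2 c, c < e & 0 < c /\ K <= c /\ ((n%:R^-1)%:E *
      \sum_(1 <= i < n.+1) 'E_P[(fun w => psi (`|Y i w| / c))%R] <= 1)%E.
  move=> Ke.
  have : (orlicz_norm n Y psi < e%:E)%E by rewrite E lte_fin.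
  move=> /ereal_inf_lt[_ [c [c0 cP] <-]]; rewrite lte_fin => ce.
  exists c => //; split=> //; split=> //.
  by rewrite -lee_fin -E; apply: ereal_inf_lbound; exists c.
(* If [K] were 0, there would be admissible [c] arbitrarily close to 0, hence admissible thresholds
   below any [dl]. *)
have Kpos : 0 < K.
  rewrite lt_neqAle -lee_fin K0 andbT; apply/eqP => K00.
  suff : 0 < 0 :> R by rewrite ltxx.
  apply: tail_pos => // dl dl0 _.
  have [|c cdl [c0 [_ cP]]] := feas (dl / (s^-1 * A)); first by rewrite -K00 divr_gt0.
  apply: tail_mono (orlicz_tail Npsi psi2 c0 cP).
    by rewrite !mulr_gt0// invr_gt0.
  by rewrite -/A mulrAC mulrC ltW// -ltr_pdivlMr.
have Lpos : 0 < L by rewrite mulr_gt0.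
(* The infimum need not be known to be attained; an admissible [c] below [2 * K] puts the threshold
   between [L] and [2 * L]. *)
have [|c c2 [c0 [Kc cP]]] := feas (2 * K); first by rewrite ltr_pMl// ltr1n.
have dE : s^-1 * c * A = c * (s^-1 * A) by ring.
have Ld : L <= s^-1 * c * A by rewrite dE ler_wpM2r// ltW.
have dL : s^-1 * c * A <= 2 * L by rewrite dE /L mulrA ler_wpM2r// ltW.
have dl0 : 0 < s^-1 * c * A by exact: lt_le_trans Ld.
have td := orlicz_tail Npsi psi2 c0 cP.
split; first exact: final_log Lpos Ld dL td.
move=> p p2 psip; apply: (final_power p2 dl0 dL td _).
by apply: orlicz_ppow.
Qed.

Lemma W1_Lp p : 2 < p ->
  (W <= C%:E * (mine p%:E (log_term (L_p n Y p)) * L_p n Y p + V2))%E.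
Proof.
move=> p2; have p0 : 0 < p by lra.
have C0 : 0 < C by have := K2_ge R => -[h _ _]; have := expR_gt0 (20 : R);
  have : 0 <= K1 R by [rewrite /K1 sqr_ge0]; rewrite /K3; lra.
have V20 := V2_ge0.
have si : 0 < s^-1 by rewrite invr_gt0.
have V2y : (+oo + V2 = +oo)%E by rewrite addye// gt_eqF// (lt_le_trans _ V20).
rewrite /L_p; set M := (\sum_(1 <= i < n.+1) _)%E.
have M0 : (0 <= M)%E.
  by apply: sume_ge0 => k _; apply: expectation_ge0 => w; exact: powR_ge0.
case E : M M0 => [m| |]// M0; last first.
  rewrite poweRyr ?invr_neq0 ?gt_eqF// gt0_muley ?lte_fin// log_term_y.
  have -> : mine p%:E 1%E = 1%E :> \bar R by apply/min_idPr; rewrite lee_fin; lra.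
  by rewrite mul1e V2y gt0_muley ?lte_fin// leey.
have m0 : 0 <= m by [].
rewrite poweR_EFin -EFinM; set L := s^-1 * _.
have L0 : 0 <= L by rewrite mulr_ge0 ?powR_ge0// ltW.
(* For [dl >= L] these have total mean at most 1; they dominate [(y / dl)^2] where [|y| > dl], and
   equal [ppow / dl] where [|y| <= dl]. The threshold can be [L] itself. *)
pose G dl k w := (`|y k w| / dl) `^ p.
have GE dl k w : (k < n)%N -> 0 < dl -> G dl k w = (s * dl) `^ (- p) * `|Y k.+1 w| `^ p.
  move=> kn dl0; rewrite /G y_norm// powRN.
  have sd : 0 < s * dl by rewrite mulr_gt0.
  have -> : `|Y k.+1 w| / s / dl = `|Y k.+1 w| / (s * dl) by rewrite invfM mulrA.
  have q0 : 0 <= `|Y k.+1 w| / (s * dl) by rewrite divr_ge0// ltW.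
  have e : (`|Y k.+1 w| / (s * dl)) `^ p * (s * dl) `^ p = `|Y k.+1 w| `^ p.
    by rewrite -(powRM _ q0 (ltW sd)) divfK// gt_eqF.
  by rewrite -e [RHS]mulrC mulfK// gt_eqF// powR_gt0.
have mG dl k : measurable_fun setT (G dl k).
  apply: (measurableT_comp (measurable_powR p)); apply: measurable_funM => //.
  by apply: measurableT_comp => //; exact: integrable_measurable (md_iy Hm k).
have sumG dl : 0 < dl -> L <= dl -> (\sum_(k < n) \int[P]_w (G dl k w)%:E <= 1)%E.
  move=> dl0 Ld; have sd : 0 < s * dl by rewrite mulr_gt0.
  have -> : (\sum_(k < n) \int[P]_w (G dl k w)%:E = ((s * dl) `^ (- p))%:E * M)%E.
    rewrite /M big_add1/= big_mkord ge0_sume_distrr; last first.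
      by move=> k _; apply: expectation_ge0 => w; exact: powR_ge0.
    apply: eq_bigr => k _; rewrite unlock -ge0_integralZl_EFin ?powR_ge0//.
    - by apply: eq_integral => w _; rewrite GE.
    - apply/measurable_EFinP; apply: (measurableT_comp (measurable_powR p)).
      exact: measurableT_comp.
  rewrite E -EFinM lee_fin powRN ler_pdivrMl ?powR_gt0// mulr1.
  have h : m `^ p^-1 <= s * dl by move: Ld; rewrite /L ler_pdivrMl.
  have -> : m = (m `^ p^-1) `^ p by rewrite -powRrM mulVf ?powRr1// gt_eqF.
  by apply: ge0_ler_powR; rewrite ?nnegrE ?powR_ge0// ltW.
have tailG dl : 0 < dl -> L <= dl -> tail dl.
  move=> dl0 Ld.
  apply: (@sum_Rintegral_le _ _ _ P n (fun k w => tail2 dl (y k w)) (G dl)) => //.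
  - exact: sqr_ge0.
  - by move=> k _; exact: tail2_int Hm dl k.
  - move=> k w kn; rewrite tail2_ge0/=.
    have u0 : 0 <= `|y k w| / dl by rewrite divr_ge0// ltW.
    rewrite /tail2; case: ltP => yd; last by rewrite mulr_ge0 ?sqr_ge0 ?powR_ge0.
    have u1 : 1 <= `|y k w| / dl by rewrite ler_pdivlMr// mul1r ltW.
    have -> : y k w ^+ 2 = dl ^+ 2 * (`|y k w| / dl) ^+ 2.
      by rewrite expr_div_n real_normK ?num_real// mulrCA divff ?mulr1// gt_eqF// exprn_gt0.
    rewrite ler_wpM2l ?sqr_ge0// -powR_mulrn// /G.
    by apply: ler_powR => //; exact: ltW.
  - by move=> k w _; exact: powR_ge0.
  - exact: sumG.
have Lpos : 0 < L by exact: tail_pos.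
have L2 : L <= 2 * L by rewrite ler_peMl// ler1n.
have td := tailG _ Lpos (lexx _).
case: (leP p%:E (log_term L%:E)) => _; last first.
  by rewrite [X in (_ * (X + _))%E]muleC; exact: final_log Lpos (lexx _) L2 td.
apply: (final_power p2 Lpos L2 td _).
apply: (@sum_Rintegral_le _ _ _ P n (fun k w => ppow p L (y k w)) (G L)) => //.
- by move=> k _; apply: ppow_int => //; exact: ltW.
- move=> k w kn; rewrite ppow_ge0/=.
  case: (lerP `|y k w| L) => yd; first by rewrite ppowE.
  by rewrite /ppow (lt_geF yd) mulr_ge0 ?powR_ge0.
- by move=> k w _; exact: powR_ge0.
- exact: sumG.
Qed.

(** For a threshold at least [L_infty], almost surely no jump exceeds it, so the tails integrate to
    0 and the logarithmic bound applies. *)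
Lemma W1_Linfty :
  (W <= C%:E * (L_infty n Y * log_term (L_infty n Y) + V2))%E.
Proof.
have C0 : 0 < C by have := K2_ge R => -[h _ _]; have := expR_gt0 (20 : R);
  have : 0 <= K1 R by [rewrite /K1 sqr_ge0]; rewrite /K3; lra.
have V20 := V2_ge0.
have si : 0 < s^-1 by rewrite invr_gt0.
have V2y : (+oo + V2 = +oo)%E by rewrite addye// gt_eqF// (lt_le_trans _ V20).
rewrite /L_infty; set M := (\big[maxe/0]_(1 <= i < n.+1) _)%E.
have M0 : (0 <= M)%E by exact: bigmax_ge_id.
have Mk k : (k < n)%N -> ('N[P]_(+oo)[EFin \o Y k.+1] <= M)%E.
  move=> kn; rewrite /M big_add1/= big_mkord.
  exact: (le_bigmax _ (fun i : 'I_n => 'N[P]_(+oo)[EFin \o Y i.+1])%E (Ordinal kn)).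
case E : M M0 => [m| |]// M0; last first.
  by rewrite gt0_muley ?lte_fin// log_term_y mule1 V2y gt0_muley ?lte_fin// leey.
have m0 : 0 <= m by [].
rewrite -EFinM; set L := s^-1 * m.
have L0 : 0 <= L by rewrite mulr_ge0// ltW.
have tailG dl : 0 < dl -> L <= dl -> tail dl.
  move=> dl0 Ld; rewrite big1 ?sqr_ge0// => k _.
  have PT : (0 < P [set: T])%E by rewrite probability_setT lte01.
  have := Mk k (ltn_ord k); rewrite E Lnorm.unlock PT.
  move=> /ess_supP h; rewrite /Rintegral (_ : (\int[P]_w _ = 0)%E)//.
  rewrite -(integral0 P setT); apply: ae_eq_integral => //.
  - by have /measurable_int := tail2_int Hm dl k.
  - apply: filterS h => w /=; rewrite lee_fin => Yw _.
    rewrite /tail2 ltNge y_norm// ler_pdivrMr// mulrC.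
    by rewrite (le_trans Yw)// -ler_pdivrMl.
have Lpos : 0 < L by exact: tail_pos.
have L2 : L <= 2 * L by rewrite ler_peMl// ler1n.
exact: final_log Lpos (lexx _) L2 (tailG _ Lpos (lexx _)).
Qed.

End final.

Theorem theorem5 (R : realType) :
  exists C : R, 0 < C /\
  forall (n : nat) (d : measure_display) (T : measurableType d)
    (P : probability T R) (F : nat -> set (set T))
    (Y : nat -> {RV P >-> R}) (sigma2 : nat -> T -> R),
  (1 <= n)%N ->
  filtration n F ->
  F 0%N = [set set0; setT] ->
  square_integrable n Y ->
  martingale_difference n F Y ->
  conditional_variances n F Y sigma2 ->
  0 < s_ n Y ->
  [/\ forall psi : R -> R, N_function psi ->
        preccurly (fun x => x `^ 2) psi ->
        (W1_normal n Y <=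
          C%:E * (L_psi n Y psi * log_term (L_psi n Y psi)
                  + V2_term n Y sigma2))%E,
      forall (p : R) (psi : R -> R), 2 < p -> N_function psi ->
        preccurly (fun x => x `^ 2) psi ->
        preccurly psi (fun x => x `^ p) ->
        (W1_normal n Y <=
          C%:E * (p%:E * L_psi n Y psi + V2_term n Y sigma2))%E,
      forall p : R, 2 < p ->
        (W1_normal n Y <=
          C%:E * (mine p%:E (log_term (L_p n Y p)) * L_p n Y p
                  + V2_term n Y sigma2))%E &
      (W1_normal n Y <=
        C%:E * (L_infty n Y * log_term (L_infty n Y)
                + V2_term n Y sigma2))%E].
Proof.
exists (4 * K3 R); split.
  have := K2_ge R => -[h _ _]; have := expR_gt0 (20 : R);
  have : 0 <= K1 R by [rewrite /K1 sqr_ge0]; rewrite /K3; lra.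
move=> n d T P F Y sigma2 n1 filtF _ _ mdY cvY s0; split.
- by move=> psi Npsi psi2; have [] := W1_psi_log n1 filtF mdY cvY s0 Npsi psi2.
- move=> p psi p2 Npsi psi2 psip.
  by have [_] := W1_psi_log n1 filtF mdY cvY s0 Npsi psi2; apply.
- by move=> p p2; have := W1_Lp filtF mdY cvY s0 p2.
- by have := W1_Linfty filtF mdY cvY s0.
Qed.
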